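(* Let $(\mathcal{S}_\alpha)_{\alpha<\omega_1}$ be a good transfinite Schreier sequence, let $p\in[1,\infty)$ and let $1\leqslant\alpha<\omega_1$. Then every surjective isometry $T:\mathbb{S}\to\mathbb{S}$ of the unit sphere $\mathbb{S}$ of $X_{\mathcal{S}_\alpha,p}$ can be extended to a linear surjective isometry of $X_{\mathcal{S}_\alpha,p}$. Moreover, if $p\in\{1,2\}$, the same conclusion holds for an arbitrary transfinite Schreier sequence $(\mathcal{S}_\alpha)_{\alpha<\omega_1}$, i.e. it is not necessary to assume that it is good.
   Context: All vector spaces are real; $\mathbb{N}$ starts at $1$; $\omega_1$ is the first uncountable ordinal; an isometry is a distance-preserving map. For finite sets $E,E'\subset\mathbb{N}$ and $n\in\mathbb{N}$, $n\leqslant E$ means $n\leqslant\min E$ and $E<E'$ means $\max E<\min E'$; these are considered true whenever one of the sets involved is empty. A transfinite Schreier sequence is a sequence $(\mathcal{S}_\alpha)_{0\leqslant\alpha<\omega_1}$ of families of finite subsets of $\mathbb{N}$ such that: $\mathcal{S}_0=\{F\subset\mathbb{N}: |F|\leqslant1\}$; $\mathcal{S}_{\beta+1}=\{\bigcup_{i=1}^nE_i:\ n\in\mathbb{N},\ n\leqslant E_1<E_2<\dots<E_n,\ E_i\in\mathcal{S}_\beta\}$ for every $\beta<\omega_1$; and for limit $\alpha$, $\mathcal{S}_\alpha=\{F\subset\mathbb{N}: F\in\mathcal{S}_{\alpha_n}\text{ for some }n\leqslant F\}$, where $(\alpha_n)_{n\in\mathbb{N}}$ is a preassigned strictly increasing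 sequence of non-zero ordinals with $\sup_n\alpha_n=\alpha$ (the approximating sequence of $\alpha$). The sequence $(\mathcal{S}_\alpha)_{\alpha<\omega_1}$ is good if for every limit ordinal $\alpha<\omega_1$ the approximating sequence consists of successor ordinals $\alpha_n=\beta_n+1$ and $(\mathcal{S}_{\beta_n})_{n\in\mathbb{N}}$ is increasing for inclusion. Let $c_{00}$ be the space of finitely supported real sequences, with canonical basis $(e_i)_{i\in\mathbb{N}}$. For $p\in[1,\infty)$, $X_{\mathcal{S}_\alpha,p}$ is the completion of $c_{00}$ for the norm $\|x\|=\sup\{(\sum_{i\in F}|x(i)|^p)^{1/p}: F\in\mathcal{S}_\alpha\}$. *)

(* Defs.v *)
From HB Require Import structures.
From mathcomp Require Import all_boot all_order all_algebra.
From mathcomp Require Import finmap.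
From mathcomp Require Import all_classical all_reals all_analysis.

Set Implicit Arguments.
Unset Strict Implicit.
Unset Printing Implicit Defensive.

Import Order.TTheory GRing.Theory Num.Theory.
Import numFieldNormedType.Exports.

Local Open Scope classical_set_scope.
Local Open Scope ring_scope.

(* N starts at 1. *)
Notation posN := {n : nat | (0 < n)%N}.

(* A total order is (order-isomorphic to) omega_1, the set of countable
   ordinals, iff it is an uncountable well-order all of whose proper initial
   segments are countable. *)
Definition is_omega1 (d : Order.disp_t) (W : orderType d) : Prop :=
  [/\ wochoice.well_order (<=%O : rel W),
      ~ countable [set: W]
    & forall a : W, countable [set b : W | (b < a)%O]].

Section Ordinals.
Context {d : Order.disp_t} {W : orderType d}.

Definition is_zero (a : W) : Prop := forall b : W, (a <= b)%O.

(* is_succ b a : a = b + 1 *)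
Definition is_succ (b a : W) : Prop :=
  (b < a)%O /\ forall c : W, (b < c)%O -> (a <= c)%O.

Definition is_limit (a : W) : Prop :=
  ~ is_zero a /\ ~ exists b : W, is_succ b a.

End Ordinals.

(* Both relations hold when a set involved is empty. *)
Definition fset_ge (n : posN) (E : {fset posN}) : Prop :=
  forall i : posN, i \in E -> (val n <= val i)%N.

Definition fset_lt (E E' : {fset posN}) : Prop :=
  forall i i' : posN, i \in E -> i' \in E' -> (val i < val i')%N.

Section Schreier.
Context {d : Order.disp_t} {W : orderType d}.
Implicit Types (approx : W -> posN -> W) (S : W -> set {fset posN}).

Definition approximates (u : posN -> W) (a : W) : Prop :=
  [/\ forall n : posN, ~ is_zero (u n),
      forall m n : posN, (val m < val n)%N -> (u m < u n)%O
    & supremums (range u) a].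

(* approx a is the approximating sequence of the limit ordinal a; its values
   at other ordinals play no role.  In the successor step, the chain
   n <= E_1 < ... < E_n is required of all the pairs of sets, not only of the
   consecutive ones: as E_i may be empty, the latter would impose nothing on
   the sets around an empty one. *)
Record schreier_sequence approx S : Prop := SchreierSequence {
  schreier_approx : forall a : W, is_limit a -> approximates (approx a) a;
  schreier_zero : forall a : W, is_zero a ->
    S a = [set F : {fset posN} | (#|` F| <= 1)%N];
  schreier_succ : forall b a : W, is_succ b a ->
    S a = [set F : {fset posN} |
      exists (n : posN) (E : 'I_(val n) -> {fset posN}),
        [/\ forall i, fset_ge n (E i),
            forall i i' : 'I_(val n), (i < i')%N -> fset_lt (E i) (E i'),
            forall i, S b (E i)
          & F = \big[fsetU/fset0]_(i < val n) E i]];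
  schreier_limit : forall a : W, is_limit a ->
    S a = [set F : {fset posN} |
      exists2 n : posN, fset_ge n F & S (approx a n) F]
}.

Definition good approx S : Prop :=
  forall a : W, is_limit a ->
    exists b : posN -> W,
      (forall n : posN, is_succ (b n) (approx a n)) /\
      (forall m n : posN, (val m <= val n)%N -> S (b m) `<=` S (b n)).

End Schreier.

Section C00.
Context {R : realType}.

Definition c00_pred : {pred posN -> R^o} :=
  fun x => `[< finite_set [set i | x i != 0] >].

Lemma c00_submod_closed : submod_closed c00_pred.
Proof.
split=> [|a x y /asboolP fx /asboolP fy]; apply/asboolP.
  rewrite (_ : [set _ | _] = set0) //.
  by apply/seteqP; split=> i //=; rewrite eqxx.
apply: (@sub_finite_set _ _ ([set i | x i != 0] `|` [set i | y i != 0])).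
  move=> i /=; have [xi0|] := eqVneq (x i) 0; last by left.
  have [yi0|] := eqVneq (y i) 0; last by right.
  by rewrite !fctE /= xi0 yi0 scaler0 addr0 eqxx.
by rewrite finite_setU.
Qed.

HB.instance Definition _ :=
  GRing.isSubmodClosed.Build R (posN -> R^o) c00_pred c00_submod_closed.

End C00.

Record c00 (R : realType) := C00 {
  c00_val :> posN -> R^o;
  c00_valP : c00_val \in c00_pred
}.

HB.instance Definition _ (R : realType) := [isSub for @c00_val R].
HB.instance Definition _ (R : realType) := [Choice of c00 R by <:].
HB.instance Definition _ (R : realType) :=
  [SubChoice_isSubLmodule of c00 R by <:].

(* The real supremum is the actual one: for x in c00 and a Schreier family,
   the set is nonempty and bounded. *)
Definition schreier_norm (R : realType) (S : set {fset posN}) (p : R)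
    (x : c00 R) : R :=
  sup [set (\sum_(i <- F) `|x i| `^ p) `^ p^-1 | F in S].

(* (X, j) is the completion of the normed space (c00, N), which is unique up
   to a linear isometry. *)
Definition is_completion (R : realType) (N : c00 R -> R)
    (X : completeNormedModType R) (j : {linear c00 R -> X}) : Prop :=
  (forall x : c00 R, `|j x| = N x) /\ dense (range j).

Definition unit_sphere (R : realType) (X : normedModType R) : set X :=
  [set x : X | `|x| = 1].
Arguments unit_sphere {R} X.

Definition isometry_on (R : realType) (X Y : normedModType R) (A : set X)
    (f : X -> Y) : Prop :=
  forall x y : X, A x -> A y -> `|f x - f y| = `|x - y|.

(* The values of T outside the unit sphere are irrelevant. *)
Definition sphere_isometries_extend (R : realType) (X : normedModType R)
    : Prop :=
  forall T : X -> X,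
    set_fun (unit_sphere X) (unit_sphere X) T ->
    set_surj (unit_sphere X) (unit_sphere X) T ->
    isometry_on (unit_sphere X) T ->
    exists U : {linear X -> X},
      [/\ isometry_on [set: X] U, set_surj [set: X] [set: X] U
        & forall x : X, unit_sphere X x -> U x = T x].

(* Main.v *)
Require Import Defs.
From HB Require Import structures.
From mathcomp Require Import all_boot all_order all_algebra.
From mathcomp Require Import finmap.
From mathcomp Require Import all_classical all_reals all_analysis.
From mathcomp Require Import zify ring lra.
Import Order.TTheory GRing.Theory Num.Theory.
Import numFieldNormedType.Exports.
Local Open Scope classical_set_scope.
Local Open Scope ring_scope.

(** Let X be the completion for a Schreier family F and T a surjective
    isometry of its sphere. The set of the y with |y + z| = 2 is a face of the
    sphere for suitable centres z: the unit vectors supported in F if p > 1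
    (the face then prescribes y on the support of z), the uniform signed
    vectors on maximal sets of F if p = 1 (the face prescribes the signs and
    the norm on the set). The points antipodal to x, i.e. at distance 2 from
    x, form a union of opposites of such faces, a minimal one exactly when x
    lies on a single face; hence T permutes the faces, and the opposite faces
    accordingly. As {1} is the only set of F containing 1, the face of e_1 is
    the only one, up to sign, that meets every face but its opposite: T acts
    on the first coordinate by a sign. Next, T maps every e_i to some +- e_k.
    For p > 1, e_i is told apart from the other unit vectors whose face is a
    point modulo e_1 by Clarkson's inequality if p <> 2; if p = 2, by the
    property that every face whose points are all at distance at least sqrt 2
    is equidistant from it. For p = 1, e_i is the intersection of a face with
    the opposite of its mirror image in the i-th coordinate. Distances to +-
    e_i and to faces then give the coordinate (T x)_k whenever i belongs to a
    set of F that is norming for x. In general, replace x_i by the two values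
    +- Y for which such a set exists and |x_i| <= Y: both points are at
    distance |Y -+ x_i| from x, which determines (T x)_k. *)

Set Implicit Arguments.
Unset Strict Implicit.
Unset Printing Implicit Defensive.

(** * Schreier families *)

(** Nothing is known of T beyond distances between unit vectors, not even T (- x) = - T x. The
    extreme distance 2 carries the most information: where it is attained, the triangle inequality
    is an equality in every coordinate of some set of F. This presupposes that the supremum in the
    norm is attained at every point of the completion and not only on [c00]; attainment comes from
    the compactness of F. The equality case explains the two kinds of centres: for p > 1 strict
    convexity forces equal coordinates, for p = 1 only equal signs. Since no other set of F contains
    1, the first coordinate is decoupled from the rest: it can take any value in [-1, 1] without
    leaving a face whose centre vanishes there. This is why uniqueness on a face is only ever
    claimed modulo e_1. The other indices do interact, because F contains all pairs of them. Once
    every coordinate of T x is a signed coordinate of x, the homogeneous extension of T is linear,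
    because the coordinates separate the points. *)

Definition pone : posN := exist _ 1%N isT.

Lemma posN_one_or_gt (i : posN) : i = pone \/ (1 < val i)%N.
Proof.
have := valP i; rewrite leq_eqVlt => /orP[/eqP h|h]; last by right.
by left; apply/val_inj.
Qed.

Definition hereditary (F : set {fset posN}) :=
  forall A B : {fset posN}, F B -> (A `<=` B)%fset -> F A.

Definition spreading (F : set {fset posN}) :=
  forall (phi : posN -> posN) (A : {fset posN}), F A ->
    (forall i, i \in A -> (val i <= val (phi i))%N) ->
    (forall i j, i \in A -> j \in A -> (val i < val j)%N ->
       (val (phi i) < val (phi j))%N) ->
    F [fset phi i | i in A]%fset.

Definition unbounded (L : set posN) :=
  forall n : nat, exists2 i : posN, L i & (n < val i)%N.

(** For a hereditary family this is compactness in the Cantor space: no infinite set has all its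
    finite subsets in [F]. *)
Definition no_unbounded (F : set {fset posN}) :=
  forall L : set posN, unbounded L ->
    exists2 A : {fset posN}, (forall i, i \in A -> L i) & ~ F A.

(** The interface between combinatorics and analysis: once [schreier_family_seq] is proved, ordinals
    only matter for the membership of pairs and triples. *)
Record schreier_family (F : set {fset posN}) : Prop := {
  schreier_sub : hereditary F;
  schreier_spread : spreading F;
  schreier_compact : no_unbounded F;
  schreier_sing : forall i, F [fset i]%fset;
  schreier_one : forall A, F A -> pone \in A -> A = [fset pone]%fset
}.

(** Moving [a] to [b] may jump over elements of [A], and is then not monotone. Induction on the
    number of elements jumped over: for such an element [c], move [c] to [b], and then [a] to
    [c]. *)
Lemma spreading_shift (F : set {fset posN}) : spreading F ->
  forall (A : {fset posN}) (a b : posN), F A -> a \in A -> b \notin A ->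
    (val a < val b)%N -> F (b |` (A `\ a))%fset.
Proof.
move=> Fs A a b.
move: {2}(#|` [fset i in A | (val a < val i < val b)%N]|)%fset (leqnn (#|` [fset i in A | (val a < val i < val b)%N]|)%fset) => n.
elim: n A a b => [|n IH] A a b hn FA aA bA ab.
  have {hn} mid i : i \in A -> (val a < val i)%N -> (val i < val b)%N -> False.
    move=> iA ai ib; move: hn; rewrite leqn0 cardfs_eq0 => /eqP/fsetP/(_ i).
    by rewrite !inE /= iA ai ib.
  suff -> : (b |` (A `\ a))%fset = [fset (if i == a then b else i) | i in A]%fset.
    apply: Fs => // [i iA|i j iA jA ij].
      by case: eqP => // ->; exact: ltnW.
    case: eqP ij => [->|ia] ij.
      case: eqP ij => [->|ja]; first by rewrite ltnn.
      move=> aj; rewrite ltnNge leq_eqVlt; apply/negP => /orP[/eqP/val_inj jb|jb].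
        by rewrite -jb jA in bA.
      exact: (mid j).
    case: eqP ij => [->|ja] ij //; exact: ltn_trans ab.
  apply/fsetP => k; rewrite !inE; apply/idP/idP.
    case/orP => [/eqP ->|/andP[ka kA]].
      by apply/imfsetP; exists a => //=; rewrite eqxx.
    by apply/imfsetP; exists k => //=; rewrite (negbTE ka).
  case/imfsetP => i /= iA ->; case: (eqVneq i a) => [_|ia]; first by rewrite eqxx.
  by rewrite iA ?ia /= orbT.
case: (pselect (exists2 c, c \in A & (val a < val c < val b)%N)); last first.
  move=> hno; apply: (IH) => //.
  rewrite (_ : [fset _ | _ in _ & _]%fset = fset0) ?cardfs0 //.
  apply/fsetP => i; rewrite !inE /=; apply/negP => /andP[iA h].
  by apply: hno; exists i.
case=> c cA /andP[ac cb].
have cardlt (x y : posN) (B : {fset posN}) d : d \in A -> (val a < val d < val b)%N ->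
    ([fset i in B | (val x < val i < val y)%N] `<=` [fset i in A | (val a < val i < val b)%N] `\ d)%fset ->
    (#|` [fset i in B | (val x < val i < val y)%N]| <= n)%N%fset.
  move=> dA dab /fsubset_leq_card h.
  have := cardfsD1 d [fset i in A | (val a < val i < val b)%N]%fset.
  have -> : d \in [fset i in A | (val a < val i < val b)%N]%fset by rewrite !inE /= dA.
  by move=> e; rewrite e add1n in hn; rewrite -ltnS; apply: leq_trans hn; rewrite ltnS.
have ca : c != a by apply: contraTneq ac => ->; rewrite ltnn.
have F1 : F (b |` (A `\ c))%fset.
  apply: IH => //; apply: (cardlt _ _ _ c) => //; first by rewrite ac cb.
  apply/fsubsetP => i; rewrite !inE /= => /andP[-> /andP[ci ->]].
  rewrite (ltn_trans ac ci) !andbT; apply: contraTneq ci => ->; by rewrite ltnn.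
have -> : (b |` (A `\ a) = c |` ((b |` (A `\ c)) `\ a))%fset.
  apply/fsetP => k; rewrite !inE.
  have ba : b != a by apply: contraTneq ab => ->; rewrite ltnn.
  case: (eqVneq k c) => [->|kc] /=; first by rewrite ca cA orbT.
  by case: (eqVneq k b) => [->|kb] //=; rewrite ba.
have cb' : c != b by apply: contraTneq cb => ->; rewrite ltnn.
have m1 : a \in (b |` (A `\ c))%fset by rewrite !inE aA (eq_sym a c) ca orbT.
have m2 : c \notin (b |` (A `\ c))%fset by rewrite !inE (negbTE cb') ?eqxx.
apply: IH => //.
apply: (cardlt _ _ _ c) => //; first by rewrite ac cb.
apply/fsubsetP => i; rewrite !inE /= => /andP[/orP[/eqP->|/andP[ic iA]] /andP[ai ic']].
  by move: ic'; rewrite ltnNge (ltnW cb).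
by rewrite ic iA ai (ltn_trans ic' cb).
Qed.

Lemma unbounded_above (L : set posN) (m : nat) :
  unbounded L -> unbounded [set i | L i /\ (m < val i)%N].
Proof.
move=> uL n; have [i Li] := uL (maxn m n).
by rewrite gtn_max => /andP[mi ni]; exists i.
Qed.

Definition chain_unions (F : set {fset posN}) (n : nat) : set {fset posN} :=
  [set A : {fset posN} | exists E : 'I_n -> {fset posN},
    [/\ forall i i' : 'I_n, (i < i')%N -> fset_lt (E i) (E i'),
        forall i, F (E i) & forall x, x \in A -> exists i, x \in E i]].

(** Choose [A] in [L] outside [F], so that the first block misses some [f] of [A]. If [f] is in a
    later block, the first block ends before [f], and whatever lies beyond [A] has to be covered by
    the other blocks: induction applies to the part of [L] above [A]. *)
Lemma chain_unions_no_unbounded (F : set {fset posN}) (n : nat) :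
  hereditary F -> no_unbounded F -> no_unbounded (chain_unions F n).
Proof.
move=> Fh Fc; elim: n => [|n IH] L uL.
  have [i Li _] := uL 0%N; exists [fset i]%fset.
    by move=> k; rewrite inE => /eqP ->.
  by case=> E [_ _ /(_ i)]; rewrite inE eqxx => /(_ isT) [[]].
have [A AL nA] := Fc _ uL.
pose m := (\max_(i <- A) val i)%N.
have Am i : i \in A -> (val i <= m)%N.
  by move=> iA; apply: (@leq_bigmax_seq _ _ predT (fun i : posN => val i)).
have [B BL nB] := IH _ (unbounded_above m uL).
exists (A `|` B)%fset.
  by move=> i; rewrite inE => /orP[/AL//|/BL[]].
case=> E [El EF Ec].
have [f fA fE] : exists2 f, f \in A & f \notin E ord0.
  apply: contrapT => h; apply: nA; apply: (Fh _ _ (EF ord0)).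
  by apply/fsubsetP => x xA; apply: contrapT => /negP xE; apply: h; exists x.
have [s fs] : exists s, f \in E s by apply: Ec; rewrite inE fA.
have s0 : (0 < s)%N.
  by rewrite lt0n; apply: contraNneq fE => s0; rewrite (_ : ord0 = s) //; apply/val_inj.
apply: nB; exists (fun i => E (lift ord0 i)); split.
- by move=> i i' ii'; apply: El; rewrite !lift0.
- by move=> i; exact: EF.
move=> x xB; have [i xi] : exists i, x \in E i by apply: Ec; rewrite inE xB orbT.
case: (unliftP ord0 i) xi => [k ->|->] xi; first by exists k.
have := El ord0 s s0 _ _ xi fs; have [_ mx] := BL _ xB.
by move=> /ltn_trans/(_ (leq_ltn_trans (Am _ fA) mx)); rewrite ltnn.
Qed.

(** Otherwise elements could be added for ever, and the infinite union would have all its finite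
    subsets in [F], against compactness. *)
Lemma maximal_superset (F : set {fset posN}) (A : {fset posN}) :
  no_unbounded F -> hereditary F -> F A ->
  exists B, [/\ F B, (A `<=` B)%fset & forall k, F (k |` B)%fset -> k \in B].
Proof.
move=> Fc Fh FA; apply: contrapT => hno.
have step (B : {fset posN}) : {k : posN | F B -> (A `<=` B)%fset -> k \notin B /\ F (k |` B)%fset}.
  apply: cid; case: (pselect (F B /\ (A `<=` B)%fset)) => [[FB AB]|h]; last first.
    by exists pone => h1 h2; case: h.
  apply: contrapT => h; apply: hno; exists B; split => // k Fk.
  by apply: contrapT => /negP kB; apply: h; exists k.
pose B := fix B n := if n is n'.+1 then (sval (step (B n')) |` B n')%fset else A.
have Bp n : F (B n) /\ (A `<=` B n)%fset.
  elim: n => [|n [FB AB]] /=; first by rewrite fsubset_refl.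
  case: (step _) => k /= /(_ FB AB)[_ ?]; split => //.
  by apply: fsubset_trans AB _; exact: fsubsetU1.
have Bc n : (n <= #|` B n|)%N.
  elim: n => // n IH /=; have [FB AB] := Bp n.
  by case: (step _) => k /= /(_ FB AB)[kB _]; rewrite cardfsU1 kB.
have Bm m n : (m <= n)%N -> (B m `<=` B n)%fset.
  elim: n => [|n IH]; first by rewrite leqn0 => /eqP ->.
  rewrite leq_eqVlt => /orP[/eqP ->//|/IH h].
  by apply: fsubset_trans h _; exact: fsubsetU1.
pose L := [set i | exists n, i \in B n].
have uL : unbounded L.
  move=> n; apply: contrapT => h.
  have : (B n.+1 `<=` [fset insubd pone (i : nat) | i in iota 1 n])%fset.
    apply/fsubsetP => i iB; apply/imfsetP; exists (val i) => /=; last by rewrite valKd.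
    rewrite mem_iota add1n ltnS (valP i) /= leqNgt; apply/negP => ni.
    by apply: h; exists i => //; exists n.+1.
  move=> /fsubset_leq_card /(leq_trans (Bc n.+1)) hc.
  have : (#|` [fset insubd pone (i : nat) | i in iota 1 n]%fset| <= size (iota 1 n))%N.
    have := leq_imfset_card imfset_key (fun i : nat => insubd pone i) (mem (iota 1 n)).
    move=> /leq_trans; apply.
    by apply: uniq_leq_size (enum_finmem_uniq _) _ => x; rewrite enum_finmemE.
  by move=> /(leq_trans hc); rewrite size_iota ltnn.
have [C CL nC] := Fc _ uL; apply: nC.
have /choice[f hf] : forall i, exists n, i \in C -> i \in B n.
  by move=> i; case: (boolP (i \in C)) => [/CL[n]|_]; [exists n|exists 0%N].
pose N := (\max_(i <- C) f i)%N.
have [FN _] := Bp N; apply: (Fh C (B N)) => //.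
apply/fsubsetP => i iC; apply: (fsubsetP (Bm (f i) N _)) (hf _ iC).
by apply: (@leq_bigmax_seq _ _ predT f).
Qed.

Lemma bigfcup_ordP (n : nat) (E : 'I_n -> {fset posN}) (x : posN) :
  reflect (exists i, x \in E i) (x \in (\big[fsetU/fset0]_(i < n) E i)%fset).
Proof.
apply: (iffP idP) => [|[i xi]].
  elim/big_rec: _ => [|i B _ IH]; first by rewrite in_fset0.
  by rewrite in_fsetU => /orP[xi|/IH//]; exists i.
rewrite (bigD1 i) //= in_fsetU xi //.
Qed.

(** * Transfinite induction along a Schreier sequence *)

Section SchreierSequence.
Context (d : Order.disp_t) (W : orderType d).
Context (approx : W -> posN -> W) (S : W -> set {fset posN}).
Context (W_wo : wochoice.well_order (<=%O : rel W)).
Context (S_schreier : schreier_sequence approx S).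

Lemma well_order_ind (P : W -> Prop) :
  (forall a, (forall b, (b < a)%O -> P b) -> P a) -> forall a, P a.
Proof.
move=> IH a; apply: contrapT => nPa.
have [|m [[mA mlow] _]] := @W_wo [pred x | `[< ~ P x >]].
  by exists a; exact/asboolP.
move/asboolP: mA; apply; apply: IH => b bm.
apply: contrapT => nPb; have : (m <= b)%O by apply: mlow; exact/asboolP.
by rewrite leNgt bm.
Qed.

(** The limit case also records that the approximating ordinals are not zero, for statements such as
    [schreier_increasing] that fail at zero. *)
Lemma schreier_ind (P : W -> Prop) :
  (forall a, is_zero a -> P a) ->
  (forall b a, is_succ b a -> P b -> P a) ->
  (forall a, is_limit a ->
     (forall n, ~ is_zero (approx a n) /\ P (approx a n)) -> P a) ->
  forall a, P a.
Proof.
move=> P0 Ps Pl; apply: well_order_ind => a IH.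
have [/P0//|nz] := pselect (is_zero a).
have [[b ba]|ns] := pselect (exists b, is_succ b a).
  by apply: (Ps b) => //; apply: IH; case: ba.
have la : is_limit a by [].
apply: Pl => // n; have [a0 amono [asup _]] := schreier_approx S_schreier la.
split; first exact: a0.
(* The supremum only gives [approx a n <= a]; comparison with the next term makes it strict. *)
apply: IH; pose n' : posN := exist _ (val n).+1 isT.
by apply: lt_le_trans (amono n n' (ltnSn _)) _; apply: asup; exists n'.
Qed.

Lemma schreier_succ_sub (b a : W) : is_succ b a -> S b `<=` S a.
Proof.
move=> ba A bA; rewrite (schreier_succ S_schreier ba) /=.
exists pone, (fun=> A); split => //.
- by move=> i k _; exact: valP.
- by move=> i i'; rewrite (ord1 i) (ord1 i').
- by rewrite big_ord_recl big_ord0 fsetU0.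
Qed.

Lemma schreier_family_seq (a : W) : schreier_family (S a).
Proof.
elim/schreier_ind : a => [a a0|b a ba [bsub bspread bcomp bsing bone]|a la IH].
- rewrite (schreier_zero S_schreier a0); split => /=.
  + by move=> A B /= hB /fsubset_leq_card/leq_trans; apply.
  + move=> phi A /= hA _ _; apply: leq_trans (leq_imfset_card _ _ _) _.
    apply: leq_trans hA; 
    by apply: uniq_leq_size (enum_finmem_uniq _) _ => x; rewrite enum_finmemE.
  + move=> L uL; have [i Li _] := uL 0%N; have [k Lk ik] := uL (val i).
    exists [fset i; k]%fset => /=.
      by move=> x; rewrite !inE => /orP[]/eqP->.
    by rewrite cardfs2; have -> : i != k by apply: contraTneq ik => ->; rewrite ltnn.
  + by move=> i /=; rewrite cardfs1.
  + move=> A /= hA oA; apply/esym/eqP; rewrite eqEfcard cardfs1 hA andbT.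
    by apply/fsubsetP => x; rewrite inE => /eqP->.
- split => //.
  + move=> A B; rewrite (schreier_succ S_schreier ba) => -[n [E [En El EF BE]]] AB /=.
    exists n, (fun i => E i `&` A)%fset; split.
    * by move=> i k; rewrite inE => /andP[/En].
    * by move=> i i' ii' k k'; rewrite !inE => /andP[h _] /andP[h' _]; apply: El ii' _ _ h h'.
    * by move=> i; apply: bsub (EF i) _; exact: fsubsetIl.
    * apply/fsetP => x; apply/idP/bigfcup_ordP => [xA|[i]]; last by rewrite inE => /andP[].
      have := fsubsetP AB _ xA; rewrite BE => /bigfcup_ordP[i xi].
      by exists i; rewrite inE xi xA.
  + move=> phi A; rewrite (schreier_succ S_schreier ba) => -[n [E [En El EF AE]]] hle hlt /=.
    have EA i x : x \in E i -> x \in A.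
      by move=> xE; rewrite AE; apply/bigfcup_ordP; exists i.
    exists n, (fun i => [fset phi x | x in E i])%fset; split.
    * by move=> i k /imfsetP[x /= xE ->]; apply: leq_trans (En _ _ xE) (hle _ (EA _ _ xE)).
    * move=> i i' ii' _ _ /imfsetP[x /= xE ->] /imfsetP[y /= yE ->].
      by apply: hlt (EA _ _ xE) (EA _ _ yE) _; apply: El ii' _ _ xE yE.
    * move=> i; apply: bspread (EF i) _ _ => [x /EA/hle//|x y /EA xA /EA yA].
      exact: hlt.
    * apply/fsetP => y; apply/imfsetP/bigfcup_ordP => /=.
        move=> [x]; rewrite AE => /bigfcup_ordP[i xE] ->; exists i.
        by apply/imfsetP; exists x.
      by move=> [i /imfsetP[x /= /EA xA ->]]; exists x.
  (* A set containing [l0] is a union of at most [l0] blocks. So one finite set suffices: [l0]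
     together with, for each [n <= l0], a set that [n] blocks cannot cover. *)
  + move=> L uL; have [l0 Ll0 _] := uL 0%N.
    have /choice[B hB] : forall n : nat, exists B : {fset posN}, (forall i, i \in B -> L i) /\ ~ chain_unions (S b) n B.
      by move=> n; have [B h1 h2] := @chain_unions_no_unbounded (S b) n bsub bcomp _ uL; exists B.
    exists (l0 |` \big[fsetU/fset0]_(n < (val l0).+1) B n)%fset.
      by move=> i; rewrite !inE => /orP[/eqP->//|/bigfcup_ordP[n /(hB n).1]].
    rewrite (schreier_succ S_schreier ba) => -[n [E [En El EF AE]]].
    have nl0 : (val n < (val l0).+1)%N.
      have /bigfcup_ordP[i li] : l0 \in (\big[fsetU/fset0]_(i < val n) E i)%fset by rewrite -AE !inE eqxx.
      by rewrite ltnS; apply: En li.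
    apply: (hB (val n)).2; exists E; split => // x xB.
    have /bigfcup_ordP[i xi] : x \in (\big[fsetU/fset0]_(i < val n) E i)%fset.
      by rewrite -AE !inE; apply/orP; right; apply/bigfcup_ordP; exists (Ordinal nl0).
    by exists i.
  + by move=> i; exact: (schreier_succ_sub ba).
  + move=> A; rewrite (schreier_succ S_schreier ba) => -[n [E [En El EF AE]]] oA.
    have /bigfcup_ordP[i oi] : pone \in (\big[fsetU/fset0]_(i < val n) E i)%fset by rewrite -AE.
    have n1 : val n = 1%N by apply/eqP; rewrite eqn_leq (En _ _ oi) (valP n).
    move: E i En El EF AE oi; rewrite n1 => E i En El EF AE oi.
    by apply: bone oA; rewrite AE big_ord_recl big_ord0 fsetU0.
- have {IH}IH n : schreier_family (S (approx a n)) by case: (IH n).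
  rewrite (schreier_limit S_schreier la); split => /=.
  + move=> A B /= [n nB FB] AB; exists n; first by move=> i /(fsubsetP AB)/nB.
    exact: (schreier_sub (IH n)) FB AB.
  + move=> phi A [n nA FA] hle hlt; exists n.
      by move=> _ /imfsetP[x /= xA ->]; apply: leq_trans (nA _ xA) (hle _ xA).
    exact: (schreier_spread (IH n)).
  (* The same device: the presence of [l0] bounds the index [n] of the approximating ordinal, so
     finitely many obstructions are put together. *)
  + move=> L uL; have [l0 Ll0 _] := uL 0%N.
    have /choice[B hB] : forall n : posN, exists B : {fset posN}, (forall i, i \in B -> L i) /\ ~ S (approx a n) B.
      by move=> n; have [B h1 h2] := schreier_compact (IH n) uL; exists B.
    exists (l0 |` \big[fsetU/fset0]_(n < (val l0).+1) B (insubd pone (val n)))%fset.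
      by move=> i; rewrite !inE => /orP[/eqP->//|/bigfcup_ordP[n /(hB _).1]].
    move=> [n nA FA]; apply: (hB n).2; apply: (schreier_sub (IH n)) FA _.
    have nl0 : (val n < (val l0).+1)%N by rewrite ltnS; apply: nA; rewrite !inE eqxx.
    apply: fsubset_trans (fsubsetU1 _ _); apply/fsubsetP => x xB.
    by apply/bigfcup_ordP; exists (Ordinal nl0) => //=; rewrite valKd.
  + by move=> i; exists pone; [move=> k _; exact: valP | exact: schreier_sing (IH pone) i].
  + by move=> A [n nA FA]; exact: (schreier_one (IH n) FA).
Qed.

(** These sets belong to the Schreier family of index 1, where the blocks are singletons. They
    persist at successors, and at limits because 1 lies below every set, so that the index [pone] is
    always admissible. *)
Lemma schreier_increasing (a : W) (n : nat) (f : 'I_n -> posN) :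
  ~ is_zero a -> (0 < n)%N -> (forall i, (n <= val (f i))%N) ->
  (forall i j : 'I_n, (i < j)%N -> (val (f i) < val (f j))%N) ->
  S a [fset f i | i in 'I_n]%fset.
Proof.
move=> + n0 fn fmono.
elim/schreier_ind : a => [a a0 /(_ a0)//|b a ba IH _|a la IH _].
- have [b0|/IH Sb] := pselect (is_zero b); last by apply: (schreier_succ_sub ba).
  rewrite (schreier_succ S_schreier ba) /=.
  exists (exist _ n n0), (fun i => [fset f i]%fset); split => /=.
  + by move=> i k; rewrite inE => /eqP->.
  + by move=> i i' ii' k k'; rewrite !inE => /eqP-> /eqP->; exact: fmono.
  + by move=> i; exact: schreier_sing (schreier_family_seq b) _.
  + apply/fsetP => x; apply/imfsetP/bigfcup_ordP => [[i _ ->]|[i]].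
      by exists i; rewrite inE.
    by rewrite inE => /eqP ->; exists i.
- rewrite (schreier_limit S_schreier la) /=; exists pone; first by move=> k _; exact: valP.
  by case: (IH pone) => h0; apply.
Qed.

Lemma schreier_pair (a : W) (i j : posN) :
  ~ is_zero a -> i != pone -> j != pone -> S a [fset i; j]%fset.
Proof.
move=> a0; wlog ij : i j / (val i <= val j)%N => [wh|] i1 j1.
  by have [/wh|/ltnW/wh] := leqP (val i) (val j); rewrite 1?fsetUC; apply.
have [->|nij] := eqVneq i j.
  by rewrite fsetUid; exact: schreier_sing (schreier_family_seq a) _.
have {nij ij}ij : (val i < val j)%N by rewrite ltn_neqAle ij andbT.
have i2 : (1 < val i)%N by case: (posN_one_or_gt i) => // e; rewrite e eqxx in i1.
pose f (k : 'I_2) := if k == ord0 then i else j.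
rewrite (_ : [fset i; j]%fset = [fset f k | k in 'I_2]%fset).
  apply: schreier_increasing => // [k|k l kl]; rewrite /f.
    by case: ifP => // _; exact: leq_trans i2 (ltnW ij).
  by case: k l kl => [[|[|k]] hk] [[|[|l]] hl].
apply/fsetP => x; rewrite !inE; apply/orP/imfsetP => [[]/eqP->|[k _ ->]].
- by exists ord0.
- by exists ord_max.
- by rewrite /f; case: ifP; rewrite eqxx; [left|right].
Qed.

Lemma schreier_triple (a : W) (i j k : posN) :
  ~ is_zero a -> (2 < val i)%N -> (val i < val j)%N -> (val j < val k)%N ->
  S a [fset i; j; k]%fset.
Proof.
move=> a0 i3 ij jk.
pose f (l : 'I_3) := if val l is 0%N then i else if val l is 1%N then j else k.
rewrite (_ : [fset i; j; k]%fset = [fset f l | l in 'I_3]%fset).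
  have j3 := ltn_trans i3 ij; have k3 := ltn_trans j3 jk; have ik := ltn_trans ij jk.
  by apply: schreier_increasing => // [[[|[|[|l]]] hl]|[[|[|[|l]]] hl] [[|[|[|m]]] hm]].
apply/fsetP => x; rewrite !inE; apply/idP/imfsetP => [|[l _ ->]].
  case/orP => [/orP[]|] /eqP->.
  - by exists ord0.
  - by exists (Ordinal (isT : (1 < 3)%N)).
  - by exists ord_max.
by case: l => [[|[|[|l]]] hl] //; rewrite /f /= eqxx ?orbT.
Qed.

End SchreierSequence.

(** * Coordinates on the completion *)

Definition psum (R : realType) (p : R) (A : {fset posN}) (f : posN -> R) : R :=
  \sum_(i <- A) `|f i| `^ p.

(** All that is retained of the completion. The last field, attainment of the supremum, is what
    turns an extremal distance into equalities on a set of [F]. Powers are used instead of norms to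
    avoid p-th roots. *)
Record coordinates (R : realType) (p : R) (F : set {fset posN})
    (X : normedModType R) (c : X -> posN -> R) (e : posN -> X) : Prop := {
  coord_lin : forall a x y i, c (a *: x + y) i = a * c x i + c y i;
  coord_e : forall i k, c (e i) k = (k == i)%:R;
  psum_le : forall A x, F A -> psum p A (c x) <= `|x| `^ p;
  psum_attained : forall x, exists2 A, F A & psum p A (c x) = `|x| `^ p
}.

Section PSum.
Context (R : realType) (p : R).
Implicit Types (A B : {fset posN}) (f g : posN -> R).

Lemma psum_ge0 A f : 0 <= psum p A f.
Proof. by apply: sumr_ge0 => i _; exact: powR_ge0. Qed.

Lemma psum0 f : psum p fset0 f = 0.
Proof. exact: big_seq_fset0. Qed.

Lemma eq_psum A f g : (forall i, i \in A -> `|f i| = `|g i|) -> psum p A f = psum p A g.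
Proof. by move=> fg; apply: eq_big_seq => i /fg ->. Qed.

Lemma psum1 i f : psum p [fset i]%fset f = `|f i| `^ p.
Proof. exact: big_seq_fset1. Qed.

Lemma psumU1 i A f : i \notin A -> psum p (i |` A)%fset f = `|f i| `^ p + psum p A f.
Proof. exact: big_fsetU1. Qed.

Lemma psumD1 i A f : i \in A -> psum p A f = `|f i| `^ p + psum p (A `\ i)%fset f.
Proof. exact: big_fsetD1. Qed.

Lemma psum_sub_eq A B f : (A `<=` B)%fset -> (forall i, i \in B -> i \notin A -> f i = 0) ->
  p != 0 -> psum p A f = psum p B f.
Proof.
move=> AB f0 p0; apply: big_fset_incl => // i iB iA.
by rewrite f0 // normr0 powR0.
Qed.

Lemma psum_sub A B f : (A `<=` B)%fset -> psum p A f <= psum p B f.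
Proof.
move=> AB; rewrite /psum.
rewrite (eq_big_seq (fun i => if i \in A then `|f i| `^ p else 0)) => [|i /= ->//].
rewrite (big_fset_incl _ AB) => [|i _ /negbTE->//].
by apply: ler_sum => i _; case: ifP => // _; exact: powR_ge0.
Qed.

End PSum.

(** * Coordinates of the completion and attainment of the norm *)

Section Completion.
Context (R : realType) (p : R) (F : set {fset posN}).
Context (X : completeNormedModType R) (j : {linear c00 R -> X}).
Context (p_ge1 : 1 <= p) (F_schreier : schreier_family F).
Context (X_completion : is_completion (schreier_norm F p) j).
Implicit Types (u v : c00 R) (x y : X) (f g : posN -> R) (A B : {fset posN}).

Let p_gt0 : 0 < p. Proof. exact: lt_le_trans ltr01 p_ge1. Qed.
Let p_neq0 : p != 0. Proof. by rewrite gt_eqF. Qed.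

Lemma c00_lin (a : R) u v i : (a *: u + v) i = a * u i + v i.
Proof. by []. Qed.

Lemma delta_c00 (i : posN) : (fun k : posN => (k == i)%:R : R^o) \in @c00_pred R.
Proof.
apply/asboolP; apply: (@sub_finite_set _ _ [set i]) => // k /=.
by have [->//|_] := eqVneq k i; rewrite eqxx.
Qed.

Definition delta (i : posN) : c00 R := C00 (delta_c00 i).

Definition vec A f : c00 R := \sum_(i <- A) f i *: delta i.

Lemma vecE A f k : vec A f k = if k \in A then f k else 0.
Proof.
have sumE (s : seq posN) : (\sum_(i <- s) f i *: delta i) k = \sum_(i <- s) f i * (k == i)%:R.
  elim: s => [|i s IH]; first by rewrite !big_nil.
  by rewrite !big_cons -IH c00_lin.
rewrite /vec sumE; case: ifP => kA.
  rewrite (big_fsetD1 k) //= eqxx mulr1 big1_seq ?addr0 // => i.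
  by rewrite !inE /= eq_sym => /andP[/negbTE->]; rewrite mulr0.
rewrite big1_seq // => i /= iA.
by rewrite (_ : k == i = false) ?mulr0 //; apply: contraFF kA => /eqP ->.
Qed.

Lemma schreier_norm_ub u : has_ubound [set (psum p A u) `^ p^-1 | A in F].
Proof.
have fu : finite_set [set i | u i != 0] by apply/asboolP; exact: c00_valP.
exists (psum p (fset_set [set i | u i != 0]) u `^ p^-1) => _ [A FA <-].
apply: ge0_ler_powR; rewrite ?nnegrE ?psum_ge0 ?invr_ge0 ?(ltW p_gt0) //.
rewrite -(@psum_sub_eq _ _ (A `&` fset_set [set i | u i != 0])%fset A) ?fsubsetIl //.
  by apply: psum_sub; exact: fsubsetIr.
move=> i iA; rewrite in_fsetI iA /= in_fset_set // notin_setE /= => h.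
by apply: contrapT => /eqP.
Qed.

Lemma schreier_norm_has_sup u : has_sup [set (psum p A u) `^ p^-1 | A in F].
Proof.
split; last exact: schreier_norm_ub.
exists (psum p [fset pone : posN]%fset u `^ p^-1).
by exists [fset pone : posN]%fset => //; exact: schreier_sing.
Qed.

Lemma norm_jE u : `|j u| = sup [set (psum p A u) `^ p^-1 | A in F].
Proof. exact: (proj1 X_completion). Qed.

Lemma psum_j_le u A : F A -> psum p A u `^ p^-1 <= `|j u|.
Proof.
by move=> FA; rewrite norm_jE; apply: ub_le_sup; [exact: schreier_norm_ub|exists A].
Qed.

Lemma coord_j_le u i : `|u i| <= `|j u|.
Proof.
have := psum_j_le u (schreier_sing F_schreier i).
by rewrite psum1 -powRrM mulfV // powRr1.
Qed.

Lemma norm_vec A f : F A -> `|j (vec A f)| = psum p A f `^ p^-1.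
Proof.
move=> FA; apply/le_anti/andP; split; last first.
  rewrite (@eq_psum _ _ A f (vec A f)) ?psum_j_le // => i iA.
  by rewrite vecE iA.
rewrite norm_jE; apply: ge_sup; first by case: (schreier_norm_has_sup (vec A f)).
move=> _ [B FB <-]; apply: ge0_ler_powR; rewrite ?nnegrE ?psum_ge0 ?invr_ge0 ?(ltW p_gt0) //.
rewrite -(@psum_sub_eq _ _ (B `&` A)%fset B) ?fsubsetIl //.
  rewrite (@eq_psum _ _ (B `&` A)%fset (vec A f) f) ?psum_sub ?fsubsetIr // => i.
  by rewrite inE vecE => /andP[_ ->].
by move=> i iB; rewrite inE iB /= vecE => /negbTE ->.
Qed.

Lemma exists_coord x : exists f : posN -> R, forall e, 0 < e ->
  exists2 u, `|j u - x| < e & forall i, `|u i - f i| <= e.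
Proof.
have /choice[u hu] : forall n : nat, exists u, `|j u - x| < n.+1%:R^-1.
  move=> n; have n0 : 0 < n.+1%:R^-1 :> R by rewrite invr_gt0.
  have [||z [/= xz [u _ uz]]] := proj2 X_completion (ball x n.+1%:R^-1).
  - by exists x; exact: ballxx.
  - exact: ball_open.
  by exists u; rewrite uz distrC; move: xz; rewrite -ball_normE.
have uu m n i : `|u m i - u n i| <= m.+1%:R^-1 + n.+1%:R^-1.
  have -> : u m i - u n i = (u m - u n) i by [].
  apply: le_trans (coord_j_le _ _) _; rewrite linearB /=.
  rewrite (_ : j (u m) - j (u n) = (j (u m) - x) - (j (u n) - x)).
    by apply: le_trans (ler_normB _ _) _; rewrite lerD // ltW.
  by rewrite opprB addrA subrK.
(* The limit of the i-th coordinates is obtained as a cut: each [u n i - n.+1%:R^-1] lies below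
   every [u m i + m.+1%:R^-1]. *)
pose E i := [set u n i - n.+1%:R^-1 | n in [set: nat]].
have Eub i m : ubound (E i) (u m i + m.+1%:R^-1).
  move=> _ [n _ <-]; have key (a b k l : R) : `|a - b| <= k + l -> a - k <= b + l.
    by rewrite ler_norml => /andP[_]; lra.
  exact: key (uu n m i).
have Esup i : has_sup (E i).
  split; first by exists (u 0%N i - 1%:R^-1); exists 0%N.
  by exists (u 0%N i + 1%:R^-1); exact: (Eub i 0%N).
exists (fun i => sup (E i)) => e e0.
have [n ne] : exists n, n.+1%:R^-1 < e.
  have [n _ hn] := near_infty_natSinv_lt (PosNum e0).
  by exists n; exact: (hn n (leqnn n)).
exists (u n); first exact: lt_trans (hu n) ne.
move=> i; apply: le_trans (ltW ne).
have h1 : u n i - n.+1%:R^-1 <= sup (E i) by apply: ub_le_sup; [by case: (Esup i)|exists n].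
have h2 : sup (E i) <= u n i + n.+1%:R^-1 by apply: ge_sup (Eub i n); case: (Esup i).
have key (a b k : R) : a - k <= b -> b <= a + k -> `|a - b| <= k.
  by rewrite ler_norml => *; apply/andP; split; lra.
exact: key h1 h2.
Qed.

Definition coord x : posN -> R := sval (cid (exists_coord x)).

Lemma coordP x e : 0 < e -> exists2 u, `|j u - x| < e & forall i, `|u i - coord x i| <= e.
Proof. by rewrite /coord; case: cid => f /= h /h. Qed.

(** The slack [k] is there for linear combinations: approximations of [x] and [y] up to [e] give one
    of [a *: x + y] up to [(|a| + 1) * e]. The divisor [2 * k + 2] in the proof collects the errors
    e', e' + k e' and k e'. *)
Lemma coord_unique x (k : R) f : 0 <= k ->
  (forall e, 0 < e -> exists2 u, `|j u - x| <= k * e & forall i, `|u i - f i| <= k * e) ->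
  coord x = f.
Proof.
move=> k0 h; apply/funext => i; apply/eqP; rewrite -subr_eq0 -normr_le0.
apply/ler_addgt0Pr => e e0; rewrite add0r.
have k1 : 0 < 2 * k + 2 by lra.
have e1 : 0 < e / (2 * k + 2) by rewrite divr_gt0.
have [u ux hu] := coordP x e1; have [v vx hv] := h _ e1.
set e' := e / _ in e1 ux vx hu hv.
have huv : `|u i - v i| <= e' + k * e'.
  apply: le_trans (coord_j_le (u - v) i) _; rewrite linearB /=.
  rewrite (_ : j u - j v = (j u - x) - (j v - x)).
    by apply: le_trans (ler_normB _ _) _; rewrite lerD // ltW.
  by rewrite opprB addrA subrK.
have key (a b c d : R) : `|a - b| <= e' -> `|a - c| <= e' + k * e' -> `|c - d| <= k * e' ->
    `|b - d| <= e.
  have -> : e = 2 * e' + 2 * k * e' by rewrite /e'; field; lra.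
  rewrite !ler_norml => /andP[? ?] /andP[? ?] /andP[? ?]; apply/andP; split; lra.
exact: key (hu i) huv (hv i).
Qed.

Lemma completion_coordD (a : R) x y i : coord (a *: x + y) i = a * coord x i + coord y i.
Proof.
rewrite (@coord_unique (a *: x + y) (`|a| + 1) (fun i => a * coord x i + coord y i)) ?addr_ge0 // => e e0.
have [u ux hu] := coordP x e0; have [v vx hv] := coordP y e0.
exists (a *: u + v).
  rewrite linearP /= opprD addrACA -scalerBr mulrDl mul1r.
  apply: le_trans (ler_normD _ _) _; rewrite normrZ lerD ?(ltW vx) //.
  by apply: ler_wpM2l => //; exact: ltW.
move=> k; rewrite c00_lin.
have -> : a * u k + v k - (a * coord x k + coord y k) =
          a * (u k - coord x k) + (v k - coord y k) by rewrite opprD addrACA -mulrBr.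
apply: le_trans (ler_normD _ _) _; rewrite mulrDl mul1r lerD ?hv //.
by rewrite normrM; apply: ler_wpM2l.
Qed.

Lemma coord_j u : coord (j u) = u.
Proof.
apply: (@coord_unique _ 0) => // e _; exists u; first by rewrite subrr normr0 mul0r.
by move=> i; rewrite subrr normr0 mul0r.
Qed.

Lemma completion_coordB x y i : coord (x - y) i = coord x i - coord y i.
Proof. by rewrite addrC -scaleN1r completion_coordD mulN1r addrC. Qed.

Lemma norm_vec_le A f (d : R) : (forall i, i \in A -> `|f i| <= d) ->
  `|j (vec A f)| <= #|` A|%:R * d.
Proof.
move=> fd; rewrite /vec linear_sum /=; apply: le_trans (ler_norm_sum _ _ _) _.
rewrite -sum1_size natr_sum mulr_suml big_seq [leRHS]big_seq; apply: ler_sum => i iA.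
rewrite linearZ /= normrZ mul1r -[leRHS]mulr1; apply: ler_pM => //; first exact: fd.
rewrite -(_ : vec [fset i]%fset (fun=> 1) = delta i) ?norm_vec ?psum1.
- by rewrite normr1 !powR1.
- exact: schreier_sing.
- by rewrite /vec big_seq_fset1 scale1r.
Qed.

Lemma vecB A f g : vec A (fun i => f i - g i) = vec A f - vec A g.
Proof. by rewrite /vec -sumrB; apply: eq_bigr => i _; rewrite scalerBl. Qed.

Lemma norm_vec_coord A x : F A -> `|j (vec A (coord x))| <= `|x|.
Proof.
move=> FA; apply/ler_addgt0Pr => e e0.
have k0 : 0 < 1 + #|` A|%:R :> R by have := ler0n R #|` A|; lra.
have e1 : 0 < e / (1 + #|` A|%:R) by rewrite divr_gt0.
have [u ux hu] := coordP x e1; set e' := e / _ in e1 ux hu.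
have h1 : `|j (vec A u)| <= `|j u| by rewrite norm_vec // psum_j_le.
have h2 : `|j u| <= `|x| + `|j u - x| by rewrite addrC -lerBlDr lerB_dist.
have h3 := norm_vec_le (A := A) (fun i _ => hu i).
rewrite vecB linearB /= in h3.
have h4 := lerB_dist (j (vec A (coord x))) (j (vec A u)).
rewrite distrC in h3.
have -> : e = e' + #|` A|%:R * e' by rewrite /e'; field; rewrite gt_eqF // -ltrBlDl.
lra.
Qed.

Lemma norm_vec_sup x e : 0 < e -> exists2 A, F A & `|x| - e < `|j (vec A (coord x))|.
Proof.
move=> e0; have e1 : 0 < e / 3 by rewrite divr_gt0.
have [u ux hu] := coordP x e1; set e' := e / 3 in e1 ux hu.
have [_ [A FA <-] hA] := sup_adherent e1 (schreier_norm_has_sup u).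
exists A => //; rewrite -norm_jE -norm_vec // in hA.
have h2 : `|x| <= `|j u| + `|j u - x| by rewrite addrC distrC -lerBlDr lerB_dist.
have h3 := norm_vec_coord (j u - x) FA.
have h4 : vec A (coord (j u - x)) = vec A u - vec A (coord x).
  by rewrite -vecB; congr (vec A _); apply/funext => i; rewrite completion_coordB coord_j.
rewrite h4 linearB /= in h3.
have h5 := lerB_dist (j (vec A u)) (j (vec A (coord x))).
have -> : e = e' + e' + e' by rewrite /e'; field.
lra.
Qed.

Definition initial (n : nat) A : {fset posN} := [fset i in A | (val i <= n)%N]%fset.

(** Beyond the support of an approximation [u] of [x], the coordinates of [x] are those of
    [x - j u], whose norm is small; the bound is therefore uniform in [A]. *)
Lemma norm_vec_tail x e : 0 < e -> exists n0 : nat, forall n A, F A -> (n0 <= n)%N ->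
  `|j (vec A (coord x))| <= `|j (vec (initial n A) (coord x))| + e.
Proof.
move=> e0; have [u ux hu] := coordP x e0.
have fu : finite_set [set i | u i != 0] by apply/asboolP; exact: c00_valP.
pose n0 := (\max_(i <- fset_set [set i | u i != 0%R]) val i)%N.
exists n0 => n A FA n0n.
have u0 i : (n < val i)%N -> u i = 0.
  move=> ni; apply: contrapT => /eqP ui.
  have : (val i <= n0)%N.
    by apply: (@leq_bigmax_seq _ _ predT (fun i : posN => val i)); rewrite // in_fset_set // inE.
  by move=> /leq_trans/(_ n0n); rewrite leqNgt ni.
have -> : vec A (coord x) = vec (initial n A) (coord x) +
          vec [fset i in A | (n < val i)%N]%fset (coord x).
  apply/val_inj/funext => i; rewrite -[LHS]/(vec A (coord x) i).
  rewrite -[RHS]/(vec (initial n A) (coord x) i +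
    vec [fset i in A | (n < val i)%N]%fset (coord x) i) !vecE !inE /=.
  case: (i \in A) => /=; last by rewrite addr0.
  by case: leqP => _; rewrite ?addr0 ?add0r.
rewrite linearD /=; apply: le_trans (ler_normD _ _) _; rewrite lerD2l.
have FB : F [fset i in A | (n < val i)%N]%fset.
  by apply: (schreier_sub F_schreier FA); exact: fset_sub.
have := norm_vec_coord (x - j u) FB.
have -> : vec [fset i in A | (n < val i)%N]%fset (coord (x - j u)) =
          vec [fset i in A | (n < val i)%N]%fset (coord x).
  apply: eq_big_seq => i; rewrite !inE /= => /andP[_ ni].
  by rewrite completion_coordB coord_j u0 ?subr0.
by move=> /le_trans; apply; rewrite distrC ltW.
Qed.

(** A compactness argument along a binary tree. [good E n] says that sets of [F] with trace [E] on
    1, ..., n norm [x] as well as desired; a branch of good traces is followed. Compactness of [F]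
    makes the branch finite, so that its traces are eventually constant, and the tail estimate shows
    that the final trace attains the norm. *)
Lemma norm_vec_attained x : exists2 A, F A & `|j (vec A (coord x))| = `|x|.
Proof.
pose good (E : {fset posN}) n := forall e, 0 < e ->
  exists A, [/\ F A, initial n A = E & `|x| - e < `|j (vec A (coord x))|].
pose next n : posN := exist _ n.+1 isT.
have initS n A : initial n.+1 A = if next n \in A then (next n |` initial n A)%fset else initial n A.
  apply/fsetP => i; case: ifP => nA; rewrite !inE /= leq_eqVlt -[val i == n.+1]/(i == next n) ltnS.
    by case: (eqVneq i (next n)) => [->|] //=; rewrite nA.
  by case: (eqVneq i (next n)) => [->|] //=; rewrite nA.
have step E n : good E n -> good E n.+1 \/ good (next n |` E)%fset n.+1.
  move=> gE; apply: contrapT => /not_orP[].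
  move=> /existsNP[e1 /not_implyP[e10 h1]] /existsNP[e2 /not_implyP[e20 h2]].
  (* A set adapted to both failing tolerances either contains [next n] or does not, and so refutes
     one of the two failures. *)
  have [|A [FA AE hA]] := gE (Num.min e1 e2); first by rewrite lt_min e10.
  have m1 : Num.min e1 e2 <= e1 by rewrite ge_min lexx.
  have m2 : Num.min e1 e2 <= e2 by rewrite ge_min lexx orbT.
  have := initS n A; case: ifP => _; rewrite AE => AE'.
    by apply: h2; exists A; split => //; lra.
  by apply: h1; exists A; split => //; lra.
pose E := fix E n := if n is n'.+1 then
   (if `[< good (E n') n >] then E n' else (next n' |` E n')%fset) else fset0.
have gE n : good (E n) n.
  elim: n => [e e0|n IH] /=.
    have [A FA hA] := norm_vec_sup x e0; exists A; split => //.
    apply/fsetP => i; rewrite !inE /= leqn0; apply/negP => /andP[_].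
    by move=> /eqP i0; have := valP i; rewrite /= i0.
  case: asboolP => // h; by case: (step _ _ IH).
have FE n : F (E n).
  have [A [FA <- _]] := gE n 1 ltr01.
  by apply: (schreier_sub F_schreier FA); exact: fset_sub.
have Em m n : (m <= n)%N -> (E m `<=` E n)%fset.
  elim: n => [|n IH]; first by rewrite leqn0 => /eqP ->.
  rewrite leq_eqVlt => /orP[/eqP ->//|/IH h] /=.
  by case: ifP => _ //; apply: fsubset_trans h _; exact: fsubsetU1.
have EN n N i : i \in E n -> (val i <= N)%N -> i \in E N.
  move=> iE iN; have [nN|/ltnW nN] := leqP n N; first exact: (fsubsetP (Em _ _ nN)).
  elim: n nN iE => [|n IH]; first by case: N iN => [|N'] iN.
  rewrite leq_eqVlt => /orP[/eqP <-//|nN] /=; case: ifP => _; first exact: IH.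
  by rewrite !inE => /orP[/eqP e|/IH->//]; move: iN; rewrite e /= leqNgt nN.
pose L := [set i | exists n, i \in E n].
(* Finite subsets of the branch lie in some [E n], hence in [F]; compactness bounds the branch. *)
have [N LN] : exists N, forall i, L i -> (val i <= N)%N.
  apply: contrapT => h; have uL : unbounded L.
    move=> n; apply: contrapT => h2; apply: h; exists n => i Li.
    by rewrite leqNgt; apply/negP => ni; apply: h2; exists i.
  have [A AL nA] := schreier_compact F_schreier uL; apply: nA.
  pose N := (\max_(i <- A) val i)%N.
  apply: (schreier_sub F_schreier (FE N)); apply/fsubsetP => i iA.
  have [n iE] := AL _ iA; apply: EN iE _.
  by apply: (@leq_bigmax_seq _ _ predT (fun i : posN => val i)).
exists (E N) => //; apply/le_anti; rewrite norm_vec_coord //=.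
apply/ler_addgt0Pr => e e0.
have e1 : 0 < e / 2 by rewrite divr_gt0.
have [n0 tail] := norm_vec_tail x e1.
pose n := maxn n0 N; have [A [FA AE hA]] := gE n _ e1.
have := tail n A FA (leq_maxl _ _); rewrite AE.
have -> : E n = E N.
  apply/eqP; rewrite eqEfsubset; apply/andP; split; last by apply: Em; exact: leq_maxr.
  apply/fsubsetP => i iE.
  by apply: EN (iE) _; apply: LN; exists n.
lra.
Qed.

Lemma completion_coordinates : coordinates p F coord (fun i => j (delta i)).
Proof.
have root (a b : R) : 0 <= a -> 0 <= b -> (a `^ p^-1 <= b) = (a <= b `^ p).
  move=> a0 b0; rewrite -[in LHS](@powRr1 _ b) // -(mulfV p_neq0) powRrM.
  apply/idP/idP; last by apply: ge0_ler_powR; rewrite ?nnegrE ?powR_ge0 ?invr_ge0 ?(ltW p_gt0).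
  rewrite leNgt => /negP h; rewrite leNgt; apply/negP => h1; apply: h.
  by apply: gt0_ltr_powR; rewrite ?nnegrE ?powR_ge0 ?invr_gt0.
split.
- exact: completion_coordD.
- by move=> i k; rewrite coord_j.
- move=> A x FA; rewrite -root ?psum_ge0 // -norm_vec //; exact: norm_vec_coord.
- move=> x; have [A FA hA] := norm_vec_attained x; exists A => //.
  by rewrite -hA norm_vec // -powRrM mulVf // powRr1 // psum_ge0.
Qed.

End Completion.

(** * Faces of the unit sphere *)

Section Faces.
Context (R : realType) (X : normedModType R).
Implicit Types (x y z w : X) (T : X -> X).

(** The inverse is part of the data and the conditions are symmetric, so every statement about [T]
    also applies to [T']. *)
Record sphere_isometry T T' : Prop := {
  si_norm : forall x, `|x| = 1 -> `|T x| = 1;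
  si_norm' : forall x, `|x| = 1 -> `|T' x| = 1;
  si_K : forall x, `|x| = 1 -> T' (T x) = x;
  si_K' : forall x, `|x| = 1 -> T (T' x) = x;
  si_dist : forall x y, `|x| = 1 -> `|y| = 1 -> `|T x - T y| = `|x - y|
}.

Lemma sphere_isometry_sym T T' : sphere_isometry T T' -> sphere_isometry T' T.
Proof.
case=> TN TN' TK TK' Td; split => // x y x1 y1.
by rewrite -[in RHS](TK' x) // -[in RHS](TK' y) // Td // TN'.
Qed.

Definition face z : set X := [set y | `|y| = 1 /\ `|y + z| = 2].

(** The common ground of p = 1 and p > 1, from which the permutation of faces follows.
    [fs_antipodal] and [fs_dist] describe distance 2 by centres; [fs_inj] keeps a centre off all
    faces but its own, so that points on a single face exist. *)
Record face_system (Z : set X) : Prop := {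
  fs_norm : forall z, Z z -> `|z| = 1;
  fs_opp : forall z, Z z -> Z (- z);
  fs_antipodal : forall x y, `|x| = 1 -> `|y| = 1 -> `|x - y| = 2 ->
    exists z, [/\ Z z, face z x & face z (- y)];
  fs_dist : forall x y z, Z z -> face z x -> face z (- y) -> `|x - y| = 2;
  fs_inj : forall z w, Z z -> Z w -> face w z -> z = w
}.

Lemma face_opp z x : face z (- x) <-> face (- z) x.
Proof. by rewrite /face /= normrN (_ : x - z = - (- x + z)) ?normrN // opprD opprK. Qed.

Lemma face_self z : `|z| = 1 -> face z z.
Proof. by move=> z1; split => //; rewrite -mulr2n -scaler_nat normrZ z1 mulr1 ger0_norm. Qed.

(** The points of parameters t and 1 - t have sum x + z, of norm 2, while each has norm at most
    1. *)
Lemma face_segment x z (t : R) : `|z| = 1 -> face z x -> 0 <= t <= 1 ->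
  `|(1 - t) *: x + t *: z| = 1.
Proof.
move=> z1 [x1 xz] /andP[t0 t1].
have bnd (s : R) : 0 <= s <= 1 -> `|(1 - s) *: x + s *: z| <= 1.
  move=> /andP[s0 s1]; apply: le_trans (ler_normD _ _) _.
  by rewrite !normrZ x1 z1 !ger0_norm ?subr_ge0 // !mulr1 subrK.
apply/le_anti; rewrite bnd ?t0 //=.
have : `|x + z| <= `|(1 - t) *: x + t *: z| + `|(1 - (1 - t)) *: x + (1 - t) *: z|.
  apply: le_trans (ler_normD _ _); rewrite le_eqVlt; apply/orP; left; apply/eqP.
  congr (`|_|); rewrite addrACA -!scalerDl (addrC t) subrK subKr.
  by rewrite subrK !scale1r.
have := bnd (1 - t); rewrite xz subr_ge0 t1 gerBl t0 => /(_ isT); lra.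
Qed.

(** The convex function [|. + w|] is at most 2 at both ends; if it reaches 2 at a point of positive
    weight on [z], it reaches 2 at [z]. *)
Lemma face_segment_face x z w (t : R) : `|x| = 1 -> `|z| = 1 -> `|w| = 1 ->
  0 < t <= 1 -> face w ((1 - t) *: x + t *: z) -> face w z.
Proof.
move=> x1 z1 w1 /andP[t0 t1] [_ h]; split => //.
apply/le_anti/andP; split.
  by apply: le_trans (ler_normD _ _) _; rewrite z1 w1.
have : (1 - t) *: x + t *: z + w = (1 - t) *: (x + w) + t *: (z + w).
  by rewrite !scalerDr addrACA -scalerDl subrK scale1r.
move=> e; move: h; rewrite e => h.
have := ler_normD ((1 - t) *: (x + w)) (t *: (z + w)).
rewrite h !normrZ !ger0_norm ?subr_ge0 ?(ltW t0) // => h1.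
have h2 : `|x + w| <= 2 by apply: le_trans (ler_normD _ _) _; rewrite x1 w1.
have h3 : (1 - t) * `|x + w| <= (1 - t) * 2 by apply: ler_wpM2l; rewrite ?subr_ge0.
rewrite -(ler_pM2l t0); lra.
Qed.

Section System.
Context (Z : set X) (FZ : face_system Z).

Definition single_face z x := face z x /\ forall w, Z w -> face w x -> w = z.

Lemma single_face_self z : Z z -> single_face z z.
Proof.
move=> Zz; split; first exact: face_self (fs_norm FZ Zz).
by move=> w Zw /(fs_inj FZ Zz Zw).
Qed.

Lemma exists_face x : `|x| = 1 -> exists2 z, Z z & face z x.
Proof.
move=> x1; have [||z []] := fs_antipodal FZ x1 (y := - x).
- by rewrite normrN.
- by rewrite opprK; case: (face_self x1).
by exists z.
Qed.

(** Push [x] slightly towards [z]: any face through the new point contains [z] by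
    [face_segment_face], hence is the face of [z] by [fs_inj]. As |x - z| <= 2, a step of e / 4
    moves by less than e. *)
Lemma single_face_dense z x (e : R) : Z z -> face z x -> 0 < e ->
  exists2 x', single_face z x' & `|x - x'| < e.
Proof.
move=> Zz fx e0; have z1 := fs_norm FZ Zz.
pose t : R := Num.min 1 (e / 4).
have t0 : 0 < t by rewrite lt_min ltr01 divr_gt0.
have t1 : t <= 1 by rewrite ge_min lexx.
exists ((1 - t) *: x + t *: z).
  split.
    split; first by apply: face_segment => //; rewrite (ltW t0).
    (* The sum is twice the point of parameter (1 + t) / 2 on the segment, so [face_segment] gives
       its norm. *)
    have -> : (1 - t) *: x + t *: z + z = 2 *: ((1 - (1 + t) / 2) *: x + ((1 + t) / 2) *: z).
      rewrite scalerDr !scalerA -addrA -{2}(scale1r z) -scalerDl.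
      by congr (_ *: _ + _ *: _); field.
    rewrite normrZ face_segment ?ger0_norm ?mulr1 //; apply/andP; split; lra.
  move=> w Zw fw; apply/esym; apply: (fs_inj FZ) => //.
  by apply: (face_segment_face (proj1 fx) z1 (fs_norm FZ Zw) _ fw); rewrite t0.
rewrite scalerBl scale1r opprD opprB addrA (addrC x) subrK.
rewrite -scalerBr normrZ gtr0_norm //.
have h : `|x - z| <= 2 by apply: le_trans (ler_normB _ _) _; rewrite z1; case: fx => ->.
have h4 : t <= e / 4 by rewrite ge_min lexx orbT.
have := ler_wpM2l (ltW t0) h; lra.
Qed.

Definition antipodal_set x : set X := [set y | `|y| = 1 /\ `|x - y| = 2].

Lemma single_antipodal z x : Z z -> single_face z x ->
  forall y, antipodal_set x y <-> face (- z) y.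
Proof.
move=> Zz [fx sx] y; split=> [[y1 xy]|fy]; last first.
  have y1 : `|y| = 1 by case: fy.
  by split => //; apply: (fs_dist FZ Zz fx); apply/face_opp.
have x1 : `|x| = 1 by case: fx.
have [w [Zw fwx]] := fs_antipodal FZ x1 y1 xy.
by rewrite (sx w Zw fwx) => /face_opp.
Qed.

Lemma face_antipodal z x y : Z z -> face z x -> face (- z) y -> antipodal_set x y.
Proof.
move=> Zz fx fy; split; first by case: fy.
by apply: (fs_dist FZ Zz fx); apply/face_opp.
Qed.

Lemma face_sub_inj z w : Z z -> Z w -> face (- w) `<=` face (- z) -> w = z.
Proof.
move=> Zz Zw h; apply: (fs_inj FZ) => //.
have /h/face_opp : face (- w) (- w) by apply: face_self; rewrite normrN (fs_norm FZ).
by rewrite opprK.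
Qed.

Lemma single_face_minimal x : `|x| = 1 ->
  (exists2 z, Z z & single_face z x) <->
  (forall x', `|x'| = 1 -> antipodal_set x' `<=` antipodal_set x ->
     antipodal_set x `<=` antipodal_set x').
Proof.
move=> x1; split=> [[z Zz sx] x' x'1 sub|hmin].
  have [w Zw fw] := exists_face x'1.
  have wz : w = z.
    apply: face_sub_inj => // y /(face_antipodal Zw fw)/sub.
    by move=> /(single_antipodal Zz sx).
  rewrite wz in Zw fw; by move=> y /(single_antipodal Zz sx)/(face_antipodal Zw fw).
have [z Zz fz] := exists_face x1; exists z => //; split => // w Zw fw.
(* The competitor in the minimality is [z] itself: its antipodal set is exactly the opposite face,
   which is contained in that of [x]. *)
have sz := single_face_self Zz.
apply: face_sub_inj => // y /(face_antipodal Zw fw)/hmin h.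
by apply/(single_antipodal Zz sz)/h; [exact: fs_norm FZ _ Zz|]
  => y' /(single_antipodal Zz sz)/(face_antipodal Zz fz).
Qed.

Section Map.
Context (T T' : X -> X) (TT' : sphere_isometry T T').

Lemma antipodal_map x y : `|x| = 1 -> `|y| = 1 ->
  antipodal_set (T x) (T y) <-> antipodal_set x y.
Proof.
by move=> x1 y1; rewrite /antipodal_set /= (si_norm TT') // (si_dist TT') // y1.
Qed.

End Map.

Lemma single_face_map T T' x : sphere_isometry T T' -> `|x| = 1 ->
  (exists2 z, Z z & single_face z x) -> exists2 w, Z w & single_face w (T x).
Proof.
move=> TT' x1 /(single_face_minimal x1) hmin.
have TT'' := sphere_isometry_sym TT'; have Tx1 := si_norm TT' x1.
apply/(single_face_minimal Tx1) => x' x'1 sub y [y1 xy].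
have y'1 := si_norm' TT' y1; have x''1 := si_norm' TT' x'1.
rewrite -(si_K' TT' x'1) -(si_K' TT' y1); apply/(antipodal_map TT') => //.
apply: hmin => //; last by apply/(antipodal_map TT') => //; rewrite (si_K' TT').
move=> u [u1 /= hu]; apply/(antipodal_map TT') => //; apply: sub.
by rewrite -(si_K' TT' x'1); apply/(antipodal_map TT').
Qed.

(** A point on the single face of [z] is sent to a point on a single face, and the correspondence of
    opposite faces identifies that face as the one of [w]. Such points are dense in the face of [z],
    and faces are closed. *)
Lemma face_map_sub T T' z w : sphere_isometry T T' -> Z z -> Z w ->
  (forall y, `|y| = 1 -> face (- z) y <-> face (- w) (T y)) ->
  forall x, face z x -> face w (T x).
Proof.
move=> TT' Zz Zw zw x fx; have x1 : `|x| = 1 by case: fx.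
have single x' : single_face z x' -> face w (T x').
  move=> sx'; have x'1 : `|x'| = 1 by case: sx' => -[].
  have [w' Zw' sw'] := single_face_map TT' x'1 (ex_intro2 _ _ z Zz sx').
  have -> : w = w'.
    apply: face_sub_inj => // y fy; have y1 : `|y| = 1 by case: fy.
    have y'1 := si_norm' TT' y1.
    rewrite -(si_K' TT' y1); apply/(single_antipodal Zw' sw').
    apply/(antipodal_map TT') => //; apply/(single_antipodal Zz sx').
    by apply/zw => //; rewrite (si_K' TT').
  by case: sw'.
split; first exact: si_norm TT' _ x1.
apply/le_anti/andP; split.
  by apply: le_trans (ler_normD _ _) _; rewrite (si_norm TT') // (fs_norm FZ).
apply/ler_addgt0Pr => e e0.
have [x' sx' xx'] := single_face_dense Zz fx e0.
have x'1 : `|x'| = 1 by case: sx' => -[].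
have [_ h] := single _ sx'.
have : `|T x' + w| <= `|T x + w| + `|T x - T x'|.
  rewrite (_ : T x' + w = T x + w - (T x - T x')) ?ler_normB //.
  by rewrite opprB [RHS]addrC addrA subrK.
rewrite (si_dist TT') // h; lra.
Qed.

(** Antipodal sets directly give the correspondence of the opposite faces only; as T is not known to
    be odd, the faces themselves need [face_map_sub], applied to T and to its inverse. *)
Lemma face_map T T' z : sphere_isometry T T' -> Z z ->
  exists w, [/\ Z w, forall y, `|y| = 1 -> face z y <-> face w (T y)
    & forall y, `|y| = 1 -> face (- z) y <-> face (- w) (T y)].
Proof.
move=> TT' Zz; have z1 := fs_norm FZ Zz.
have sz := single_face_self Zz.
have [w Zw sw] : exists2 w, Z w & single_face w (T z).
  by apply: (single_face_map TT' z1); exists z.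
have zw y : `|y| = 1 -> face (- z) y <-> face (- w) (T y).
  move=> y1; split=> [/(single_antipodal Zz sz)|/(single_antipodal Zw sw)].
    by move=> /(antipodal_map TT' z1 y1)/(single_antipodal Zw sw).
  by move=> /(antipodal_map TT' z1 y1)/(single_antipodal Zz sz).
exists w; split => // y y1; split; first exact: (face_map_sub TT').
move=> fy; rewrite -(si_K TT' y1).
apply: (face_map_sub (sphere_isometry_sym TT') Zw Zz) => // u u1.
have u'1 := si_norm' TT' u1.
by split => [|/(zw _ u'1)]; rewrite ?(si_K' TT') // => h; apply/zw; rewrite ?(si_K' TT').
Qed.

End System.
End Faces.

(** * Inequalities for powers *)

Section PowerConvexity.
Context (R : realType).
Implicit Types (p q a b m s t u : R).

(** The strict Bernoulli inequality. With u = exp x, multiply exp ((p - 1) x) > 1 + (p - 1) x by exp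
    x, and use x exp x >= exp x - 1. *)
Lemma powR_tangent1 p u : 1 < p -> 0 <= u -> u != 1 -> 1 + p * (u - 1) < u `^ p.
Proof.
move=> p1; rewrite le_eqVlt => /orP[/eqP <- _|u0 u1].
  have p0 : p != 0 by rewrite gt_eqF //; lra.
  by rewrite powR0 //; lra.
pose x := ln u; have x0 : x != 0 by rewrite /x ln_eq0.
have ue : u = expR x by rewrite /x lnK.
have -> : u `^ p = expR x * expR ((p - 1) * x).
  by rewrite /powR gt_eqF // -expRD; congr expR; rewrite -/x; ring.
have h1 : 1 + (p - 1) * x < expR ((p - 1) * x).
  by apply: expR_gt1Dx; rewrite mulf_neq0 // subr_eq0 gt_eqF.
have h2 : 1 + - x <= expR (- x) := expR_ge1Dx _.
have e0 : 0 < expR x := expR_gt0 x.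
have h3 : expR x * (1 - x) <= 1.
  by rewrite -[leRHS](expRxMexpNx_1 x) ler_pM2l.
rewrite -(ltr_pM2l e0) in h1; rewrite ue; nra.
Qed.

Lemma powR_tangent p m : 1 < p -> 0 < m ->
  exists k, forall s, 0 <= s -> s != m -> m `^ p + k * (s - m) < s `^ p.
Proof.
move=> p1 m0; exists (p * m `^ p / m) => s s0 sm.
have h := @powR_tangent1 p (s / m) p1 (divr_ge0 s0 (ltW m0)).
have mp : 0 < m `^ p by apply: powR_gt0.
have -> : s `^ p = m `^ p * (s / m) `^ p.
  rewrite -powRM ?divr_ge0 ?(ltW m0) //; congr (_ `^ _); field; rewrite gt_eqF //.
have -> : m `^ p + p * m `^ p / m * (s - m) = m `^ p * (1 + p * (s / m - 1)).
  by field; rewrite gt_eqF.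
rewrite ltr_pM2l //; apply: h.
have mn0 : m != 0 by rewrite gt_eqF.
by apply: contraNneq sm => h1; rewrite -[s](divfK mn0) h1 mul1r.
Qed.

Lemma powR_midpoint p s t : 1 < p -> 0 <= s -> 0 <= t -> s != t ->
  2 * ((s + t) / 2) `^ p < s `^ p + t `^ p.
Proof.
move=> p1 s0 t0 st; have m0 : 0 < (s + t) / 2.
  rewrite divr_gt0 // lt_neqAle addr_ge0 // andbT eq_sym paddr_eq0 //.
  by apply/negP => /andP[/eqP s00 /eqP t00]; rewrite s00 t00 eqxx in st.
have [k hk] := powR_tangent p1 m0.
have hs := hk s s0; have ht := hk t t0.
have sm : s != (s + t) / 2 by apply: contra_neq st; lra.
have tm : t != (s + t) / 2 by apply: contra_neq st; lra.
have {}hs := hs sm; have {}ht := ht tm.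
have -> : 2 * ((s + t) / 2) `^ p =
  (((s + t) / 2) `^ p + k * (s - (s + t) / 2)) + (((s + t) / 2) `^ p + k * (t - (s + t) / 2)) by field.
exact: ltrD.
Qed.

(** Strict convexity applied to |a| and |b|; if these agree then b = - a and the left side
    vanishes. *)
Lemma powR_add_lt p a b : 1 < p -> a != b ->
  `|a + b| `^ p < 2 `^ p / 2 * (`|a| `^ p + `|b| `^ p).
Proof.
move=> p1 ab; have p0 : 0 < p by lra.
have c0 : 0 < 2 `^ p / 2 :> R by rewrite divr_gt0 // powR_gt0.
have [aeb|nab] := eqVneq `|a| `|b|.
  have ba : b = - a.
    move/eqP: aeb; rewrite eqr_norm2 => /orP[]/eqP h; first by rewrite h eqxx in ab.
    by rewrite h opprK.
  have a0 : a != 0 by apply: contraNneq ab => a0; rewrite ba a0 oppr0.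
  rewrite ba subrr normr0 powR0 ?gt_eqF // normrN.
  by apply: mulr_gt0 => //; apply: addr_gt0; apply: powR_gt0; rewrite normr_gt0.
have h := powR_midpoint p1 (normr_ge0 a) (normr_ge0 b) nab.
apply: (@le_lt_trans _ _ (2 `^ p * ((`|a| + `|b|) / 2) `^ p)).
  rewrite -powRM ?divr_ge0 ?addr_ge0 // [2 * _]mulrC divfK //.
  by apply: ge0_ler_powR; rewrite ?nnegrE ?addr_ge0 ?ler_normD // ltW.
have : 2 `^ p / 2 * (2 * ((`|a| + `|b|) / 2) `^ p) < 2 `^ p / 2 * (`|a| `^ p + `|b| `^ p).
  by rewrite ltr_pM2l.
by rewrite mulrA divfK.
Qed.

(** Strict convexity: s and 1 + t lie strictly between t and 1 + s and have the same sum. It says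
    that (1 + t)^p - t^p increases with t. *)
Lemma powR_swap p s t : 1 < p -> 0 <= t -> t < s ->
  s `^ p + (1 + t) `^ p < t `^ p + (1 + s) `^ p.
Proof.
move=> p1 t0 ts; pose h := s - t; have se : s = t + h by rewrite addrC subrK.
have h0 : 0 < h by rewrite subr_gt0.
have s0 : 0 < s by lra.
have s1 : 0 <= 1 + s by lra.
have t1 : 0 < 1 + t by lra.
have h1 : 0 < 1 + h by lra.
have [k hk] := powR_tangent p1 s0; have [l hl] := powR_tangent p1 t1.
have e1 : s `^ p + k * (t - s) < t `^ p by apply: hk; rewrite ?lt_eqF.
have e2 : s `^ p + k * (1 + s - s) < (1 + s) `^ p by apply: hk; rewrite ?gt_eqF //; lra.
have e3 : (1 + t) `^ p + l * (t - (1 + t)) < t `^ p by apply: hl; rewrite ?lt_eqF //; lra.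
have e4 : (1 + t) `^ p + l * (1 + s - (1 + t)) < (1 + s) `^ p.
  by apply: hl; rewrite ?gt_eqF //; lra.
rewrite -(ltr_pM2l h0) in e2; rewrite -(ltr_pM2l h0) in e3.
(* s is the barycentre of t and 1 + s with weights 1 and h; 1 + t is the one with weights h and
   1. *)
have e5 : (1 + h) * s `^ p < t `^ p + h * (1 + s) `^ p.
  have -> : (1 + h) * s `^ p = (s `^ p + k * (t - s)) + h * (s `^ p + k * (1 + s - s)).
    by rewrite /h; ring.
  exact: ltrD.
have e6 : (1 + h) * (1 + t) `^ p < h * t `^ p + (1 + s) `^ p.
  have -> : (1 + h) * (1 + t) `^ p = h * ((1 + t) `^ p + l * (t - (1 + t))) + ((1 + t) `^ p + l * (1 + s - (1 + t))).
    by rewrite /h; ring.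
  exact: ltrD.
rewrite -(ltr_pM2l h1); lra.
Qed.

Lemma powR_midpoint_le q s t : 1 <= q -> 0 <= s -> 0 <= t ->
  2 * ((s + t) / 2) `^ q <= s `^ q + t `^ q.
Proof.
move=> q1 s0 t0; have st0 : 0 <= (s + t) / 2 by rewrite divr_ge0 // addr_ge0.
have [<-|st] := eqVneq s t.
  have -> : (s + s) / 2 = s by field.
  by lra.
move: q1; rewrite le_eqVlt => /orP[/eqP <-|q1]; last exact/ltW/powR_midpoint.
by rewrite !powRr1 // mulrC divfK.
Qed.

Lemma powR_superadd q a b : 1 <= q -> 0 <= a -> 0 <= b ->
  a `^ q + b `^ q <= (a + b) `^ q.
Proof.
move=> q1 a0 b0; have q0 : 0 < q by lra.
have ab0 : 0 <= a + b by rewrite addr_ge0.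
rewrite -(mulr_powRB1 a0 q0) -(mulr_powRB1 b0 q0) -(mulr_powRB1 ab0 q0) mulrDl.
have mono x : 0 <= x -> x <= a + b -> x `^ (q - 1) <= (a + b) `^ (q - 1).
  by move=> x0 xab; apply: ge0_ler_powR; rewrite ?nnegrE ?subr_ge0.
by apply: lerD; apply: ler_wpM2l => //; apply: mono; rewrite ?lerDl ?lerDr.
Qed.

Lemma powRVK q a : 0 < q -> 0 <= a -> (a `^ q) `^ q^-1 = a.
Proof. by move=> q0 a0; rewrite -powRrM mulfV ?gt_eqF // powRr1. Qed.

Lemma powR_root_le q a b : 0 < q -> 0 <= a -> 0 <= b -> a `^ q^-1 <= b -> a <= b `^ q.
Proof.
move=> q0 a0 b0 h; have -> : a = (a `^ q^-1) `^ q.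
  by rewrite -powRrM mulVf ?gt_eqF // powRr1.
by apply: ge0_ler_powR; rewrite ?nnegrE ?powR_ge0 ?(ltW q0).
Qed.

Lemma powR_le_root q a b : 0 < q -> 0 <= a -> 0 <= b -> a <= b `^ q^-1 -> a `^ q <= b.
Proof.
move=> q0 a0 b0 h; have -> : b = (b `^ q^-1) `^ q.
  by rewrite -powRrM mulVf ?gt_eqF // powRr1.
by apply: ge0_ler_powR; rewrite ?nnegrE ?powR_ge0 ?(ltW q0).
Qed.

(** Convexity for the exponent 1 / q, applied to the q-th powers of s and t. *)
Lemma powR_midpoint_ge q s t : 0 < q <= 1 -> 0 <= s -> 0 <= t ->
  s `^ q + t `^ q <= 2 * ((s + t) / 2) `^ q.
Proof.
move=> /andP[q0 q1] s0 t0; have st0 : 0 <= (s + t) / 2 by rewrite divr_ge0 // addr_ge0.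
have r1 : 1 <= q^-1 by rewrite invf_ge1.
have h := powR_midpoint_le r1 (powR_ge0 s q) (powR_ge0 t q).
rewrite !powRVK // in h.
have h2 : ((s `^ q + t `^ q) / 2) `^ q^-1 <= (s + t) / 2 by lra.
have : (s `^ q + t `^ q) / 2 <= ((s + t) / 2) `^ q.
  apply: powR_root_le; rewrite ?divr_ge0 ?addr_ge0 ?powR_ge0 //.
lra.
Qed.

Lemma powR_subadd q a b : 0 < q <= 1 -> 0 <= a -> 0 <= b ->
  (a + b) `^ q <= a `^ q + b `^ q.
Proof.
move=> /andP[q0 q1] a0 b0; have r1 : 1 <= q^-1 by rewrite invf_ge1.
apply: powR_le_root; rewrite ?addr_ge0 ?powR_ge0 //.
by have := powR_superadd r1 (powR_ge0 a q) (powR_ge0 b q); rewrite !powRVK.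
Qed.

(** Exponent p / 2 on squares: by the parallelogram identity, the two Clarkson inequalities below
    reduce to concavity and subadditivity, or convexity and superadditivity, of the power p / 2. *)
Lemma powR_sqr p a : 0 <= a -> a `^ p = (a ^+ 2) `^ (p / 2).
Proof.
by move=> a0; rewrite -powR_mulrn // -powRrM mulrC divfK.
Qed.

(* Clarkson's inequality 2 (a^p + b^p) >= |a + b|^p + |a - b|^p (p <= 2) for
   a = 1 + t, b = 1 - t; reversed for p >= 2. *)
Lemma clarkson_le p t : 0 < p <= 2 -> 0 <= t <= 1 ->
  2 `^ p * (1 + t `^ p) <= 2 * ((1 + t) `^ p + (1 - t) `^ p).
Proof.
move=> /andP[p0 p2] /andP[t0 t1].
have q : 0 < p / 2 <= 1 by rewrite divr_gt0 //= ler_pdivrMr // mul1r.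
have -> : 2 `^ p * (1 + t `^ p) = 2 `^ p + (2 * t) `^ p.
  by rewrite powRM // mulrDr mulr1.
rewrite (@powR_sqr p 2) // (@powR_sqr p (2 * t)) ?mulr_ge0 //.
have := powR_midpoint_ge q (sqr_ge0 2) (sqr_ge0 (2 * t)).
have -> : (2 ^+ 2 + (2 * t) ^+ 2) / 2 = (1 + t) ^+ 2 + (1 - t) ^+ 2 :> R by field.
move=> /le_trans; apply; rewrite ler_pM2l //.
rewrite (@powR_sqr p (1 + t)) ?(@powR_sqr p (1 - t)); try lra.
exact: powR_subadd q (sqr_ge0 _) (sqr_ge0 _).
Qed.

Lemma clarkson_ge p t : 2 <= p -> 0 <= t <= 1 ->
  2 * ((1 + t) `^ p + (1 - t) `^ p) <= 2 `^ p * (1 + t `^ p).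
Proof.
move=> p2 /andP[t0 t1].
have q : 1 <= p / 2 by rewrite ler_pdivlMr // mul1r.
have -> : 2 `^ p * (1 + t `^ p) = 2 `^ p + (2 * t) `^ p.
  by rewrite powRM // mulrDr mulr1.
rewrite (@powR_sqr p 2) // (@powR_sqr p (2 * t)) ?mulr_ge0 //.
apply: le_trans (powR_midpoint_le q (sqr_ge0 2) (sqr_ge0 (2 * t))).
have -> : (2 ^+ 2 + (2 * t) ^+ 2) / 2 = (1 + t) ^+ 2 + (1 - t) ^+ 2 :> R by field.
rewrite ler_pM2l // (@powR_sqr p (1 + t)) ?(@powR_sqr p (1 - t)); try lra.
exact: powR_superadd q (sqr_ge0 _) (sqr_ge0 _).
Qed.

Lemma ltr_pow2 p q : p < q -> 2 `^ p < 2 `^ q :> R.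
Proof.
move=> pq; rewrite /powR gt_eqF // ltr_expR ltr_pM2r //.
by rewrite ln_gt0 // ltr1n.
Qed.

(** For a rigid y with t = |y_i| the left side is |e_i - y|^p + |e_i + y|^p. By Clarkson its
    difference with 2^p is at least (4 - 2^p) (1 - t^p) / 2 if p < 2, and at most that if p > 2;
    this quantity is nonzero. *)
Lemma clarkson_neq p t : 1 < p -> p != 2 -> 0 <= t < 1 ->
  (1 + t) `^ p + (1 - t) `^ p + 2 * (1 - t `^ p) != 2 `^ p.
Proof.
move=> p1 p2 /andP[t0 t1].
have p0 : 0 < p by lra.
have tp : t `^ p < 1.
  have -> : 1 = 1 `^ p :> R by rewrite powR1.
  by apply: gt0_ltr_powR; rewrite ?nnegrE.
have two0 : 0 < 2 `^ p :> R by rewrite powR_gt0.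
have t01 : 0 <= t <= 1 by rewrite t0 ltW.
have e4 : 4 = 2 `^ 2 :> R by rewrite powR_mulrn // -natrX.
move: p2; rewrite neq_lt => /orP[p2|p2].
  have lt4 : 2 `^ p < 4 :> R by rewrite e4 ltr_pow2.
  have := @clarkson_le p t; rewrite p0 (ltW p2) => /(_ isT t01) h.
  rewrite gt_eqF //; nra.
have lt4 : 4 < 2 `^ p :> R by rewrite e4 ltr_pow2.
have h := clarkson_ge (ltW p2) t01.
rewrite lt_eqF //; nra.
Qed.

End PowerConvexity.

(** * Isometries in coordinates *)

Section Coordinates.
Context (R : realType) (p : R) (F : set {fset posN}).
Context (X : normedModType R) (c : X -> posN -> R) (e : posN -> X).
Context (p_ge1 : 1 <= p) (F_schreier : schreier_family F).
Context (ce : coordinates p F c e).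
Implicit Types (x y z : X) (f : posN -> R) (A B : {fset posN}) (i k : posN).

Lemma pow1p : 1 `^ p = 1 :> R. Proof. by rewrite powR1. Qed.
Lemma exponent_gt0 : 0 < p. Proof. exact: lt_le_trans ltr01 p_ge1. Qed.
Lemma exponent_neq0 : p != 0. Proof. by rewrite gt_eqF // exponent_gt0. Qed.

Lemma ler_powRp (a b : R) : 0 <= a -> 0 <= b -> (a `^ p <= b `^ p) = (a <= b).
Proof.
move=> a0 b0; apply/idP/idP; last by apply: ge0_ler_powR; rewrite ?nnegrE ?(ltW exponent_gt0).
rewrite !leNgt; apply: contra; apply: gt0_ltr_powR; rewrite ?nnegrE //; exact: exponent_gt0.
Qed.

Lemma powRp_inj (a b : R) : 0 <= a -> 0 <= b -> a `^ p = b `^ p -> a = b.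
Proof. by move=> a0 b0 h; apply/le_anti; rewrite -(ler_powRp a0 b0) -(ler_powRp b0 a0) h lexx. Qed.

Lemma le_2powRp : 2 <= 2 `^ p :> R.
Proof. by rewrite -[leLHS](@powRr1 _ 2) // ler_powR // ler1n. Qed.

Lemma coord0 i : c 0 i = 0.
Proof.
have := coord_lin ce 1 0 0 i; rewrite scale1r addr0 mul1r.
by move=> /eqP; rewrite -subr_eq subrr => /eqP.
Qed.

Lemma coordD x y i : c (x + y) i = c x i + c y i.
Proof. by rewrite -[x]scale1r (coord_lin ce) mul1r scale1r. Qed.

Lemma coordZ a x i : c (a *: x) i = a * c x i.
Proof. by rewrite -[a *: x]addr0 (coord_lin ce) coord0 addr0. Qed.

Lemma coordN x i : c (- x) i = - c x i.
Proof. by rewrite -scaleN1r coordZ mulN1r. Qed.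

Lemma coordB x y i : c (x - y) i = c x i - c y i.
Proof. by rewrite coordD coordN. Qed.

Lemma coord_vec A f k : c (\sum_(i <- A) f i *: e i) k = if k \in A then f k else 0.
Proof.
have sumE (s : seq posN) : c (\sum_(i <- s) f i *: e i) k = \sum_(i <- s) f i * (k == i)%:R.
  elim: s => [|i s IH]; first by rewrite !big_nil coord0.
  by rewrite !big_cons -IH coordD coordZ (coord_e ce).
rewrite sumE; case: ifP => kA.
  rewrite (big_fsetD1 k) //= eqxx mulr1 big1_seq ?addr0 // => i.
  by rewrite !inE /= eq_sym => /andP[/negbTE->]; rewrite mulr0.
rewrite big1_seq // => i /= iA.
by rewrite (_ : k == i = false) ?mulr0 //; apply: contraFF kA => /eqP ->.
Qed.

Lemma psum_le1 A x : F A -> `|x| = 1 -> psum p A (c x) <= 1.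
Proof. by move=> FA x1; have := psum_le ce x FA; rewrite x1 powR1. Qed.

Lemma psum_attained1 x : `|x| = 1 -> exists2 A, F A & psum p A (c x) = 1.
Proof. by move=> x1; have := psum_attained ce x; rewrite x1 powR1. Qed.

Lemma norm_le_psum x (r : R) : 0 <= r -> (forall A, F A -> psum p A (c x) <= r `^ p) -> `|x| <= r.
Proof.
by move=> r0 h; rewrite -ler_powRp //; have [A FA <-] := psum_attained ce x; exact: h.
Qed.

Lemma norm_psumE x (s : R) : (forall A, F A -> psum p A (c x) <= s) ->
  (exists2 A, F A & s <= psum p A (c x)) -> `|x| `^ p = s.
Proof.
move=> h [A FA hA]; apply/le_anti; rewrite (le_trans hA (psum_le ce _ FA)) andbT.
by have [B FB <-] := psum_attained ce x; exact: h.
Qed.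

Lemma norm1_psum x : (forall A, F A -> psum p A (c x) <= 1) ->
  (exists2 A, F A & 1 <= psum p A (c x)) -> `|x| = 1.
Proof. by move=> h1 h2; apply: powRp_inj => //; rewrite powR1; exact: norm_psumE. Qed.

Lemma psum_support A B x : (forall i, i \notin A -> c x i = 0) ->
  psum p B (c x) <= psum p A (c x).
Proof.
move=> xA; rewrite -(@psum_sub_eq _ p (B `&` A)%fset B) ?fsubsetIl ?exponent_neq0 //.
  by apply: psum_sub; exact: fsubsetIr.
by move=> i iB; rewrite inE iB /=; exact: xA.
Qed.

Lemma norm_support A x : F A -> (forall i, i \notin A -> c x i = 0) ->
  `|x| `^ p = psum p A (c x).
Proof.
by move=> FA xA; apply: norm_psumE => [B FB|]; [exact: psum_support|exists A].
Qed.

Lemma coord_le x i : `|c x i| <= `|x|.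
Proof. by rewrite -ler_powRp // -psum1 (psum_le ce) //; exact: schreier_sing. Qed.

Lemma coord_inj x y : (forall i, c x i = c y i) -> x = y.
Proof.
move=> h; apply/eqP; rewrite -subr_eq0 -normr_le0; apply: norm_le_psum => // A FA.
rewrite powR0 ?exponent_neq0 // /psum big1 // => i _.
by rewrite coordB h subrr normr0 powR0 ?exponent_neq0.
Qed.

Lemma coord_e_eq i : c (e i) i = 1.
Proof. by rewrite (coord_e ce) eqxx. Qed.

Lemma coord_e_neq i k : k != i -> c (e i) k = 0.
Proof. by rewrite (coord_e ce) => /negbTE->. Qed.

Lemma norm_basis i : `|e i| = 1.
Proof.
apply: powRp_inj => //; rewrite (@norm_support [fset i]%fset) //.
- by rewrite psum1 coord_e_eq normr1.
- exact: schreier_sing.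
- by move=> k; rewrite inE => ki; rewrite coord_e_neq.
Qed.

Lemma norm_addN_basis x (a : R) i : `|x - (x + a *: e i)| = `|a|.
Proof. by rewrite opprD addrA subrr add0r normrN normrZ norm_basis mulr1. Qed.

Lemma psum_change A x (a : R) i :
  psum p A (c (x + (a - c x i) *: e i)) =
  if i \in A then `|a| `^ p + psum p (A `\ i)%fset (c x) else psum p A (c x).
Proof.
have off k : k != i -> c (x + (a - c x i) *: e i) k = c x k.
  by move=> ki; rewrite coordD coordZ coord_e_neq // mulr0 addr0.
have on : c (x + (a - c x i) *: e i) i = a.
  by rewrite coordD coordZ coord_e_eq mulr1 addrC subrK.
case: ifP => iA.
  rewrite (@psumD1 _ _ i) // on; congr (_ + _); apply: eq_psum => k.
  by rewrite !inE => /andP[/off->].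
by apply: eq_psum => k kA; rewrite off //; apply: contraFneq iA => <-.
Qed.

Definition reflect_coord i x : X := x + (- c x i - c x i) *: e i.

Lemma coord_reflect i x k : c (reflect_coord i x) k = if k == i then - c x i else c x k.
Proof.
rewrite coordD coordZ; case: eqVneq => [->|ki]; first by rewrite coord_e_eq; ring.
by rewrite coord_e_neq // mulr0 addr0.
Qed.

Lemma psum_mem_pone A f : F A -> pone \in A -> psum p A f = `|f pone| `^ p.
Proof. by move=> FA /(schreier_one F_schreier FA) ->; rewrite psum1. Qed.

(** As [pone] belongs to no set of [F] but its singleton, the norm is the maximum of the first
    coordinate's modulus and of the norm of the rest. *)
Lemma norm_pone_add z (a : R) : c z pone = 0 -> `|z| = 1 -> `|a| <= 1 ->
  `|a *: e pone + z| = 1.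
Proof.
move=> z0 z1 a1.
have psumE A : F A -> pone \notin A -> psum p A (c (a *: e pone + z)) = psum p A (c z).
  move=> FA oA; apply: eq_psum => i iA; rewrite (coord_lin ce) coord_e_neq.
    by rewrite mulr0 add0r.
  by apply: contraNneq oA => <-.
apply: norm1_psum => [A FA|].
  case: (boolP (pone \in A)) => oA; last by rewrite psumE // psum_le1.
  rewrite psum_mem_pone // (coord_lin ce) z0 coord_e_eq mulr1 addr0.
  by rewrite -[leRHS]pow1p ler_powRp.
have [A FA hA] := psum_attained1 z1; exists A => //; rewrite psumE ?hA //.
apply: contraPN hA => oA; rewrite psum_mem_pone // z0 normr0 powR0 ?exponent_neq0 //.
by move=> /eqP; rewrite eq_sym oner_eq0.
Qed.

Lemma face_pone y : face (e pone) y <-> `|y| = 1 /\ c y pone = 1.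
Proof.
split=> [[y1 ye]|[y1 y0]]; split => //.
  have hle := coord_le y pone; rewrite y1 ler_norml in hle; case/andP: hle => h1 h2.
  have [A FA hA] := psum_attained ce (y + e pone); rewrite ye in hA.
  case: (boolP (pone \in A)) => oA.
    move: hA; rewrite psum_mem_pone // coordD coord_e_eq => /powRp_inj.
    move=> /(_ (normr_ge0 _))/(_ (ler0n _ 2)); rewrite ger0_norm; lra.
  have : psum p A (c (y + e pone)) <= 1.
    rewrite (@eq_psum _ _ A _ (c y)) ?psum_le1 // => i iA.
    by rewrite coordD coord_e_neq ?addr0 //; apply: contraNneq oA => <-.
  by rewrite hA => h; have := le_2powRp; lra.
apply/le_anti/andP; split.
  by apply: le_trans (ler_normD _ _) _; rewrite y1 norm_basis.
apply: le_trans (coord_le _ pone); rewrite coordD y0 coord_e_eq.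
exact: ler_norm.
Qed.

Lemma face_eq (Z : set X) (FZ : face_system Z) z w : Z z -> Z w ->
  (forall y, `|y| = 1 -> face z y -> face w y) -> z = w.
Proof.
move=> Zz Zw h; have z1 := fs_norm FZ Zz.
by apply: (fs_inj FZ) => //; apply: h => //; exact: face_self.
Qed.

(** If the face of [e pone] went to the face of a centre w other than +- [e pone], a face disjoint
    from that of w would come from a face disjoint from that of [e pone]; but a centre [z']
    vanishing at [pone] always shares the point [e pone + z'] with it. *)
Lemma coord_pone_map (Z : set X) T T' : face_system Z -> Z (e pone) ->
  (forall z, Z z -> [\/ z = e pone, z = - e pone | c z pone = 0]) ->
  (forall z, Z z -> c z pone = 0 -> exists w,
     [/\ Z w, w <> z, w <> - z & forall y, face z y -> ~ face w y]) ->
  sphere_isometry T T' ->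
  exists2 s : R, s = 1 \/ s = - 1 & forall x, `|x| = 1 -> c (T x) pone = s * c x pone.
Proof.
move=> FZ Ze Zpone Zdisj TT'.
have TT'' := sphere_isometry_sym TT'.
have [w [Zw ew eNw]] := face_map FZ TT' Ze.
have [s s1 ws] : exists2 s : R, s = 1 \/ s = - 1 & w = s *: e pone.
  case: (Zpone w Zw) => [->|->|w0].
  - by exists 1; [left|rewrite scale1r].
  - by exists (- 1); [right|rewrite scaleN1r].
  have [w' [Zw' w'w w'Nw disj]] := Zdisj w Zw w0.
  have [z' [Zz' wz' _]] := face_map FZ TT'' Zw'.
  case: (Zpone z' Zz') => [z'e|z'e|z'0].
  - case: w'w; apply: (face_eq FZ) => // y y1 /(wz' y y1); rewrite z'e.
    by move=> /(ew _ (si_norm' TT' y1)); rewrite (si_K' TT').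
  - case: w'Nw; apply: (face_eq FZ) => //; first exact: fs_opp.
    move=> y y1 /(wz' y y1); rewrite z'e.
    by move=> /(eNw _ (si_norm' TT' y1)); rewrite (si_K' TT').
  exfalso; pose y := 1 *: e pone + z'.
  have y1 : `|y| = 1 by apply: norm_pone_add; rewrite ?normr1 ?(fs_norm FZ).
  apply: (disj (T y)).
    apply/ew => //; apply/face_pone; split => //.
    by rewrite (coord_lin ce) z'0 coord_e_eq mulr1 addr0.
  apply/wz'; first exact: si_norm TT' _ y1.
  rewrite (si_K TT') //; split => //.
  (* The sum is twice [2^-1 *: e pone + z'], to which [norm_pone_add] applies again. *)
  rewrite -addrA -mulr2n -scaler_nat -[1 in X in X *: e _](@mulfV _ 2) //.
  rewrite -scalerA -scalerDr normrZ norm_pone_add ?(fs_norm FZ) ?mulr1 ?normr_nat //.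
  by rewrite ger0_norm ?invr_ge0 // invf_le1 // ler1n.
exists s => // x x1.
have xle := coord_le x pone; rewrite x1 ler_norml in xle; case/andP: xle => xl xu.
(* Setting the first coordinate to 1 or - 1 gives points on the two opposite faces, at distances 1 -
   x_1 and 1 + x_1 from [x]; the two resulting bounds leave a single value for (T x)_1. *)
have dist (a : R) : `|a| = 1 -> exists2 y, `|y| = 1 /\ c y pone = a & `|x - y| = `|a - c x pone|.
  move=> a1; exists (x + (a - c x pone) *: e pone); last exact: norm_addN_basis.
  split; last by rewrite coordD coordZ coord_e_eq mulr1 addrC subrK.
  apply: norm1_psum => [A FA|].
    rewrite psum_change; case: ifP => oA; last by rewrite psum_le1.
    by rewrite (schreier_one F_schreier FA oA) fsetDv psum0 addr0 a1 powR1.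
  exists [fset pone]%fset; first exact: schreier_sing.
  by rewrite psum_change inE eqxx fsetDv psum0 addr0 a1 powR1.
have [y [y1 yo] xy] := dist 1 (normr1 _).
have Ty : c (T y) pone = s.
  have /(ew y y1) : face (e pone) y by apply/face_pone.
  case: s1 ws => -> ->; rewrite ?scale1r ?scaleN1r.
    by move=> /face_pone[].
  move=> /face_opp/face_pone[_]; rewrite coordN => h; lra.
have [y' [y'1 y'o] xy'] := dist (- 1) (normrN1 _).
have Ty' : c (T y') pone = - s.
  have /(eNw y' y'1) : face (- e pone) y'.
    by apply/face_opp/face_pone; rewrite normrN coordN y'o opprK.
  case: s1 ws => -> ->; rewrite ?scale1r ?scaleN1r ?opprK.
    move=> /face_opp/face_pone[_]; rewrite coordN => h; lra.
  by move=> /face_pone[].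
have h1 := coord_le (T x - T y) pone; have h2 := coord_le (T x - T y') pone.
rewrite (si_dist TT') // xy coordB Ty ler_norml in h1.
rewrite (si_dist TT') // xy' coordB Ty' ler_norml in h2.
rewrite ger0_norm in h1; last lra.
rewrite ler0_norm in h2; last lra.
case/andP: h1 => ? ?; case/andP: h2 => ? ?.
by case: s1 => ss; rewrite ss in Ty Ty' *; lra.
Qed.

End Coordinates.

(** * From coordinates on norming sets to a linear extension *)

Section Extension.
Context (R : realType) (p : R) (F : set {fset posN}).
Context (X : normedModType R) (c : X -> posN -> R) (e : posN -> X).
Context (p_ge1 : 1 <= p) (F_schreier : schreier_family F).
Context (ce : coordinates p F c e).
Context (T T' : X -> X) (TT' : sphere_isometry T T').
Context (g : posN -> posN) (s : posN -> R).
Context (s_sign : forall i, s i = 1 \/ s i = - 1).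
Context (g_surj : forall k, exists i, g i = k).
Context (T_normed : forall x A i, `|x| = 1 -> F A -> psum p A (c x) = 1 ->
  i \in A -> c (T x) (g i) = s i * c x i).
Implicit Types (x y z : X) (A B : {fset posN}) (i k : posN).

Lemma signed_coord x i : `|x| = 1 -> c (T x) (g i) = s i * c x i.
Proof.
move=> x1; have p0 := exponent_gt0 p_ge1.
(* The value 3 exceeds the norm of [x], so a set norming [x'] must contain [i]; it then maximises
   the sum over [B \ i] among all the sets of [F] containing [i]. *)
pose x' := x + (3 - c x i) *: e i.
have x'E B := psum_change ce B x 3 i; rewrite -/x' in x'E.
have [A FA hA] := psum_attained ce x'.
have xi1 : `|c x i| <= 1 by rewrite -x1 (coord_le p_ge1 F_schreier ce).
have x'3 : 3 <= `|x'|.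
  have := coord_le p_ge1 F_schreier ce x' i.
  by rewrite /x' (coordD ce) (coordZ ce) (coord_e_eq ce) mulr1 addrC subrK ger0_norm.
have iA : i \in A.
  apply: contraT => iA; have := psum_change ce A x 3 i; rewrite (negbTE iA) -/x' hA => h.
  have := psum_le1 ce FA x1; rewrite -h -[leRHS](pow1p p) (ler_powRp p_ge1) //; lra.
pose m := psum p (A `\ i)%fset (c x).
have hA' : `|x'| `^ p = 3 `^ p + m.
  by rewrite -hA x'E iA ger0_norm.
have m0 : 0 <= m by exact: psum_ge0.
have m1 : m + `|c x i| `^ p <= 1 by rewrite addrC -psumD1 // (psum_le1 ce).
(* The modulus at coordinate [i] for which [A] sums to exactly 1; by maximality of [m] no other set
   exceeds 1. *)
pose Y := (1 - m) `^ p^-1.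
have Y0 : 0 <= Y by exact: powR_ge0.
have m1' : 0 <= 1 - m by have := powR_ge0 `|c x i| p; lra.
have Yp : Y `^ p = 1 - m by rewrite -powRrM mulVf ?exponent_neq0 // powRr1.
have xY : `|c x i| <= Y by rewrite -(ler_powRp p_ge1) // Yp; lra.
have key (a : R) : `|a| = Y ->
    `|s i * a - c (T x) (g i)| <= `|a - c x i|.
  move=> aY; pose y := x + (a - c x i) *: e i.
  have yE B := psum_change ce B x a i; rewrite -/y in yE.
  have yA : psum p A (c y) = 1 by rewrite yE iA aY Yp subrK.
  have yi : c y i = a.
    by rewrite (coordD ce) (coordZ ce) (coord_e_eq ce) mulr1 addrC subrK.
  have y1 : `|y| = 1.
    apply: (norm1_psum p_ge1 ce) => [B FB|]; last by exists A; rewrite ?yA.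
    rewrite yE; case: ifP => iB; last exact: (psum_le1 ce).
    have := psum_le ce x' FB; rewrite x'E iB hA' aY Yp ger0_norm //; lra.
  have := coord_le p_ge1 F_schreier ce (T y - T x) (g i).
  rewrite (coordB ce) (T_normed y1 FA yA iA) yi (si_dist TT') // (distrC y).
  by rewrite /y (norm_addN_basis p_ge1 F_schreier ce).
move: xY (key Y (ger0_norm Y0)) (key (- Y)); rewrite normrN (ger0_norm Y0) => xY h1 /(_ erefl) h2.
rewrite ler_norml in xY; case/andP: xY => xl xu.
have e1 : `|Y - c x i| = Y - c x i by rewrite ger0_norm //; lra.
have e2 : `|- Y - c x i| = Y + c x i by rewrite ler0_norm; lra.
rewrite e1 ler_norml in h1; rewrite e2 ler_norml in h2.
by case/andP: h1 => + +; case/andP: h2 => + +; case: (s_sign i) => ->; lra.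
Qed.

(** The homogeneous extension inherits [signed_coord] at every vector; as [g] is onto and the
    coordinates separate points, it is linear. *)
Lemma linear_extension : exists U : {linear X -> X},
  [/\ isometry_on [set: X] U, set_surj [set: X] [set: X] U
    & forall x, unit_sphere X x -> U x = T x].
Proof.
pose U x := `|x| *: T (`|x|^-1 *: x).
have nrm x : x != 0 -> `| `|x|^-1 *: x | = 1.
  by move=> x0; rewrite normrZ normfV normr_id mulVf // normr_eq0.
have Uc x i : c (U x) (g i) = s i * c x i.
  have [->|x0] := eqVneq x 0.
    by rewrite /U normr0 scale0r !(coord0 ce) mulr0.
  rewrite /U (coordZ ce) signed_coord ?nrm // (coordZ ce).
  by rewrite mulrCA mulVKf ?normr_eq0.
have Ulin : linear U.
  move=> a x y; apply: (coord_inj p_ge1 ce) => k; have [i <-] := g_surj k.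
  rewrite (coord_lin ce) !Uc (coord_lin ce); ring.
have Unorm x : `|U x| = `|x|.
  have [->|x0] := eqVneq x 0; first by rewrite /U normr0 scale0r normr0.
  by rewrite /U normrZ (si_norm TT') ?nrm // normr_id mulr1.
pose UL : {linear X -> X} := HB.pack U (GRing.isLinear.Build R X X *:%R U Ulin).
exists UL; split => /=.
- by move=> x y _ _; rewrite -(raddfB UL) /= Unorm.
- move=> y _; have [->|y0] := eqVneq y 0.
    by exists 0 => //; rewrite /= /U normr0 scale0r.
  exists (`|y| *: T' (`|y|^-1 *: y)) => //=.
  have h : `|T' (`|y|^-1 *: y)| = 1 by rewrite (si_norm' TT') ?nrm.
  rewrite /U normrZ normr_id h mulr1 scalerA mulVf ?normr_eq0 // scale1r.
  by rewrite (si_K' TT') ?nrm // scalerA mulfV ?normr_eq0 // scale1r.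
- by move=> x x1; rewrite /= /U x1 invr1 !scale1r.
Qed.

End Extension.

Lemma fset_above (A : {fset posN}) : exists b : posN, forall i, i \in A -> (val i < val b)%N.
Proof.
pose b : posN := exist _ (\max_(i <- A) val i).+1%N isT; exists b => i iA.
by rewrite /= ltnS; apply: (@leq_bigmax_seq _ _ predT (fun i : posN => val i)).
Qed.

Lemma ler_sum_eq (R : realType) (A : {fset posN}) (f h : posN -> R) :
  (forall i, i \in A -> f i <= h i) -> \sum_(i <- A) h i <= \sum_(i <- A) f i ->
  forall i, i \in A -> f i = h i.
Proof.
move=> fh hf i iA; apply/le_anti; rewrite fh //= -subr_ge0.
move: hf; rewrite [leLHS](big_fsetD1 i) //= [leRHS](big_fsetD1 i) //= => hf.
have : \sum_(k <- (A `\ i)%fset) f k <= \sum_(k <- (A `\ i)%fset) h k.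
  rewrite big_seq [leRHS]big_seq; apply: ler_sum => k.
  by rewrite !inE => /andP[_ /fh].
lra.
Qed.

(** * Signed permutations of the basis *)

Section BasisPermutation.
Context (R : realType) (p : R) (F : set {fset posN}).
Context (X : normedModType R) (c : X -> posN -> R) (e : posN -> X).
Context (p_ge1 : 1 <= p) (F_schreier : schreier_family F).
Context (ce : coordinates p F c e).
Implicit Types (x y z : X) (A B : {fset posN}) (i k : posN).

Lemma ltr_powRp (a b : R) : 0 <= a -> 0 <= b -> (a `^ p < b `^ p) = (a < b).
Proof. by move=> a0 b0; rewrite !ltNge ler_powRp. Qed.

Lemma psum_add A x (a : R) i :
  psum p A (c (x + a *: e i)) =
  if i \in A then `|c x i + a| `^ p + psum p (A `\ i)%fset (c x) else psum p A (c x).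
Proof. by rewrite -(psum_change ce) addrAC subrr add0r. Qed.

Lemma psum_miss A B z i : (forall k, k \notin A -> c z k = 0) -> i \in A -> i \notin B ->
  psum p B (c z) + `|c z i| `^ p <= psum p A (c z).
Proof.
move=> zA iA iB; rewrite addrC (psumD1 _ _ iA) lerD2l.
rewrite -(@psum_sub_eq _ p (B `&` A)%fset B) ?fsubsetIl ?(exponent_neq0 p_ge1) //.
  apply: psum_sub; apply/fsubsetP => k; rewrite !inE => /andP[kB ->].
  by rewrite andbT; apply: contraNneq iB => <-.
by move=> k kB; rewrite inE kB /=; exact: zA.
Qed.

(** If a set attaining |x - e_i| contains i, it does better for x + e_i, since |x_i - 1| < x_i + 1.
    If not, it gives at most 1, while |x + e_i| is at least x_i + 1. *)
Lemma dist_basis_lt x i : `|x| = 1 -> 0 < c x i -> `|x - e i| < `|x + e i|.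
Proof.
move=> x1 xi; rewrite -ltr_powRp //.
have [A FA <-] := psum_attained ce (x - e i).
rewrite -scaleN1r psum_add -[in ltRHS](scale1r (e i)).
case: ifP => iA.
  apply: (@lt_le_trans _ _ (psum p A (c (x + 1 *: e i)))); last exact: (psum_le ce).
  rewrite psum_add iA ltrD2r ltr_powRp //.
  have -> : `|c x i + 1| = c x i + 1 by rewrite ger0_norm //; lra.
  by rewrite ltr_norml; apply/andP; split; lra.
apply: (le_lt_trans (psum_le1 ce FA x1)).
rewrite -[ltLHS](pow1p p) ltr_powRp //.
apply: lt_le_trans (coord_le p_ge1 F_schreier ce _ i).
rewrite (coordD ce) (coordZ ce) (coord_e_eq ce) gtr0_norm; lra.
Qed.

Lemma signed_basis_coord x i (s : R) : `|x| = 1 -> s = 1 \/ s = - 1 ->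
  `|x - s *: e i| < `|x + s *: e i| -> 0 <= s * c x i.
Proof.
move=> x1 s1 h; rewrite leNgt; apply/negP => h0.
have ss : s * s = 1 by case: s1 => ->; rewrite ?mulrNN mulr1.
have ns : `|s| = 1 by case: s1 => ->; rewrite ?normrN normr1.
have y1 : `|- s *: x| = 1 by rewrite normrZ normrN ns x1 mulr1.
have := dist_basis_lt (i := i) y1; rewrite (coordZ ce) mulNr oppr_gt0 => /(_ h0).
have -> : `|- s *: x - e i| = `|x + s *: e i|.
  rewrite -[RHS]mul1r -ns -normrZ scalerDr scalerA ss scale1r -normrN.
  by rewrite opprB scaleNr opprK addrC.
have -> : `|- s *: x + e i| = `|x - s *: e i|.
  rewrite -[RHS]mul1r -ns -normrZ scalerBr scalerA ss scale1r -normrN.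
  by rewrite opprD scaleNr opprK.
by move=> /(lt_trans h); rewrite ltxx.
Qed.

(** The images of [e i] and [- e i] are both recorded, since T is not known to be odd. [pone] is
    excluded: there T is controlled through the first coordinate only. *)
Definition basis_mapping (T : X -> X) := forall i, i != pone -> exists k (s : R),
  [/\ k != pone, s = 1 \/ s = - 1, T (e i) = s *: e k & T (- e i) = - (s *: e k)].

Record basis_action (T : X -> X) (g : posN -> posN) (s : posN -> R) : Prop := {
  ba_sign : forall i, s i = 1 \/ s i = - 1;
  ba_inj : injective g;
  ba_surj : forall k, exists i, g i = k;
  ba_pone : g pone = pone;
  ba_coord : forall x, `|x| = 1 -> c (T x) pone = s pone * c x pone;
  ba_basis : forall i, i != pone -> T (e i) = s i *: e (g i);
  ba_basisN : forall i, i != pone -> T (- e i) = - (s i *: e (g i))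
}.

Lemma signed_basis_inj (s t : R) i k : s = 1 \/ s = - 1 -> s *: e i = t *: e k -> i = k.
Proof.
move=> s1 h; apply/eqP; apply: contraT => ik; have := congr1 (fun x => c x i) h.
rewrite /= !(coordZ ce) (coord_e_eq ce) (coord_e_neq ce ik) mulr0 mulr1 => s0.
by case: s1; rewrite s0 => /eqP; rewrite ?(eq_sym 0) ?oppr_eq0 ?oner_eq0.
Qed.

(** Injectivity of [g] comes from cancelling T on the vectors +- e_i, surjectivity from applying the
    hypothesis to the inverse. *)
Lemma exists_basis_action T T' : sphere_isometry T T' ->
  basis_mapping T -> basis_mapping T' ->
  (exists2 t : R, t = 1 \/ t = - 1 & forall x, `|x| = 1 -> c (T x) pone = t * c x pone) ->
  exists g s, basis_action T g s.
Proof.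
move=> TT' bT bT' [t t1 Tt].
have : forall i, exists k, exists s : R, [/\ (k == pone) = (i == pone), s = 1 \/ s = - 1,
    i = pone -> s = t & i != pone -> T (e i) = s *: e k /\ T (- e i) = - (s *: e k)].
  move=> i; have [->|i1] := eqVneq i pone.
    by exists pone, t; rewrite eqxx.
  have [k [s [k1 s1 h1 h2]]] := bT i i1; exists k, s; split => //.
    by rewrite (negbTE k1).
  by move=> ii; rewrite ii eqxx in i1.
move=> /choice[g] /choice[s] gs; exists g, s.
have g1 : g pone = pone by have [/eqP] := gs pone; rewrite eqxx => /eqP/eqP.
have gE i : i != pone -> T (e i) = s i *: e (g i).
  by move=> i1; have [_ _ _ /(_ i1)[]] := gs i.
have gNE i : i != pone -> T (- e i) = - (s i *: e (g i)).
  by move=> i1; have [_ _ _ /(_ i1)[]] := gs i.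
have s1 i : s i = 1 \/ s i = - 1 by have [] := gs i.
have gpone i : (g i == pone) = (i == pone) by have [] := gs i.
have ne i : `|e i| = 1 by exact: (norm_basis p_ge1 F_schreier ce).
split => //.
- move=> i k gik; have [i1|i1] := eqVneq i pone.
    by apply/esym/eqP; rewrite i1 -gpone -gik i1 g1.
  have k1 : k != pone by rewrite -gpone -gik gpone.
  have [ss|ss] : s i = s k \/ s i = - s k.
    by case: (s1 i) => ->; case: (s1 k) => ->; rewrite ?opprK; [left|right|right|left].
  - have h : e i = e k.
      by rewrite -(si_K TT' (ne i)) gE // ss gik -gE // (si_K TT').
    by apply: (@signed_basis_inj 1 1); [left|rewrite !scale1r].
  - have h : e i = - e k.
      by rewrite -(si_K TT' (ne i)) gE // ss gik scaleNr -gNE // (si_K TT') ?normrN.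
    by apply: (@signed_basis_inj 1 (- 1)); [left|rewrite scale1r scaleN1r].
- move=> k; have [->|k1] := eqVneq k pone; first by exists pone.
  have [i [r [i1 r1 h1 h2]]] := bT' k k1; exists i.
  have : T (T' (e k)) = e k by rewrite (si_K' TT').
  rewrite h1; case: r1 => ->; rewrite ?scaleN1r ?scale1r.
    by rewrite gE // => h; apply: (@signed_basis_inj (s i) 1); rewrite ?scale1r.
  rewrite gNE // => h; apply: (@signed_basis_inj (s i) (- 1)) => //.
  by rewrite scaleN1r -h opprK.
- by move=> x x1; have [_ _ /(_ erefl)-> _] := gs pone; exact: Tt.
Qed.

Section Signed.
Context (T T' : X -> X) (TT' : sphere_isometry T T').
Context (g : posN -> posN) (s : posN -> R) (Tgs : basis_action T g s).

Lemma basis_action_dist x i : `|x| = 1 -> i != pone ->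
  `|T x - s i *: e (g i)| = `|x - e i|.
Proof.
move=> x1 i1; rewrite -(ba_basis Tgs i1) (si_dist TT') //.
exact: (norm_basis p_ge1 F_schreier ce).
Qed.

Lemma basis_action_distN x i : `|x| = 1 -> i != pone ->
  `|T x + s i *: e (g i)| = `|x + e i|.
Proof.
move=> x1 i1; rewrite -[s i *: _]opprK -(ba_basisN Tgs i1) (si_dist TT') ?opprK //.
by rewrite normrN (norm_basis p_ge1 F_schreier ce).
Qed.

(** T preserves the distances to e_i and to - e_i, and comparing these two reveals the sign of the
    coordinate. *)
Lemma signed_of_norm x i : `|x| = 1 -> i != pone -> `|c (T x) (g i)| = `|c x i| ->
  c (T x) (g i) = s i * c x i.
Proof.
move=> x1 i1 h; have Tx1 := si_norm TT' x1.
have si1 := ba_sign Tgs i.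
have [xi|xi|xi] := ltrgt0P (c x i).
- have := dist_basis_lt x1 xi; rewrite -basis_action_dist // -basis_action_distN //.
  move=> /(signed_basis_coord Tx1 si1) h1.
  move: h h1; rewrite (gtr0_norm xi); case: si1 => ->; rewrite ?mulN1r ?mul1r => <- h1.
    by rewrite ger0_norm.
  by rewrite ler0_norm ?opprK // -oppr_ge0.
- have : 0 < c (- x) i by rewrite (coordN ce) oppr_gt0.
  have Nx1 : `|- x| = 1 by rewrite normrN.
  move=> /(dist_basis_lt Nx1); rewrite -normrN opprB opprK addrC.
  rewrite -[ltRHS]normrN opprD opprK -basis_action_dist // -basis_action_distN //.
  have Ns : - s i = 1 \/ - s i = - 1 by case: si1 => ->; rewrite ?opprK; [right|left].
  have := signed_basis_coord (i := g i) Tx1 Ns; rewrite scaleNr opprK => h1 /h1.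
  move: h; rewrite (ltr0_norm xi); case: si1 => ->; rewrite ?mulN1r ?opprK ?mul1r => h h2.
    by rewrite -[c x i]opprK -h ler0_norm ?opprK // -oppr_ge0.
  by rewrite -h ger0_norm.
- by apply/eqP; rewrite xi mulr0 -normr_eq0 h xi normr0.
Qed.

End Signed.
End BasisPermutation.

(** * Exponent 1 *)

Section ExponentOne.
Context (R : realType) (F : set {fset posN}).
Context (X : normedModType R) (c : X -> posN -> R) (e : posN -> X).
Context (F_schreier : schreier_family F).
Context (F_pair : forall i k : posN, i != pone -> k != pone -> F [fset i; k]%fset).
Context (F_triple : forall i j k : posN, (2 < val i)%N -> (val i < val j)%N ->
  (val j < val k)%N -> F [fset i; j; k]%fset).
Context (ce : coordinates (1 : R) F c e).
Implicit Types (x y z w : X) (A B : {fset posN}) (i k : posN) (th : posN -> R).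

Let le11 : (1 : R) <= 1. Proof. exact: lexx. Qed.

(** Enlarging a set never lowers the sum, so norming sets may be taken maximal; maximality then
    ensures that a centre is normed by its own set only, see [center_norming]. *)
Definition maximal_set A := F A /\ forall k, F (k |` A)%fset -> k \in A.

Definition signs th := forall i, th i = 1 \/ th i = - 1.

Definition functional A th x : R := \sum_(i <- A) th i * c x i.

Definition sum_face A th y := `|y| = 1 /\ functional A th y = 1.

Definition center A th : X := \sum_(i <- A) (th i / #|` A|%:R) *: e i.

Definition centers : set X := [set z | exists A th,
  [/\ maximal_set A, signs th & z = center A th]].

Lemma sign_abs th i : signs th -> `|th i| = 1.
Proof. by case/(_ i) => ->; rewrite ?normrN normr1. Qed.

Lemma sign_sq th i : signs th -> th i * th i = 1.
Proof. by case/(_ i) => ->; rewrite ?mulrNN mulr1. Qed.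

Lemma signsN th : signs th -> signs (fun i => - th i).
Proof. by move=> s1 i; case: (s1 i) => ->; rewrite ?opprK; [right|left]. Qed.

Lemma psum_sum A f : psum (1 : R) A f = \sum_(i <- A) `|f i|.
Proof. by apply: eq_bigr => i _; rewrite powRr1. Qed.

Lemma sum_le_norm A x : F A -> \sum_(i <- A) `|c x i| <= `|x|.
Proof. by move=> FA; have := psum_le ce x FA; rewrite psum_sum powRr1. Qed.

Lemma sum_attained x : exists2 A, F A & \sum_(i <- A) `|c x i| = `|x|.
Proof. by have := psum_attained ce x; rewrite powRr1 // => -[A FA]; rewrite psum_sum; exists A. Qed.

Lemma functional_term th x i : signs th -> th i * c x i <= `|c x i|.
Proof. by move=> s1; apply: le_trans (ler_norm _) _; rewrite normrM (sign_abs i s1) mul1r. Qed.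

Lemma functional_le_sum A th x : signs th -> functional A th x <= \sum_(i <- A) `|c x i|.
Proof. by move=> s1; apply: ler_sum => i _; exact: functional_term. Qed.

Lemma functional_le A th x : F A -> signs th -> functional A th x <= `|x|.
Proof. by move=> FA s1; exact: le_trans (functional_le_sum _ _ s1) (sum_le_norm _ FA). Qed.

Lemma functionalD A th x y : functional A th (x + y) = functional A th x + functional A th y.
Proof. by rewrite -big_split; apply: eq_bigr => i _; rewrite (coordD ce) mulrDr. Qed.

Lemma functionalN A th x : functional A th (- x) = - functional A th x.
Proof. by rewrite -sumrN; apply: eq_bigr => i _; rewrite (coordN ce) mulrN. Qed.

Lemma functional_sign A th x : functional A (fun i => - th i) x = - functional A th x.
Proof. by rewrite -sumrN; apply: eq_bigr => i _; rewrite mulNr. Qed.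

Lemma functional_basis A th (a : R) i :
  functional A th (a *: e i) = if i \in A then th i * a else 0.
Proof.
rewrite /functional; case: ifP => iA.
  rewrite (big_fsetD1 i) //= big1_seq => [|k /=]; rewrite (coordZ ce).
    by rewrite (coord_e_eq ce) mulr1 addr0.
  by rewrite !inE => /andP[ki _]; rewrite (coord_e_neq ce ki) !mulr0.
rewrite big1_seq // => k /= kA; rewrite (coordZ ce) (coord_e_neq ce) ?mulr0 ?mulr0 //.
by apply: contraFneq iA => <-.
Qed.

Lemma sum_face_abs A th y : F A -> signs th -> sum_face A th y ->
  forall i, i \in A -> `|c y i| = th i * c y i.
Proof.
move=> FA s1 [y1 fy] i iA; apply/esym.
apply: (@ler_sum_eq _ A (fun i => th i * c y i) (fun i => `|c y i|)) => // [k _|].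
  exact: functional_term.
by rewrite -[leRHS]/(functional A th y) fy -y1 sum_le_norm.
Qed.

Lemma sum_face_sum A th y : F A -> signs th -> sum_face A th y -> \sum_(i <- A) `|c y i| = 1.
Proof.
move=> FA s1 fy; case: (fy) => _ <-; apply: eq_big_seq => i iA.
exact: (sum_face_abs FA s1 fy).
Qed.

Lemma maximal_eq A B : maximal_set A -> F B -> (A `<=` B)%fset -> A = B.
Proof.
move=> [FA mA] FB AB; apply/eqP; rewrite eqEfsubset AB; apply/fsubsetP => k kB.
apply: mA; apply: (schreier_sub F_schreier FB); apply/fsubsetP => l.
by rewrite !inE => /orP[/eqP->//|]; exact: (fsubsetP AB).
Qed.

Lemma maximal_card_gt0 A : maximal_set A -> 0 < #|` A|%:R :> R.
Proof.
move=> [FA mA]; rewrite ltr0n lt0n cardfs_eq0; apply/eqP => A0.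
have : pone \in A by apply: mA; rewrite A0 fsetU0; exact: schreier_sing.
by rewrite A0 inE.
Qed.

Lemma maximal_pone A : maximal_set A -> pone \in A -> A = [fset pone]%fset.
Proof. by move=> [FA _]; exact: (schreier_one F_schreier FA). Qed.

Lemma coord_center A th i : c (center A th) i = if i \in A then th i / #|` A|%:R else 0.
Proof. exact: (coord_vec ce). Qed.

Lemma functional_center A th : maximal_set A -> signs th -> functional A th (center A th) = 1.
Proof.
move=> mA s1; have A0 := maximal_card_gt0 mA.
rewrite /functional (eq_big_seq (fun=> #|` A|%:R^-1)) => [|i iA].
  by rewrite big_const_seq count_predT iter_addr_0 -[_ *+ _]mulr_natl mulfV // gt_eqF.
by rewrite coord_center iA mulrA (sign_sq i s1) mul1r.
Qed.

Lemma abs_center A th i : signs th -> `|c (center A th) i| = if i \in A then #|` A|%:R^-1 else 0.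
Proof.
move=> s1; rewrite coord_center; case: ifP => _; last by rewrite normr0.
by rewrite normrM (sign_abs i s1) mul1r ger0_norm // invr_ge0.
Qed.

Lemma norm_center A th : maximal_set A -> signs th -> `|center A th| = 1.
Proof.
move=> mA s1; have A0 := maximal_card_gt0 mA; have [FA _] := mA.
rewrite -[LHS]powRr1 // (@norm_support _ _ _ _ _ _ le11 ce A) //.
  rewrite psum_sum (eq_big_seq (fun=> #|` A|%:R^-1)) => [|i iA].
    by rewrite big_const_seq count_predT iter_addr_0 -[_ *+ _]mulr_natl mulfV // gt_eqF.
  by rewrite abs_center // iA.
by move=> i /negbTE iA; rewrite coord_center iA.
Qed.

Lemma centerN A th : center A (fun i => - th i) = - center A th.
Proof. by rewrite -sumrN; apply: eq_bigr => i _; rewrite mulNr scaleNr. Qed.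

Lemma center_norming A B th : maximal_set A -> signs th -> F B ->
  1 <= \sum_(i <- B) `|c (center A th) i| -> A = B.
Proof.
move=> mA s1 FB h; apply: maximal_eq => //; apply/fsubsetP => i iA.
apply: contraT => iB.
have zA k : k \notin A -> c (center A th) k = 0 by move=> /negbTE kA; rewrite coord_center kA.
have := psum_miss le11 zA iA iB; rewrite !psum_sum powRr1 // abs_center // iA => h1.
have := sum_le_norm (center A th) mA.1; rewrite norm_center //.
have : 0 < #|` A|%:R^-1 :> R by rewrite invr_gt0 maximal_card_gt0.
lra.
Qed.

(** A set attaining |y + z| = 2 norms both [y] and [z], so it is [A]; the triangle inequality is an
    equality in each coordinate of it, so [y] has the signs of [z] there, zeros allowed. *)
Lemma face_center A th y : maximal_set A -> signs th ->
  face (center A th) y <-> sum_face A th y.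
Proof.
move=> mA s1; have [FA _] := mA; have z1 := norm_center mA s1.
split=> [[y1 yz]|[y1 fy]]; split => //.
  have [B FB hB] := sum_attained (y + center A th).
  have hle k : k \in B -> `|c (y + center A th) k| <= `|c y k| + `|c (center A th) k|.
    by move=> _; rewrite (coordD ce) ler_normD.
  have yB := sum_le_norm y FB; have zB := sum_le_norm (center A th) FB.
  rewrite y1 in yB; rewrite z1 in zB.
  have sumB : \sum_(k <- B) (`|c y k| + `|c (center A th) k|) <= \sum_(k <- B) `|c (y + center A th) k|.
    rewrite hB yz big_split /=; lra.
  have eqB := ler_sum_eq hle sumB.
  have AB : A = B.
    apply: (center_norming mA s1 FB).
    have : \sum_(k <- B) `|c (y + center A th) k| <= \sum_(k <- B) (`|c y k| + `|c (center A th) k|).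
      by rewrite big_seq [leRHS]big_seq; exact: ler_sum.
    rewrite hB yz big_split /=; lra.
  apply/le_anti; rewrite -{1}y1 functional_le //=.
  have -> : functional A th y = \sum_(k <- A) `|c y k|.
    apply: eq_big_seq => k kA; have kB : k \in B by rewrite -AB.
    have := eqB k kB; rewrite (coordD ce) coord_center kA.
    have A0 := maximal_card_gt0 mA; set n := #|` A|%:R in A0 *.
    have n0 : 0 < n^-1 by rewrite invr_gt0.
    case: (s1 k) => ->; rewrite ?mulN1r ?normrN ?mul1r (gtr0_norm n0) => h.
      by rewrite ger0_norm // leNgt; apply/negP => y0; move: h; rewrite (ltr0_norm y0);
        case: (lerP 0 (c y k + n^-1)) => [/ger0_norm|/ltr0_norm] ->; lra.
    rewrite ler0_norm // leNgt; apply/negP => y0; move: h; rewrite (gtr0_norm y0);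
      case: (lerP 0 (c y k - n^-1)) => [/ger0_norm|/ltr0_norm] ->; lra.
  rewrite -AB in hB zB.
  have : \sum_(k <- A) `|c (y + center A th) k| <= \sum_(k <- A) (`|c y k| + `|c (center A th) k|).
    by apply: ler_sum => k _; rewrite (coordD ce) ler_normD.
  rewrite hB yz big_split /=; lra.
apply/le_anti/andP; split.
  by apply: le_trans (ler_normD _ _) _; rewrite y1 z1.
have := functional_le (y + center A th) FA s1.
by rewrite functionalD fy functional_center.
Qed.

Lemma maximal_above A : F A -> exists2 B, maximal_set B & (A `<=` B)%fset.
Proof.
move=> FA.
have [B [FB AB mB]] := maximal_superset (schreier_compact F_schreier) (schreier_sub F_schreier) FA.
by exists B.
Qed.

(** Unlike the usual sign it is never zero, as [signs] requires. *)
Definition sign_of (a : R) : R := if 0 <= a then 1 else - 1.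

Lemma sign_ofP f : signs (fun i => sign_of (f i)).
Proof. by move=> i; rewrite /sign_of; case: ifP; [left|right]. Qed.

Lemma sign_of_mul (a : R) : sign_of a * a = `|a|.
Proof.
rewrite /sign_of; case: (leP 0 a) => [a0|a0]; first by rewrite mul1r ger0_norm.
by rewrite mulN1r ltr0_norm.
Qed.

Lemma centers_system : face_system centers.
Proof.
split.
- by move=> z [A [th [mA s1 ->]]]; exact: norm_center.
- move=> z [A [th [mA s1 ->]]]; exists A, (fun i => - th i); split => //.
    exact: signsN.
  by rewrite centerN.
(* A set attaining |x - y| = 2 is enlarged to a maximal one. The functional with the signs of x - y
   has value 2, which x and - y can only share equally. *)
- move=> x y x1 y1 xy; have [B FB hB] := sum_attained (x - y).
  have [A mA BA] := maximal_above FB; have [FA _] := mA.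
  pose th i := sign_of (c (x - y) i); have s1 : signs th by exact: sign_ofP.
  have : functional A th (x - y) = \sum_(i <- A) `|c (x - y) i|.
    by apply: eq_bigr => i _; rewrite sign_of_mul.
  have := psum_sub 1 (c (x - y)) BA; rewrite !psum_sum hB xy => h1 h2.
  have h3 := functional_le x FA s1; have h4 := functional_le (- y) FA s1.
  rewrite functionalD in h2; rewrite x1 in h3; rewrite normrN y1 in h4.
  exists (center A th); split; first by exists A, th.
    by apply/face_center => //; split => //; lra.
  by apply/face_center => //; split; [rewrite normrN|lra].
- move=> x y z [A [th [mA s1 ->]]] /(face_center _ mA s1)[x1 fx] /(face_center _ mA s1)[y1 fy].
  apply/le_anti/andP; split.
    by apply: le_trans (ler_normB _ _) _; rewrite x1 -(normrN y) y1.
  have := functional_le (x - y) mA.1 s1; rewrite functionalD fx fy; lra.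
(* A centre on the face of another one is normed by the other's set, so the sets agree; all its
   coordinates there are nonzero, so the signs agree. *)
- move=> z w [A [th [mA s1 ->]]] [B [ta [mB t1 ->]]] /(face_center _ mB t1) fz.
  have AB : A = B.
    by apply: (center_norming mA s1 mB.1); rewrite (sum_face_sum mB.1 t1 fz).
  rewrite -{B mB}AB in fz *; apply: eq_big_seq => i iA.
  have := sum_face_abs mA.1 t1 fz iA; rewrite abs_center // coord_center iA.
  have n0 : #|` A|%:R != 0 :> R by rewrite gt_eqF // maximal_card_gt0.
  rewrite -[in LHS](mul1r (_^-1)) mulrA => /(mulIf (invr_neq0 n0)) h.
  congr (_ / _ *: _).
  by case: (s1 i) (t1 i) h => -> [] -> //; rewrite ?mulrNN ?mulr1 ?mul1r.
Qed.

Lemma maximal_pone_set : maximal_set [fset pone]%fset.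
Proof.
split; first exact: schreier_sing.
move=> k Fk; rewrite -(schreier_one F_schreier Fk) !inE eqxx ?orbT //.
Qed.

Lemma centers_pone : centers (e pone).
Proof.
exists [fset pone]%fset, (fun=> 1); split; [exact: maximal_pone_set|by left|].
by rewrite /center big_seq_fset1 cardfs1 divr1 scale1r.
Qed.

Lemma centers_cases z : centers z -> [\/ z = e pone, z = - e pone | c z pone = 0].
Proof.
move=> [A [th [mA s1 ->]]]; have [oA|oA] := boolP (pone \in A); last first.
  by apply: Or33; rewrite coord_center (negbTE oA).
rewrite (maximal_pone mA oA) /center big_seq_fset1 cardfs1 divr1.
by case: (s1 pone) => ->; [apply: Or31|apply: Or32]; rewrite ?scale1r ?scaleN1r.
Qed.

Lemma maximal_neq0 A : maximal_set A -> exists i, i \in A.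
Proof.
move=> mA; have := maximal_card_gt0 mA; rewrite ltr0n cardfs_gt0 => /fset0Pn[i iA].
by exists i.
Qed.

Lemma pair_le1 x i k : i != pone -> k != pone -> i != k -> `|c x i| + `|c x k| <= `|x|.
Proof.
move=> i1 k1 ik; have := sum_le_norm x (F_pair i1 k1).
by rewrite -psum_sum psumU1 ?inE // psum1 !powRr1.
Qed.

(** Replace an element a of A by some b beyond A, enlarge to a maximal B, and reverse the signs on
    A. A common point y vanishes on A except at a, so |y_a| = 1; the pairs with a then force y to
    vanish on B, where its functional should be 1. *)
Lemma centers_disjoint z : centers z -> c z pone = 0 -> exists w,
  [/\ centers w, w <> z, w <> - z & forall y, face z y -> ~ face w y].
Proof.
move=> [A [th [mA s1 ->]]] z0; have [FA _] := mA.
have A0 := maximal_card_gt0 mA.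
have oA : pone \notin A.
  apply/negP => oA; move: z0; rewrite coord_center oA => /eqP.
  by rewrite mulf_eq0 invr_eq0 (gt_eqF A0) orbF -normr_eq0 (sign_abs pone s1) oner_eq0.
have [a aA] := maximal_neq0 mA.
have [b bA] := fset_above A.
have bnA : b \notin A by apply/negP => /bA; rewrite ltnn.
have FB0 := spreading_shift (schreier_spread F_schreier) FA aA bnA (bA a aA).
have [B mB B0B] := maximal_above FB0; have [FB _] := mB.
have bB : b \in B by apply: (fsubsetP B0B); rewrite !inE eqxx.
have aB : a \notin B.
  apply/negP => aB; move: bnA; rewrite (maximal_eq mA FB) ?bB //.
  apply/fsubsetP => k kA; have [->//|ka] := eqVneq k a.
  by apply: (fsubsetP B0B); rewrite !inE ka kA orbT.
pose ta k := if k \in A then - th k else 1.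
have t1 : signs ta.
  by move=> k; rewrite /ta; case: ifP => _; [exact: (signsN s1)|left].
have cwb : c (center B ta) b != 0.
  rewrite coord_center bB mulf_neq0 ?invr_neq0 ?(gt_eqF (maximal_card_gt0 mB)) //.
  by rewrite -normr_eq0 (sign_abs b t1) oner_eq0.
have czb : c (center A th) b = 0 by rewrite coord_center (negbTE bnA).
exists (center B ta); split.
- by exists B, ta.
- by move=> h; rewrite h czb eqxx in cwb.
- by move=> h; rewrite h (coordN ce) czb oppr0 eqxx in cwb.
move=> y /(face_center _ mA s1) fz /(face_center _ mB t1) fw.
have y0 k : k \in A -> k != a -> c y k = 0.
  move=> kA ka; have kB : k \in B by apply: (fsubsetP B0B); rewrite !inE ka kA orbT.
  have := sum_face_abs FB t1 fw kB; rewrite (sum_face_abs FA s1 fz kA) /ta kA mulNr => h.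
  have : th k * c y k = 0 by lra.
  by move=> /eqP; rewrite mulf_eq0 -normr_eq0 (sign_abs k s1) oner_eq0 => /eqP.
have ya : `|c y a| = 1.
  rewrite -(sum_face_sum FA s1 fz) (big_fsetD1 a) //= big1_seq ?addr0 // => k.
  by rewrite !inE /= => /andP[ka kA]; rewrite y0 ?normr0.
have yB k : k \in B -> c y k = 0.
  move=> kB; have [kA|kA] := boolP (k \in A).
    by apply: y0 => //; apply: contraNneq aB => <-.
  have k1 : k != pone.
    apply/eqP => k1; rewrite k1 in kB; have := bB.
    rewrite (maximal_pone mB kB) inE => /eqP b1; have := bA a aA.
    by rewrite b1 /= ltnS leqn0 => /eqP a0; have := valP a; rewrite /= a0.
  have a1 : a != pone by apply: contraNneq oA => <-.
  have ak : a != k by apply: contraNneq kA => <-.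
  have := pair_le1 y a1 k1 ak; rewrite ya; case: fz => -> _ h.
  by apply/eqP; rewrite -normr_le0; lra.
case: fw => _; rewrite /functional big1_seq => [/eqP|k /= kB]; last by rewrite yB ?mulr0.
by rewrite eq_sym oner_eq0.
Qed.

Lemma coord_pone_map1 T T' : sphere_isometry T T' ->
  exists2 s : R, s = 1 \/ s = - 1 & forall x, `|x| = 1 -> c (T x) pone = s * c x pone.
Proof.
exact: (coord_pone_map le11 F_schreier ce centers_system centers_pone centers_cases centers_disjoint).
Qed.

(** * Characterisation of the signed basis vectors for p = 1 *)

Definition flip th i := fun k => if k == i then - th k else th k.

Lemma signs_flip th i : signs th -> signs (flip th i).
Proof. by move=> s1 k; rewrite /flip; case: ifP => _ //; exact: (signsN s1). Qed.

Lemma functional_flip A th i x : i \in A ->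
  functional A (flip th i) x = functional A th x - 2 * (th i * c x i).
Proof.
move=> iA; rewrite /functional (big_fsetD1 i) //= [in RHS](big_fsetD1 i) //= /flip eqxx.
rewrite (eq_big_seq (fun k => th k * c x k)) => [|k]; first by ring.
by rewrite !inE => /andP[/negbTE->].
Qed.

Lemma psum_reflect A i x : psum 1 A (c (reflect_coord c e i x)) = psum 1 A (c x).
Proof.
rewrite /reflect_coord (psum_change ce); case: ifP => // iA.
by rewrite normrN -psumD1.
Qed.

Lemma norm_reflect i x : `|x| = 1 -> `|reflect_coord c e i x| = 1.
Proof.
move=> x1; apply: (norm1_psum le11 ce) => [A FA|].
  by rewrite psum_reflect (psum_le1 ce).
have [A FA hA] := psum_attained1 ce x1; exists A => //.
by rewrite psum_reflect hA.
Qed.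

Lemma dist_reflect i x : `|x - reflect_coord c e i x| = 2 * `|c x i|.
Proof.
rewrite /reflect_coord opprD addrA subrr add0r normrN normrZ (norm_basis le11 F_schreier ce) mulr1.
by rewrite (_ : - c x i - c x i = - 2 * c x i) ?normrM ?normrN ?normr_nat //; ring.
Qed.

Lemma sum_face_reflect A th i y : i \in A -> sum_face A th y ->
  sum_face A (flip th i) (reflect_coord c e i y).
Proof.
move=> iA [y1 fy]; split; first exact: norm_reflect.
rewrite functional_flip // /reflect_coord functionalD functional_basis iA fy (coordD ce) (coordZ ce).
rewrite (coord_e_eq ce); ring.
Qed.

(** A set giving more than 1 must contain i. There the i-th term is 1 - |y_i|, because y_i has the
    sign t, and the other terms sum to at most 1 - |y_i|. *)
Lemma dist_basis_le A th i y (t : R) : F A -> signs th -> i \in A -> th i = t ->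
  sum_face A th y -> 1 < `|y - t *: e i| -> `|y - t *: e i| <= 2 - 2 * `|c y i|.
Proof.
move=> FA s1 iA tE fy; rewrite -scaleNr.
have [B FB <-] := sum_attained (y + - t *: e i).
have y1 : `|y| = 1 by case: fy.
have := sum_le_norm y FB; rewrite y1 => yB.
rewrite -psum_sum (psum_add ce); case: ifP => iB; last by rewrite psum_sum; lra.
move=> _; rewrite powRr1 // psum_sum.
rewrite (big_fsetD1 i) //= in yB.
have hi := sum_face_abs FA s1 fy iA; rewrite tE in hi.
suff -> : `|c y i + - t| = 1 - `|c y i| by lra.
have : `|c y i| <= 1 by rewrite -y1 (coord_le le11 F_schreier ce).
have t1 := s1 i; rewrite tE in t1; case: t1 hi => ->; rewrite ?mul1r ?mulN1r => hi h.
  by rewrite ler0_norm; [rewrite hi; ring|lra].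
by rewrite opprK ger0_norm; [rewrite hi; ring|lra].
Qed.

(** A metric substitute for reflecting a coordinate: for x = +- e_i, the reflection of y lies at
    distance 2 |y_i| from y, and [dist_basis_le] bounds |y - x| by 2 - 2 |y_i|. For general x it
    excludes nonzero coordinates below 1/2, see [repels_half]. *)
Definition repels z z' x := forall y, face z y -> 1 < `|y - x| ->
  exists2 y', face (- z') y' & `|y - y'| <= 2 - `|y - x|.

(** Uniqueness of the common point settles the case where the two sets share a coordinate at which x
    is nonzero; repulsion is there for the remaining case. *)
Definition pins z z' x := [/\ face z x, face z' x, c x pone = 0,
  forall y, face z y -> face z' y -> c y pone = 0 -> y = x & repels z z' x /\ repels z' z x].

Lemma repels_basis A th i (t : R) : maximal_set A -> signs th -> i \in A -> th i = t ->
  repels (center A th) (- center A (flip th i)) (t *: e i).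
Proof.
move=> mA s1 iA tE y /(face_center _ mA s1) fy h.
exists (reflect_coord c e i y).
  by rewrite opprK; apply/face_center => //; [exact: signs_flip|exact: sum_face_reflect].
by rewrite dist_reflect; have := dist_basis_le mA.1 s1 iA tE fy h; lra.
Qed.

Lemma pins_basis A th i (t : R) : maximal_set A -> signs th -> i \in A -> th i = t ->
  i != pone -> pins (center A th) (- center A (flip th i)) (t *: e i).
Proof.
move=> mA s1 iA tE i1; have [FA _] := mA; have f1 := signs_flip i s1.
have t1 := s1 i; rewrite tE in t1.
have tt : t * t = 1 by case: t1 => ->; rewrite ?mulrNN mulr1.
have tn : `|t| = 1 by case: t1 => ->; rewrite ?normrN normr1.
have xn : `|t *: e i| = 1 by rewrite normrZ tn mul1r (norm_basis le11 F_schreier ce).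
have fz' y : face (- center A (flip th i)) y <-> sum_face A (fun k => - flip th i k) y.
  by rewrite -centerN face_center //; exact: signsN.
split.
- by apply/face_center => //; split => //; rewrite functional_basis iA tE.
- by apply/fz'; split => //; rewrite functional_basis iA /flip eqxx /= opprK tE tt.
- by rewrite (coordZ ce) (coord_e_neq ce) ?mulr0 // eq_sym.
- move=> y /(face_center _ mA s1) fy /fz' fy' y0.
  have yA k : k \in A -> k != i -> c y k = 0.
    move=> kA ki; have := sum_face_abs FA (signsN f1) fy' kA.
    rewrite (sum_face_abs FA s1 fy kA) /flip (negbTE ki) => h.
    have : th k * c y k = 0 by lra.
    by move=> /eqP; rewrite mulf_eq0 -normr_eq0 (sign_abs k s1) oner_eq0 => /eqP.
  have yi : `|c y i| = 1.
    rewrite -(sum_face_sum FA s1 fy) (big_fsetD1 i) //= big1_seq ?addr0 // => k.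
    by rewrite !inE /= => /andP[ki kA]; rewrite yA ?normr0.
  apply: (coord_inj le11 ce) => k; rewrite (coordZ ce).
  have [->|ki] := eqVneq k i.
    have := sum_face_abs FA s1 fy iA; rewrite yi tE (coord_e_eq ce) mulr1 => h.
    by rewrite -[LHS]mul1r -tt -mulrA -h mulr1.
  rewrite (coord_e_neq ce ki) mulr0; have [->//|k1] := eqVneq k pone.
  have ik : i != k by rewrite eq_sym.
  have := pair_le1 y i1 k1 ik; rewrite yi; case: fy => -> _ h.
  by apply/eqP; rewrite -normr_le0; lra.
- split; first exact: repels_basis.
  have h : - center A (flip th i) = center A (fun k => - flip th i k) by rewrite centerN.
  have h' : center A th = - center A (flip (fun k => - flip th i k) i).
    rewrite -centerN; congr center; apply/funext => k.
    by rewrite /flip; case: (k == i); rewrite ?opprK.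
  rewrite h [in X in repels _ X _]h'; apply: repels_basis => //; first exact: signsN.
  by rewrite /flip eqxx /= opprK.
Qed.

(** If 0 < |x_a| < 1/2, the vector th_a e_a of the first face is at distance at least 2 - 2 |x_a| >
    1 from x. Repulsion provides a point at distance less than 1 from it where the functional of B
    is - 1; but at th_a e_a this functional is nonnegative. *)
Lemma repels_half A th B ta x a : maximal_set A -> signs th -> maximal_set B -> signs ta ->
  face (center A th) x -> face (center B ta) x -> repels (center A th) (center B ta) x ->
  a \in A -> c x a != 0 -> 2^-1 <= `|c x a|.
Proof.
move=> mA s1 mB t1 /(face_center _ mA s1) fx /(face_center _ mB t1) fx' rep aA xa.
rewrite leNgt; apply/negP => xa2.
pose y := th a *: e a.
have fy : face (center A th) y.
  apply/face_center => //; split; last by rewrite functional_basis aA (sign_sq a s1).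
  by rewrite normrZ (sign_abs a s1) mul1r (norm_basis le11 F_schreier ce).
have hA : \sum_(k <- A) `|c (y - x) k| = 2 - 2 * `|c x a|.
  rewrite (big_fsetD1 a) //= (eq_big_seq (fun k => `|c x k|)) => [|k]; last first.
    rewrite !inE => /andP[ka _]; rewrite (coordB ce) (coordZ ce) (coord_e_neq ce ka).
    by rewrite mulr0 sub0r normrN.
  have := sum_face_sum mA.1 s1 fx; rewrite (big_fsetD1 a) //= => h.
  have -> : c (y - x) a = th a * (1 - `|c x a|).
    rewrite (coordB ce) (coordZ ce) (coord_e_eq ce) (sum_face_abs mA.1 s1 fx aA).
    by rewrite mulrBr mulrA (sign_sq a s1) mul1r.
  rewrite normrM (sign_abs a s1) mul1r ger0_norm; lra.
have yx := sum_le_norm (y - x) mA.1; rewrite hA in yx.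
have [|y' fy' yy'] := rep y fy; first by lra.
have ffy' : functional B ta y' = - 1.
  have : sum_face B (fun k => - ta k) y'.
    by apply/face_center; rewrite ?centerN //; exact: signsN.
  by case=> _; rewrite functional_sign => h; rewrite -h opprK.
have := functional_le (y - y') mB.1 t1.
rewrite functionalD functionalN ffy' opprK functional_basis.
have : 0 <= (if a \in B then ta a * th a else 0).
  case: ifP => // aB.
  have := sum_face_abs mB.1 t1 fx' aB; rewrite (sum_face_abs mA.1 s1 fx aA) => /(mulIf xa) ->.
  by rewrite (sign_sq a t1).
move: (if a \in B then _ else _) => u h1 h2; lra.
Qed.

Lemma triple_sum x i j k : i != j -> i != k -> j != k ->
  (2 < val i)%N -> (2 < val j)%N -> (2 < val k)%N ->
  `|c x i| + `|c x j| + `|c x k| <= `|x|.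
Proof.
move=> ij ik jk i2 j2 k2.
have FA : F (i |` [fset j; k])%fset.
  have sorted (a b d : posN) : (2 < val a)%N -> (val a < val b)%N -> (val b < val d)%N ->
      (i |` [fset j; k])%fset = [fset a; b; d]%fset -> F (i |` [fset j; k])%fset.
    by move=> a2 ab bd ->; exact: F_triple.
  have neq (a b : posN) : a != b -> (val a < val b)%N \/ (val b < val a)%N.
    move=> ab; case: (ltngtP (val a) (val b)) => [||/val_inj h]; [by left|by right|].
    by rewrite h eqxx in ab.
  have perm (a b d : posN) : (forall l, (l == i) || (l == j) || (l == k) = (l == a) || (l == b) || (l == d)) ->
      (i |` [fset j; k])%fset = [fset a; b; d]%fset.
    by move=> h; apply/fsetP => l; rewrite !inE orbA h.
  case: (neq _ _ ij) => ij'; case: (neq _ _ ik) => ik'; case: (neq _ _ jk) => jk'.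
  - by apply: (sorted i j k) => //; apply: perm => l.
  - by apply: (sorted i k j) => //; apply: perm => l; rewrite orbAC.
  - by exfalso; lia.
  - by apply: (sorted k i j) => //; apply: perm => l; do 3 case: (l == _).
  - by apply: (sorted j i k) => //; apply: perm => l; do 3 case: (l == _).
  - by exfalso; lia.
  - by apply: (sorted j k i) => //; apply: perm => l; do 3 case: (l == _).
  - by apply: (sorted k j i) => //; apply: perm => l; do 3 case: (l == _).
have := sum_le_norm x FA.
by rewrite -psum_sum !psumU1 ?inE ?negb_or ?ij ?ik // psum1 !powRr1 // addrA.
Qed.

Lemma pins_only z z' x : centers z -> centers z' -> pins z z' x ->
  exists k (s : R), [/\ k != pone, s = 1 \/ s = - 1 & x = s *: e k].
Proof.
move=> [A [th [mA s1 ->]]] [B [ta [mB t1 ->]]] [fz fz' x0 uniq [rep rep']].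
have fx : sum_face A th x by apply/face_center.
have fx' : sum_face B ta x by apply/face_center.
have x1 : `|x| = 1 by case: fx.
have nz k : c x k != 0 -> k != pone by apply: contraNneq => ->; rewrite x0.
have unit k : k != pone -> `|c x k| = 1 -> exists k (s : R),
    [/\ k != pone, s = 1 \/ s = - 1 & x = s *: e k].
  move=> k1 xk; exists k, (c x k); split => //.
    by move/eqP: xk; rewrite eqr_norml ler01 andbT => /orP[]/eqP; [left|right].
  apply: (coord_inj le11 ce) => l; rewrite (coordZ ce); have [->|lk] := eqVneq l k.
    by rewrite (coord_e_eq ce) mulr1.
  rewrite (coord_e_neq ce lk) mulr0; have [->//|l1] := eqVneq l pone.
  have kl : k != l by rewrite eq_sym.
  by have := pair_le1 x k1 l1 kl; rewrite xk x1 => h; apply/eqP; rewrite -normr_le0; lra.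
(* At a shared nonzero coordinate both sign patterns agree, so the signed basis vector is a common
   point as well, and uniqueness identifies it with [x]. *)
have [[c0 [c0A c0B xc0]]|disj] := pselect (exists k, [/\ k \in A, k \in B & c x k != 0]).
  have h : th c0 = ta c0.
    have := sum_face_abs mB.1 t1 fx' c0B.
    by rewrite (sum_face_abs mA.1 s1 fx c0A) => /(mulIf xc0).
  exists c0, (th c0); split; [exact: nz|exact: s1|].
  have n1 : `|th c0 *: e c0| = 1.
    by rewrite normrZ (sign_abs c0 s1) mul1r (norm_basis le11 F_schreier ce).
  apply/esym/uniq.
  - by apply/face_center => //; split => //; rewrite functional_basis c0A (sign_sq c0 s1).
  - by apply/face_center => //; split => //; rewrite functional_basis c0B h (sign_sq c0 t1).
  - by rewrite (coordZ ce) (coord_e_neq ce) ?mulr0 // eq_sym; exact: nz.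
(* Moduli summing to 1, the nonzero ones being at least 1/2: a single unit coordinate, or at least
   two nonzero ones. *)
have two (D : {fset posN}) (d1 : \sum_(k <- D) `|c x k| = 1)
    (d2 : forall k, k \in D -> c x k != 0 -> 2^-1 <= `|c x k|) :
    (exists2 k, k != pone & `|c x k| = 1) \/
    exists a a', [/\ a != a', a \in D /\ a' \in D, c x a != 0 /\ c x a' != 0,
       2^-1 <= `|c x a| & 2^-1 <= `|c x a'|].
  have exnz (E : {fset posN}) : \sum_(k <- E) `|c x k| != 0 -> exists2 k, k \in E & c x k != 0.
    move=> h; apply: contrapT => h2; move/eqP: h; apply.
    rewrite big1_seq // => k /= kE; apply/eqP; rewrite normr_eq0.
    by apply: contraT => xk; case: h2; exists k.
  have [|a aD xa] := exnz D; first by rewrite d1 oner_eq0.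
  have [e0|] := eqVneq (\sum_(k <- (D `\ a)%fset) `|c x k|) 0.
    left; exists a; first exact: nz.
    by rewrite -d1 (big_fsetD1 a) //= e0 addr0.
  move=> /exnz[a']; rewrite !inE => /andP[a'a a'D] xa'.
  by right; exists a, a'; split => //; [rewrite eq_sym|exact: d2|exact: d2].
have [[k k1 xk]|[a [a' [aa' [aA a'A] [xa xa'] ha ha']]]] :=
    two A (sum_face_sum mA.1 s1 fx) (fun k => repels_half mA s1 mB t1 fz fz' rep (a := k)).
  exact: unit k1 xk.
have [[k k1 xk]|[b [b' [bb' [bB b'B] [xb xb'] hb hb']]]] :=
    two B (sum_face_sum mB.1 t1 fx') (fun k => repels_half mB t1 mA s1 fz' fz rep' (a := k)).
  exact: unit k1 xk.
(* Four distinct indices other than 1 carry at least 1/2 each. At most one of them is 2, so three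
   exceed 2 and form a set of [F] with sum at least 3/2. *)
exfalso.
have neq k l : k \in A -> l \in B -> c x k != 0 -> k != l.
  by move=> kA lB xk; apply/eqP => kl; apply: disj; exists k; rewrite {2}kl.
have small k : c x k != 0 -> (2 < val k)%N \/ val k = 2%N.
  move=> /nz k1; have [k1'|] := posN_one_or_gt k; first by rewrite k1' eqxx in k1.
  by rewrite leq_eqVlt => /orP[/eqP <-|]; [right|left].
have ab := neq a b aA bB xa; have ab' := neq a b' aA b'B xa.
have a'b := neq a' b a'A bB xa'; have a'b' := neq a' b' a'A b'B xa'.
have bad i j k : i != j -> i != k -> j != k -> 2^-1 <= `|c x i| -> 2^-1 <= `|c x j| ->
    2^-1 <= `|c x k| -> (2 < val i)%N -> (2 < val j)%N -> (2 < val k)%N -> False.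
  move=> ij ik jk hi hj hk i2 j2 k2.
  have := triple_sum x ij ik jk i2 j2 k2; rewrite x1; lra.
have val2 k l : k != l -> val k = 2%N -> c x l != 0 -> (2 < val l)%N.
  move=> kl k2 /small[//|l2]; move/eqP: kl; case; apply/val_inj; by rewrite k2 l2.
have [a2|a2] := small a xa; last first.
  by apply: (bad a' b b') => //; apply: (val2 a).
have [a2'|a2'] := small a' xa'; last first.
  by apply: (bad a b b') => //; apply: (val2 a') => //; rewrite eq_sym.
have [b2|b2] := small b xb; first by apply: (bad a a' b).
by apply: (bad a a' b') => //; apply: (val2 b).
Qed.

Lemma repels_map T T' z z' w w' x : sphere_isometry T T' -> `|x| = 1 ->
  (forall y, `|y| = 1 -> face z y <-> face w (T y)) ->
  (forall y, `|y| = 1 -> face (- z') y <-> face (- w') (T y)) ->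
  repels z z' x -> repels w w' (T x).
Proof.
move=> TT' x1 zw zw' rep y fy; have y1 : `|y| = 1 by case: fy.
have u1 := si_norm' TT' y1; rewrite -(si_K' TT' y1) (si_dist TT') // => h.
have fu : face z (T' y) by apply/zw => //; rewrite (si_K' TT').
have [u' fu' uu'] := rep _ fu h; have u'1 : `|u'| = 1 by case: fu'.
exists (T u'); first by apply/zw'.
by rewrite (si_dist TT').
Qed.

Lemma basis_mapping1 T T' : sphere_isometry T T' -> basis_mapping e T.
Proof.
move=> TT' i i1.
have [t t1 Tpone] := coord_pone_map1 TT'.
have [A mA iA] := maximal_above (schreier_sing F_schreier i).
have {}iA : i \in A by apply: (fsubsetP iA); rewrite inE.
pose th (k : posN) : R := 1; have s1 : signs th by left.
pose z := center A th; pose z' := - center A (flip th i).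
have Zz : centers z by exists A, th.
have Zz' : centers z'.
  exists A, (fun k => - flip th i k); split => //; last by rewrite centerN.
  by apply: signsN; exact: signs_flip.
have [fz fz' x0 uniq [rep rep']] := pins_basis mA s1 iA (erefl : th i = 1) i1.
rewrite scale1r -/z -/z' in fz fz' x0 uniq rep rep'.
have ei1 : `|e i| = 1 by exact: (norm_basis le11 F_schreier ce).
have [w [Zw zw zNw]] := face_map centers_system TT' Zz.
have [w' [Zw' zw' zNw']] := face_map centers_system TT' Zz'.
have Tpone0 y : `|y| = 1 -> c (T y) pone = 0 -> c y pone = 0.
  by move=> y1; rewrite Tpone //; case: t1 => ->; rewrite ?mul1r ?mulN1r => // /eqP;
    rewrite oppr_eq0 => /eqP.
have pw : pins w w' (T (e i)).
  split; [exact/zw|exact/zw'|by rewrite Tpone // x0 mulr0| |].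
    move=> y fy fy' y0; have y1 : `|y| = 1 by case: fy.
    have u1 := si_norm' TT' y1.
    rewrite -(si_K' TT' y1); congr T; apply: uniq.
    - by apply/zw => //; rewrite (si_K' TT').
    - by apply/zw' => //; rewrite (si_K' TT').
    - by apply: Tpone0 => //; rewrite (si_K' TT').
  by split; [exact: repels_map TT' ei1 zw zNw' rep|exact: repels_map TT' ei1 zw' zNw rep'].
have [k [s [k1 ss Tk]]] := pins_only Zw Zw' pw.
exists k, s; split => //; rewrite -Tk.
case: pw => _ _ _ uniqw _.
have Nei1 : `|- e i| = 1 by rewrite normrN.
(* By the correspondence of opposite faces, - T (- e_i) is a common point too; uniqueness makes T
   odd at e_i. *)
rewrite -[LHS]opprK; congr (- _); apply: uniqw.
- by apply/face_opp/zNw => //; apply/face_opp; rewrite opprK.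
- by apply/face_opp/zNw' => //; apply/face_opp; rewrite opprK.
- by rewrite (coordN ce) Tpone // (coordN ce) x0 oppr0 mulr0 oppr0.
Qed.

(** * Coordinates on a norming set for p = 1 *)

Section Action.
Context (T T' : X -> X) (TT' : sphere_isometry T T').
Context (g : posN -> posN) (s : posN -> R) (Tgs : basis_action c e T g s).

(** A signed basis vector t e_k lies on the face of A exactly when k is in A and th_k = t; this
    test, applied in both directions, reads off the set and the signs of the image. *)
Lemma center_image A th w : maximal_set A -> signs th -> pone \notin A -> centers w ->
  (forall y, `|y| = 1 -> face (center A th) y <-> face w (T y)) ->
  exists B ta, [/\ maximal_set B, signs ta, w = center B ta,
    forall k, (g k \in B) = (k \in A) & forall k, k \in A -> ta (g k) = th k * s k].
Proof.
move=> mA s1 oA [B [ta [mB t1 ->]]] zw.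
have ne k (t : R) : t = 1 \/ t = - 1 -> `|t *: e k| = 1.
  by move=> ht; rewrite normrZ (norm_basis le11 F_schreier ce) mulr1; case: ht => ->;
    rewrite ?normrN normr1.
have Te k (t : R) : k != pone -> t = 1 \/ t = - 1 -> T (t *: e k) = (t * s k) *: e (g k).
  move=> k1; case=> ->; rewrite ?scaleN1r ?scale1r ?mulN1r ?mul1r.
    exact: (ba_basis Tgs k1).
  by rewrite (ba_basisN Tgs k1) scaleNr.
have sth k (t : R) : t = 1 \/ t = - 1 -> t * s k = 1 \/ t * s k = - 1.
  by case=> ->; case: (ba_sign Tgs k) => ->; rewrite ?mulN1r ?mul1r ?opprK; [left|right|right|left].
have fwd k : k \in A -> g k \in B /\ ta (g k) = th k * s k.
  move=> kA; have k1 : k != pone by apply: contraNneq oA => <-.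
  have /(zw _ (ne k _ (s1 k))) : face (center A th) (th k *: e k).
    apply/face_center => //; split; first exact: ne.
    by rewrite functional_basis kA (sign_sq k s1).
  rewrite Te // => /(face_center _ mB t1)[_]; rewrite functional_basis.
  case: ifP => [gkB h|_ /eqP]; last by rewrite eq_sym oner_eq0.
  split => //; case: (t1 (g k)) h => ->; rewrite ?mulN1r ?mul1r => h //.
  by rewrite -h opprK.
have bwd k : g k \in B -> k \in A.
  move=> gkB; have [kk|k1] := eqVneq k pone.
    have [i iA] := maximal_neq0 mA; have [giB _] := fwd i iA.
    move: gkB; rewrite kk (ba_pone Tgs) => oB.
    move: giB; rewrite (maximal_pone mB oB) inE -{1}(ba_pone Tgs) => /eqP/(ba_inj Tgs) <- //.
  have ht := sth k _ (t1 (g k)).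
  have : face (center A th) ((ta (g k) * s k) *: e k).
    apply/zw; first exact: ne.
    rewrite Te //; apply/face_center => //.
    have -> : ta (g k) * s k * s k = ta (g k).
      by case: (ba_sign Tgs k) => ->; rewrite -mulrA ?mulrNN !mulr1.
    by split; [exact: ne|rewrite functional_basis gkB (sign_sq _ t1)].
  move=> /(face_center _ mA s1)[_]; rewrite functional_basis.
  by case: ifP => // _ /eqP; rewrite eq_sym oner_eq0.
exists B, ta; split => // [k|k /fwd[]//].
by apply/idP/idP => [/bwd|/fwd[]].
Qed.

Lemma normed_coord1 x A i : `|x| = 1 -> F A -> psum 1 A (c x) = 1 -> i \in A ->
  c (T x) (g i) = s i * c x i.
Proof.
move=> x1 FA; rewrite psum_sum => xA iA.
have [->|i1] := eqVneq i pone; first by rewrite (ba_pone Tgs) (ba_coord Tgs).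
apply: (signed_of_norm le11 F_schreier ce TT' Tgs) => //.
have [B mB AB] := maximal_above FA.
have {FA AB iA xA A} [iA xA] : i \in B /\ \sum_(k <- B) `|c x k| = 1.
  split; first exact: (fsubsetP AB).
  apply/le_anti/andP; split; first by have := sum_le_norm x mB.1; rewrite x1.
  by rewrite -[leLHS]xA -!psum_sum; exact: psum_sub.
move: B mB iA xA => A mA iA xA; have [FA _] := mA.
have oA : pone \notin A.
  by apply/negP => oA; move: iA i1; rewrite (maximal_pone mA oA) inE => ->.
pose th k := sign_of (c x k); have s1 : signs th by exact: sign_ofP.
have fx : sum_face A th x.
  by split => //; rewrite -xA; apply: eq_bigr => k _; rewrite sign_of_mul.
have Zz : centers (center A th) by exists A, th.
have [w [Zw zw _]] := face_map centers_system TT' Zz.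
have [B [ta [mB t1 we gB taE]]] := center_image mA s1 oA Zw zw.
have Tx1 := si_norm TT' x1.
have fTx : sum_face B ta (T x).
  by apply/face_center => //; rewrite -we; apply/zw => //; apply/face_center.
have imB : B = [fset g k | k in A]%fset.
  apply/fsetP => k; have [l <-] := ba_surj Tgs k; rewrite gB.
  apply/idP/imfsetP => [lA|[l' /= l'A /(ba_inj Tgs)->//]]; by exists l.
(* Reflect x in k: the image lies on the flipped face, where the functional is 1, whereas at T x the
   flipped functional is 1 - 2 |(T x)_(g k)|. The two points are at distance 2 |x_k|. *)
have le k : k \in A -> `|c (T x) (g k)| <= `|c x k|.
  move=> kA; have f1 := signs_flip k s1.
  have Zk : centers (center A (flip th k)) by exists A, (flip th k).
  have [w' [Zw' zw' _]] := face_map centers_system TT' Zk.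
  have [B' [ta' [mB' t1' we' gB' taE']]] := center_image mA f1 oA Zw' zw'.
  have BB' : B' = B.
    by apply/fsetP => l; have [l' <-] := ba_surj Tgs l; rewrite gB gB'.
  rewrite BB' in we' gB' mB'.
  have y1 := norm_reflect k x1.
  have fTy : sum_face B ta' (T (reflect_coord c e k x)).
    apply/face_center => //; rewrite -we'; apply/zw' => //; apply/face_center => //.
    exact: sum_face_reflect.
  have tE : functional B ta' (T x) = functional B (flip ta (g k)) (T x).
    apply: eq_big_seq => l; have [l' <-] := ba_surj Tgs l; rewrite gB => l'A.
    congr (_ * _); rewrite taE' // /flip (inj_eq (ba_inj Tgs)) taE //.
    by case: ifP => _; rewrite ?mulNr.
  have gkB : g k \in B by rewrite gB.
  have := functional_le (T (reflect_coord c e k x) - T x) mB.1 t1'.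
  rewrite functionalD functionalN tE functional_flip // (si_dist TT') // (distrC _ x) dist_reflect.
  case: fTy => _ ->; case: (fTx) => _ ->.
  rewrite -(sum_face_abs mB.1 t1 fTx gkB); lra.
(* Both families of moduli have sum 1, so the termwise inequalities are equalities. *)
apply: (ler_sum_eq le) => //.
rewrite xA -(sum_face_sum mB.1 t1 fTx) imB big_imfset //= => k l _ _; exact: (ba_inj Tgs).
Qed.

End Action.

Lemma extension1 T T' : sphere_isometry T T' -> exists U : {linear X -> X},
  [/\ isometry_on [set: X] U, set_surj [set: X] [set: X] U
    & forall x, unit_sphere X x -> U x = T x].
Proof.
move=> TT'; have TT'' := sphere_isometry_sym TT'.
have [g [s Tgs]] := exists_basis_action le11 F_schreier ce TT'
  (basis_mapping1 TT') (basis_mapping1 TT'') (coord_pone_map1 TT').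
apply: (linear_extension le11 F_schreier ce TT' (ba_sign Tgs) (ba_surj Tgs)).
exact: normed_coord1 TT' _ _ Tgs.
Qed.

End ExponentOne.

(** * Exponents greater than 1 *)

Lemma fset_pos_min (R : realType) (A : {fset posN}) (f : posN -> R) :
  (forall i, i \in A -> 0 < f i) ->
  exists2 m : R, 0 < m <= 1 & forall i, i \in A -> m <= f i.
Proof.
move=> f0; suff h (s : seq posN) : (forall i, i \in s -> 0 < f i) ->
    exists2 m : R, 0 < m <= 1 & forall i, i \in s -> m <= f i by exact: h.
elim: s => [|a s IH] fs; first by exists 1 => //; rewrite ltr01 lexx.
have [i si|m /andP[m0 m1] hm] := IH; first by apply: fs; rewrite inE si orbT.
have fa : 0 < f a by apply: fs; rewrite inE eqxx.
exists (Num.min m (f a)); first by rewrite lt_min m0 fa ge_min m1.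
move=> i; rewrite inE => /orP[/eqP->|/hm h]; first by rewrite ge_min lexx orbT.
by rewrite ge_min h.
Qed.

Section ExponentGtOne.
Context (R : realType) (p : R) (F : set {fset posN}).
Context (X : normedModType R) (c : X -> posN -> R) (e : posN -> X).
Context (p_gt1 : 1 < p).
Context (F_schreier : schreier_family F).
Context (F_pair : forall i k : posN, i != pone -> k != pone -> F [fset i; k]%fset).
Context (ce : coordinates p F c e).
Implicit Types (x y z w : X) (A B : {fset posN}) (i k : posN).

Let p1 : 1 <= p. Proof. exact: ltW. Qed.
Let p0 : 0 < p. Proof. exact: lt_trans ltr01 p_gt1. Qed.
Let pn0 : p != 0. Proof. by rewrite gt_eqF. Qed.

Definition norming_support A z :=
  [/\ F A, psum p A (c z) = 1 & forall i, (i \in A) = (c z i != 0)].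

Definition unit_blocks : set X := [set z | exists A, norming_support A z].

Lemma support_out A z : norming_support A z -> forall i, i \notin A -> c z i = 0.
Proof. by move=> [_ _ hA] i; rewrite hA negbK => /eqP. Qed.

Lemma block_norm A z : norming_support A z -> `|z| = 1.
Proof.
move=> hz; have [FA sA _] := hz; apply: (norm1_psum p1 ce) => [B FB|].
  by rewrite -sA; apply: (psum_support p1); exact: support_out hz.
by exists A; rewrite ?sA.
Qed.

Lemma psumZ A (a : R) x : psum p A (c (a *: x)) = `|a| `^ p * psum p A (c x).
Proof.
rewrite /psum mulr_sumr; apply: eq_bigr => i _.
by rewrite (coordZ ce) normrM powRM.
Qed.

(** The termwise bound |a + b|^p <= 2^(p-1) (|a|^p + |b|^p) sums to at most 2^p, and is strict
    wherever the coordinates differ. *)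
Lemma psum_add_eq A x y : F A -> `|x| = 1 -> `|y| = 1 -> 2 `^ p <= psum p A (c (x + y)) ->
  psum p A (c x) = 1 /\ forall i, i \in A -> c x i = c y i.
Proof.
move=> FA x1 y1 h.
have c0 : 0 < 2 `^ p / 2 :> R by rewrite divr_gt0 // powR_gt0.
have hx := psum_le1 ce FA x1; have hy := psum_le1 ce FA y1.
have sumE : \sum_(i <- A) (2 `^ p / 2 * (`|c x i| `^ p + `|c y i| `^ p)) =
    2 `^ p / 2 * (psum p A (c x) + psum p A (c y)).
  by rewrite -mulr_sumr big_split.
have le i : i \in A -> `|c (x + y) i| `^ p <= 2 `^ p / 2 * (`|c x i| `^ p + `|c y i| `^ p).
  move=> _; rewrite (coordD ce); have [->|ne] := eqVneq (c x i) (c y i).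
    rewrite (_ : c y i + c y i = 2 * c y i); last by ring.
    by rewrite normrM powRM // normr_nat le_eqVlt; apply/orP; left; apply/eqP; field.
  exact/ltW/powR_add_lt.
have sumle : 2 `^ p / 2 * (psum p A (c x) + psum p A (c y)) <= 2 `^ p.
  rewrite -[leRHS](@divfK _ 2) // ler_pM2l //; lra.
have eqs := ler_sum_eq le; rewrite sumE in eqs.
have {}eqs := eqs (le_trans sumle h).
have sumge : 2 `^ p <= 2 `^ p / 2 * (psum p A (c x) + psum p A (c y)).
  by apply: le_trans h _; rewrite -sumE /psum big_seq [leRHS]big_seq; apply: ler_sum.
split.
  move: sumge; rewrite -[leLHS](@divfK _ 2) // ler_pM2l //; lra.
move=> i iA; apply/eqP; apply: contraT => ne.
by have := powR_add_lt p_gt1 ne; rewrite -(coordD ce) (eqs i iA) ltxx.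
Qed.

Lemma attained2 x : `|x| = 2 -> exists2 A, F A & 2 `^ p <= psum p A (c x).
Proof. by move=> x2; have [A FA h] := psum_attained ce x; exists A => //; rewrite h x2. Qed.

Lemma block_sub A B z : norming_support A z -> F B -> 1 <= psum p B (c z) -> (A `<=` B)%fset.
Proof.
move=> hz FB h; apply/fsubsetP => i iA; apply: contraT => iB.
have := psum_miss p1 (support_out hz) iA iB; case: hz => _ -> hA.
have : 0 < `|c z i| `^ p by rewrite powR_gt0 // normr_gt0 -hA.
lra.
Qed.

(** A set attaining |y + z| = 2 carries equal coordinates of y and z and norms z, hence contains its
    support. *)
Lemma face_block A z y : norming_support A z ->
  face z y <-> `|y| = 1 /\ forall i, i \in A -> c y i = c z i.
Proof.
move=> hz; have z1 := block_norm hz; have [FA sA _] := hz.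
split=> [[y1 yz]|[y1 yz]]; split => //.
  have [B FB hB] := attained2 yz; have [sB eqB] := psum_add_eq FB y1 z1 hB.
  have AB : (A `<=` B)%fset.
    by apply: (block_sub hz FB); rewrite -sB -(eq_psum p (f := c y)) // => i /eqB->.
  by move=> i iA; apply: eqB; exact: (fsubsetP AB).
apply/le_anti/andP; split.
  by apply: le_trans (ler_normD _ _) _; rewrite y1 z1.
rewrite -(ler_powRp p1) //; apply: le_trans (psum_le ce _ FA).
rewrite (@eq_psum _ _ A _ (c (2 *: z))) => [|i iA]; first by rewrite psumZ sA mulr1 normr_nat.
by rewrite (coordD ce) (coordZ ce) yz // mulr_natl mulr2n.
Qed.

Lemma blockN A z : norming_support A z -> norming_support A (- z).
Proof.
move=> [FA sA hA]; split => //; last by move=> i; rewrite (coordN ce) oppr_eq0.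
by rewrite -[RHS]sA; apply: eq_psum => i _; rewrite (coordN ce) normrN.
Qed.

Lemma restrict_block A x : F A -> psum p A (c x) = 1 -> exists B z,
  [/\ norming_support B z, (B `<=` A)%fset,
      forall i, i \in A -> c z i = c x i & forall i, i \in B -> c x i != 0].
Proof.
move=> FA sA; pose B := [fset i in A | c x i != 0]%fset.
have BA : (B `<=` A)%fset by exact: fset_sub.
have zE i : c (\sum_(i <- B) c x i *: e i) i = if i \in B then c x i else 0.
  exact: (coord_vec ce).
exists B, (\sum_(i <- B) c x i *: e i); split => //.
- split; first exact: (schreier_sub F_schreier FA).
    rewrite -sA (eq_psum p (g := c x)) => [|i iB]; last by rewrite zE iB.
    apply: psum_sub_eq => // i iA; rewrite !inE /= iA /= negbK => /eqP//.
  move=> i; rewrite zE; case: ifP => [|_]; last by rewrite eqxx.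
  by rewrite !inE => /andP[_ ->].
- move=> i iA; rewrite zE; case: ifP => //; rewrite !inE /= iA /= => /negbT.
  by rewrite negbK => /eqP.
- by move=> i; rewrite !inE => /andP[].
Qed.

Lemma blocks_system : face_system unit_blocks.
Proof.
split.
- by move=> z [A /block_norm].
- by move=> z [A /blockN]; exists A.
(* The centre is the restriction of x to a set attaining |x - y| = 2, where x and - y agree. *)
- move=> x y x1 y1 xy; have [A FA hA] := attained2 xy.
  have Ny1 : `|- y| = 1 by rewrite normrN.
  have [sA eqA] := psum_add_eq FA x1 Ny1 hA.
  have [B [z [hz BA zx _]]] := restrict_block FA sA.
  exists z; split; first by exists B.
    by apply/(face_block _ hz); split => // i iB; rewrite zx // (fsubsetP BA).
  apply/(face_block _ hz); split => // i iB.
  by rewrite zx ?(fsubsetP BA) // eqA // (fsubsetP BA).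
- move=> x y z [A hz] /(face_block _ hz)[x1 xz] /(face_block _ hz)[y1 yz].
  have [FA sA _] := hz; apply/le_anti/andP; split.
    by apply: le_trans (ler_normB _ _) _; rewrite x1 -(normrN y) y1.
  rewrite -(ler_powRp p1) //; apply: le_trans (psum_le ce _ FA).
  rewrite (@eq_psum _ _ A _ (c (2 *: z))) => [|i iA]; first by rewrite psumZ sA mulr1 normr_nat.
  by rewrite (coordD ce) (coordZ ce) xz // yz // mulr_natl mulr2n.
- move=> z w [A hz] [B hw] /(face_block _ hw)[_ zw].
  have [FB sB hB] := hw.
  have AB : (A `<=` B)%fset.
    by apply: (block_sub hz FB); rewrite -sB (@eq_psum _ p B (c z) (c w)) // => i /zw->.
  apply: (coord_inj p1 ce) => i; have [/zw//|iB] := boolP (i \in B).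
  rewrite (support_out hw iB) (support_out hz) //.
  by apply: contra iB; exact: (fsubsetP AB).
Qed.

Lemma basis_block i : norming_support [fset i]%fset (e i).
Proof.
split; first exact: schreier_sing.
  by rewrite psum1 (coord_e_eq ce) normr1 powR1.
move=> k; rewrite inE; have [->|ki] := eqVneq k i.
  by rewrite (coord_e_eq ce) oner_eq0.
by rewrite (coord_e_neq ce ki) eqxx.
Qed.

Lemma blocks_basis i : unit_blocks (e i).
Proof. by exists [fset i]%fset; exact: basis_block. Qed.

Lemma single_block A z i : norming_support A z -> A = [fset i]%fset -> z = e i \/ z = - e i.
Proof.
move=> hz Ai; have [_ sA _] := hz; rewrite Ai psum1 in sA.
have zi : `|c z i| = 1.
  by apply: (powRp_inj p1) => //; rewrite sA powR1.
have zk k : k != i -> c z k = 0.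
  by move=> ki; apply: (support_out hz); rewrite Ai inE.
move/eqP: zi; rewrite eqr_norml ler01 andbT => /orP[]/eqP zi; [left|right];
  apply: (coord_inj p1 ce) => k; rewrite ?(coordN ce).
  by have [->|ki] := eqVneq k i; [rewrite (coord_e_eq ce)|rewrite (coord_e_neq ce ki) zk].
have [->|ki] := eqVneq k i; first by rewrite (coord_e_eq ce).
by rewrite (coord_e_neq ce ki) zk ?oppr0.
Qed.

Lemma block_neq0 A z : norming_support A z -> exists i, i \in A.
Proof.
move=> [_ sA _]; apply/fset0Pn; apply: contraT; rewrite negbK => /eqP A0.
by move: sA; rewrite A0 psum0 => /eqP; rewrite eq_sym oner_eq0.
Qed.

Lemma blocks_cases z : unit_blocks z -> [\/ z = e pone, z = - e pone | c z pone = 0].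
Proof.
move=> [A hz]; have [oA|oA] := boolP (pone \in A); last first.
  by apply: Or33; exact: support_out hz _ oA.
have [FA _ _] := hz.
by case: (single_block hz (schreier_one F_schreier FA oA)); [exact: Or31|exact: Or32].
Qed.

Lemma pair_psum_le1 x i k : i != pone -> k != pone -> i != k -> `|x| = 1 ->
  `|c x i| `^ p + `|c x k| `^ p <= 1.
Proof.
move=> i1 k1 ik x1; have := psum_le1 ce (F_pair i1 k1) x1.
by rewrite psumU1 ?inE // psum1.
Qed.

Lemma reflect_block A z i : norming_support A z -> norming_support A (reflect_coord c e i z).
Proof.
move=> [FA sA hA]; split => //.
  by rewrite -[RHS]sA; apply: eq_psum => k _; rewrite (coord_reflect ce); case: eqVneq => [->|_]; rewrite ?normrN.
by move=> k; rewrite hA (coord_reflect ce); case: (eqVneq k i) => [->|_]; rewrite ?oppr_eq0.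
Qed.

(** The companion is a reflection of z in one coordinate if the support has two elements, and
    otherwise e_b with b beyond the support: the pair {a, b} cannot carry both z_a <> 0 and a
    coordinate 1. *)
Lemma blocks_disjoint z : unit_blocks z -> c z pone = 0 -> exists w,
  [/\ unit_blocks w, w <> z, w <> - z & forall y, face z y -> ~ face w y].
Proof.
move=> [A hz] z0; have [FA sA hA] := hz; have [a aA] := block_neq0 hz.
have nz k : k \in A -> k != pone by apply: contraTneq => ->; rewrite hA z0 eqxx.
have za : c z a != 0 by rewrite -hA.
have [[a' [a'A a'a]]|hno] := pselect (exists a', a' \in A /\ a' != a).
  exists (reflect_coord c e a z); split.
  - by exists A; exact: reflect_block.
  - move=> h; have := congr1 (fun x => c x a) h; rewrite /= (coord_reflect ce) eqxx => h'.
    by move/eqP: za; apply; lra.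
  - move=> h; have := congr1 (fun x => c x a') h.
    rewrite /= (coord_reflect ce) (negbTE a'a) (coordN ce) => h'.
    by have : c z a' != 0; [rewrite -hA|move/eqP; apply; lra].
  - move=> y /(face_block _ hz)[_ yz] /(face_block _ (reflect_block a hz))[_ yw].
    have := yw a aA; rewrite (yz a aA) (coord_reflect ce) eqxx => h.
    by move/eqP: za; apply; lra.
have [b bA] := fset_above A.
have bnA : b \notin A by apply/negP => /bA; rewrite ltnn.
have zb : c z b = 0 by exact: support_out hz _ bnA.
exists (e b); split; first exact: blocks_basis.
- by move=> h; have := congr1 (fun x => c x b) h; rewrite /= (coord_e_eq ce) zb => /eqP;
    rewrite oner_eq0.
- by move=> h; have := congr1 (fun x => c x b) h; rewrite /= (coordN ce) (coord_e_eq ce) zb => /eqP;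
    rewrite oppr0 oner_eq0.
move=> y /(face_block _ hz)[y1 yz] /(face_block _ (basis_block b))[_ yb].
have b1 : b != pone.
  apply/eqP => b1; have := bA a aA; rewrite b1 /= ltnS leqn0 => /eqP a0.
  by have := valP a; rewrite /= a0.
have ab : a != b by apply: contraNneq bnA => <-.
have := pair_psum_le1 (nz a aA) b1 ab y1.
rewrite yz // (yb b) ?inE // (coord_e_eq ce) normr1 powR1.
have : 0 < `|c z a| `^ p by rewrite powR_gt0 // normr_gt0.
lra.
Qed.

Lemma coord_pone_map2 T T' : sphere_isometry T T' ->
  exists2 s : R, s = 1 \/ s = - 1 & forall x, `|x| = 1 -> c (T x) pone = s * c x pone.
Proof.
exact: (coord_pone_map p1 F_schreier ce blocks_system (blocks_basis pone) blocks_cases blocks_disjoint).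
Qed.

(** A set of [F] that contains k must miss some i of the support, and thereby loses at least what it
    gains at k. *)
Lemma push_norm A z k (a : R) : norming_support A z -> k \notin A -> ~ F (k |` A)%fset ->
  (forall i, i \in A -> `|a| <= `|c z i|) -> `|z + a *: e k| = 1.
Proof.
move=> hz kA nF az; have [FA sA hA] := hz; have z1 := block_norm hz.
have zk := support_out hz kA.
apply: (norm1_psum p1 ce) => [B FB|]; last first.
  by exists A => //; rewrite (psum_add ce) (negbTE kA) sA.
rewrite (psum_add ce); case: ifP => kB; last exact: (psum_le1 ce FB z1).
rewrite zk add0r.
have [i iA iB] : exists2 i, i \in A & i \notin B.
  apply: contrapT => h; apply: nF; apply: (schreier_sub F_schreier FB).
  apply/fsubsetP => l; rewrite !inE => /orP[/eqP->//|lA].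
  by apply: contraT => lB; case: h; exists l.
have := psum_miss p1 (support_out hz) iA iB; rewrite sA.
have : psum p (B `\ k)%fset (c z) <= psum p B (c z) by apply: psum_sub; exact: fsubD1set.
have : `|a| `^ p <= `|c z i| `^ p by rewrite (ler_powRp p1) // az.
lra.
Qed.

Lemma face_push A z k (a : R) : norming_support A z -> k \notin A -> ~ F (k |` A)%fset ->
  (forall i, i \in A -> `|a| <= `|c z i|) -> face z (z + a *: e k).
Proof.
move=> hz kA nF az; apply/(face_block _ hz); split; first exact: push_norm hz kA nF az.
move=> i iA; rewrite (coordD ce) (coordZ ce) (coord_e_neq ce) ?mulr0 ?addr0 //.
by apply: contraNneq kA => <-.
Qed.

Lemma block_pos_min A z : norming_support A z ->
  exists2 m : R, 0 < m <= 1 & forall i, i \in A -> m <= `|c z i|.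
Proof. by move=> [_ _ hA]; apply: fset_pos_min => i; rewrite hA normr_gt0. Qed.

Definition rigid z := [/\ unit_blocks z, c z pone = 0 &
  forall y, face z y -> c y pone = 0 -> y = z].

(** If adding k to the support leaves [F], a small multiple of e_k can be added without leaving the
    face; if not, the support already exhausts the norm on the enlarged set and y_k = 0. *)
Lemma rigidP A z : norming_support A z -> c z pone = 0 ->
  rigid z <-> forall k, k != pone -> F (k |` A)%fset.
Proof.
move=> hz z0; have [FA sA hA] := hz; split=> [[_ _ uniq] k k1|hF].
  apply: contrapT => nF.
  have kA : k \notin A.
    apply/negP => kA; apply: nF; suff -> : (k |` A)%fset = A by [].
    by apply/fsetP => l; rewrite !inE; case: eqP => // ->.
  have [m /andP[m0 _] mz] := block_pos_min hz.
  have : z + m *: e k = z.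
    apply: uniq; last by rewrite (coordD ce) (coordZ ce) z0 (coord_e_neq ce) ?mulr0 ?addr0 // eq_sym.
    by apply: face_push hz kA nF _ => i iA; rewrite gtr0_norm ?mz.
  move=> /(congr1 (fun x => c x k)); rewrite /= (coordD ce) (coordZ ce) (coord_e_eq ce); lra.
split; [by exists A|by []|] => y /(face_block _ hz)[y1 yz] y0.
apply: (coord_inj p1 ce) => k; have [/yz//|kA] := boolP (k \in A).
rewrite (support_out hz kA); have [->//|k1] := eqVneq k pone.
have := psum_le1 ce (hF k k1) y1; rewrite psumU1 // (@eq_psum _ _ A _ (c z)) => [|i /yz->//].
rewrite sA => h; have : `|c y k| `^ p <= 0 by lra.
rewrite le_eqVlt ltNge powR_ge0 orbF powR_eq0 normr_eq0 => /andP[/eqP->//].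
Qed.

(** Modulo e_1 the image face is a single point. T z, the centre of that face and - T (- z) all
    belong to it with first coordinate 0, so they coincide. *)
Lemma rigid_map T T' z : sphere_isometry T T' -> rigid z ->
  rigid (T z) /\ T (- z) = - T z.
Proof.
move=> TT' [Zz z0 uniq].
have [t t1 Tpone] := coord_pone_map2 TT'.
have z1 := fs_norm blocks_system Zz; have Nz1 : `|- z| = 1 by rewrite normrN.
have Tpone0 y : `|y| = 1 -> (c (T y) pone == 0) = (c y pone == 0).
  by move=> y1; rewrite Tpone //; case: t1 => ->; rewrite ?mul1r ?mulN1r ?oppr_eq0.
have [w [Zw zw zNw]] := face_map blocks_system TT' Zz.
have fTz : face w (T z) by apply/zw => //; exact: face_self.
have w1 := fs_norm blocks_system Zw.
have w0 : c w pone = 0.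
  have Tz0 : c (T z) pone = 0 by apply/eqP; rewrite Tpone0 // z0.
  have bad (a : R) : a = 1 -> a = 0 -> False by move=> ->; move/eqP; rewrite oner_eq0.
  case: (blocks_cases Zw) => // we; exfalso; rewrite we in fTz.
    by have /(face_pone p1 F_schreier ce)[_ /bad] := fTz; exact.
  have /face_opp/(face_pone p1 F_schreier ce)[_] := fTz.
  by rewrite (coordN ce) Tz0 oppr0 => /esym/eqP; rewrite oner_eq0.
have uniqw y : face w y -> c y pone = 0 -> y = T z.
  move=> fy y0; have y1 : `|y| = 1 by case: fy.
  have u1 := si_norm' TT' y1; rewrite -(si_K' TT' y1); congr T; apply: uniq.
    by apply/zw => //; rewrite (si_K' TT').
  by apply/eqP; rewrite -Tpone0 // (si_K' TT') // y0.
have wTz : w = T z by apply: uniqw => //; exact: face_self.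
rewrite -wTz; split; first by split => // y fy y0; rewrite wTz; exact: uniqw.
apply/eqP; rewrite -eqr_oppLR; apply/eqP; rewrite wTz; apply: uniqw.
  by apply/face_opp/zNw => //; exact: face_self.
by apply/eqP; rewrite (coordN ce) oppr_eq0 Tpone0 // (coordN ce) z0 oppr0.
Qed.

Lemma rigid_basis i : i != pone -> rigid (e i).
Proof.
move=> i1; have oi : pone != i by rewrite eq_sym.
apply/(rigidP (basis_block i)); first by rewrite (coord_e_neq ce oi).
by move=> k k1; exact: F_pair.
Qed.

Lemma rigid_support z : rigid z -> exists A, [/\ norming_support A z, pone \notin A &
  forall k, k != pone -> F (k |` A)%fset].
Proof.
move=> rz; have [[A hz] z0 _] := rz; exists A; split => //.
  by case: hz => _ _ ->; rewrite z0 eqxx.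
exact/(rigidP hz z0).
Qed.

Lemma rigid_single x : rigid x ->
  (forall A a a', norming_support A x -> a \in A -> a' \in A -> a' != a -> False) ->
  exists k (s : R), [/\ k != pone, s = 1 \/ s = - 1 & x = s *: e k].
Proof.
move=> rx hno; have [A [hx oA _]] := rigid_support rx.
have [a aA] := block_neq0 hx; exists a.
have Aa : A = [fset a]%fset.
  apply/fsetP => l; rewrite inE; have [->//|la] := eqVneq l a.
  by apply/negbTE/negP => lA; exact: hno hx aA lA la.
have a1 : a != pone by apply: contraNneq oA => <-.
by case: (single_block hx Aa) => ->; [exists 1|exists (- 1)]; split; rewrite ?scale1r ?scaleN1r //;
  [left|right].
Qed.

Lemma psum_le_rest B y i : F B -> `|y| = 1 -> i \in B ->
  psum p (B `\ i)%fset (c y) <= 1 - `|c y i| `^ p.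
Proof. by move=> FB y1 iB; have := psum_le1 ce FB y1; rewrite (psumD1 _ _ iB); lra. Qed.

(** The value of |y +- e_i|^p when t = |y_i|, a norming set of y contains i and the signs agree: (1
    + t)^p at i and 1 - t^p elsewhere. It increases by [powR_swap]. *)
Definition phi (t : R) := (1 + t) `^ p + 1 - t `^ p.

Lemma phi_mono s t : 0 <= s -> 0 <= t -> phi s <= phi t -> s <= t.
Proof.
move=> s0 t0; rewrite /phi => h; rewrite leNgt; apply/negP => ts.
have := powR_swap p_gt1 t0 ts; lra.
Qed.

Lemma dist_le_phi y i (a : R) : `|y| = 1 -> `|a| = 1 -> `|y + a *: e i| `^ p <= phi `|c y i|.
Proof.
move=> y1 a1; have [A FA <-] := psum_attained ce (y + a *: e i).
rewrite (psum_add ce) /phi; case: ifP => iA.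
  have := psum_le_rest FA y1 iA.
  have : `|c y i + a| `^ p <= (1 + `|c y i|) `^ p.
    by rewrite (ler_powRp p1) ?addr_ge0 // addrC -a1 ler_normD.
  lra.
have := psum_le1 ce FA y1.
have : `|c y i| `^ p <= (1 + `|c y i|) `^ p by rewrite (ler_powRp p1) ?addr_ge0 // lerDr.
lra.
Qed.

Lemma dist_eq_phi A y i (a : R) : `|y| = 1 -> `|a| = 1 -> F A -> psum p A (c y) = 1 ->
  i \in A -> 0 <= a * c y i -> `|y + a *: e i| `^ p = phi `|c y i|.
Proof.
move=> y1 a1 FA sA iA ay; apply/le_anti; rewrite dist_le_phi //=.
apply: le_trans (psum_le ce _ FA); rewrite (psum_add ce) iA.
have -> : `|c y i + a| = 1 + `|c y i|.
  have -> : c y i + a = a * (1 + a * c y i).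
    have aa : a * a = 1 by rewrite -expr2 -real_normK ?num_real // a1 expr1n.
    by rewrite mulrDr mulr1 mulrA aa mul1r addrC.
  rewrite normrM a1 mul1r ger0_norm ?addr_ge0 //; congr (_ + _).
  by rewrite -[LHS]ger0_norm // normrM a1 mul1r.
by move: sA; rewrite (psumD1 _ _ iA) /phi; lra.
Qed.

(** * Basis vectors among the rigid vectors, p different from 2 *)

Section NotTwo.
Context (p_neq2 : p != 2).

(** The value 2^p is reached by x and its reflection y in one coordinate: that coordinate is doubled
    in x - y, the others in x + y. This y differs from x and - x once the support of x has two
    elements. *)
Definition off_clarkson x := forall y, rigid y -> y <> x -> y <> - x ->
  `|x - y| `^ p + `|x + y| `^ p <> 2 `^ p.

(** Since y is rigid, its support together with i is in [F], and both norms can be computed on it;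
    |y_i| < 1 because y is not +- e_i, so [clarkson_neq] applies. *)
Lemma off_clarkson_basis i : i != pone -> off_clarkson (e i).
Proof.
move=> i1 y ry yx yNx.
have [A [hy oA FA]] := rigid_support ry.
have [_ sA hA] := hy; have y1 := block_norm hy; have FiA := FA i i1.
have supp k (a : R) : k \notin (i |` A)%fset -> c (y + a *: e i) k = 0.
  rewrite !inE negb_or => /andP[ki kA].
  by rewrite (coordD ce) (coordZ ce) (coord_e_neq ce ki) mulr0 addr0 (support_out hy).
have nE (a : R) : `|y + a *: e i| `^ p = `|c y i + a| `^ p + (1 - `|c y i| `^ p).
  rewrite (norm_support p1 ce FiA) => [|k]; last exact: supp.
  rewrite (psum_add ce) !inE eqxx /=; congr (_ + _).
  have [iA|iA] := boolP (i \in A).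
    have -> : (i |` A)%fset = A by apply/fsetP => l; rewrite !inE; case: eqP => // ->.
    by move: sA; rewrite (psumD1 _ _ iA); lra.
  have -> : ((i |` A) `\ i)%fset = A.
    by apply/fsetP => l; rewrite !inE; case: eqP => // ->; rewrite (negbTE iA).
  by rewrite sA (support_out hy iA) normr0 powR0 // subr0.
have -> : `|e i - y| = `|y + -1 *: e i| by rewrite scaleN1r distrC.
have -> : `|e i + y| = `|y + 1 *: e i| by rewrite scale1r addrC.
rewrite !nE.
have yi1 : `|c y i| < 1.
  rewrite lt_neqAle -{2}y1 (coord_le p1 F_schreier ce) andbT; apply/eqP => yi.
  have iA : i \in A by rewrite hA -normr_eq0 yi oner_eq0.
  have Ai : A = [fset i]%fset.
    apply/fsetP => l; rewrite inE; have [->//|li] := eqVneq l i.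
    apply/negbTE/negP => lA.
    have := psum_miss p1 (B := [fset i]%fset) (support_out hy) lA.
    rewrite inE li => /(_ isT); rewrite psum1 yi powR1 sA.
    have : 0 < `|c y l| `^ p by rewrite powR_gt0 // normr_gt0 -hA.
    lra.
  by case: (single_block hy Ai).
have yi0 : 0 <= `|c y i| < 1 by rewrite normr_ge0.
have := clarkson_neq p_gt1 p_neq2 yi0 => /eqP; apply: contra_not => <-.
have e1 : `|1 + `|c y i| | = 1 + `|c y i| by rewrite ger0_norm // addr_ge0.
have e2 : `|1 - `|c y i| | = 1 - `|c y i| by rewrite ger0_norm // subr_ge0 ltW.
have [yi|yi] := leP 0 (c y i).
  rewrite (ger0_norm yi) in e1 e2 *.
  have -> : `|c y i + -1| = 1 - c y i by rewrite -normrN opprD opprK addrC e2.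
  have -> : `|c y i + 1| = 1 + c y i by rewrite addrC e1.
  by ring.
rewrite (ltr0_norm yi) in e1 e2 *.
have -> : `|c y i + -1| = 1 - c y i by rewrite -normrN opprD opprK addrC e1.
have -> : `|c y i + 1| = 1 + c y i by rewrite -[c y i]opprK addrC e2.
by rewrite opprK; ring.
Qed.

Lemma off_clarkson_single x : rigid x -> off_clarkson x ->
  exists k (s : R), [/\ k != pone, s = 1 \/ s = - 1 & x = s *: e k].
Proof.
move=> rx off; apply: (rigid_single rx) => A a a' hx aA a'A a'a.
have [FAA sA hA] := hx; have [_ x0 _] := rx.
have oA : pone \notin A by rewrite hA x0 eqxx.
have FA := (rigidP hx x0).1 rx.
have xa : c x a != 0 by rewrite -hA.
apply: (off (reflect_coord c e a x)).
- apply/(rigidP (reflect_block a hx)) => //; rewrite (coord_reflect ce) ifN ?(support_out hx oA) //.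
  by apply: contraNneq oA => ->.
- by move=> h; have := congr1 (fun x => c x a) h; rewrite /= (coord_reflect ce) eqxx => h';
    move/eqP: xa; apply; lra.
- move=> h; have := congr1 (fun x => c x a') h.
  rewrite /= (coord_reflect ce) (negbTE a'a) (coordN ce) => h'.
  by have : c x a' != 0; [rewrite -hA|move/eqP; apply; lra].
have out k : k \notin A -> c x k = 0 by exact: support_out hx k.
have outf k : k \notin A -> c (reflect_coord c e a x) k = 0 by exact: support_out (reflect_block a hx) k.
have -> : `|x - reflect_coord c e a x| `^ p = 2 `^ p * `|c x a| `^ p.
  rewrite (norm_support p1 ce FAA) => [|k kA]; last by rewrite (coordB ce) out // outf // subr0.
  rewrite (psumD1 _ _ aA) (coordB ce) (coord_reflect ce) eqxx opprK.
  rewrite [X in _ + X](_ : _ = 0) ?addr0.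
    by rewrite (_ : c x a + c x a = 2 * c x a) ?normrM ?powRM ?normr_nat //; ring.
  rewrite /psum big1_seq // => k /=; rewrite !inE => /andP[ka _].
  by rewrite (coordB ce) (coord_reflect ce) (negbTE ka) subrr normr0 powR0.
have -> : `|x + reflect_coord c e a x| `^ p = 2 `^ p * (1 - `|c x a| `^ p).
  rewrite (norm_support p1 ce FAA) => [|k kA]; last by rewrite (coordD ce) out // outf // addr0.
  rewrite (psumD1 _ _ aA) (coordD ce) (coord_reflect ce) eqxx subrr normr0 powR0 // add0r.
  rewrite (@eq_psum _ _ _ _ (c (2 *: x))) => [|k]; last first.
    rewrite !inE => /andP[ka _]; rewrite (coordD ce) (coord_reflect ce) (negbTE ka) (coordZ ce).
    by congr (`|_|); ring.
  by rewrite psumZ normr_nat; congr (_ * _); move: sA; rewrite (psumD1 _ _ aA); lra.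
by ring.
Qed.

Lemma basis_mapping_neq2 T T' : sphere_isometry T T' -> basis_mapping e T.
Proof.
move=> TT' i i1; have TT'' := sphere_isometry_sym TT'.
have [rT TN] := rigid_map TT' (rigid_basis i1).
have ei1 : `|e i| = 1 by exact: (norm_basis p1 F_schreier ce).
have Nei1 : `|- e i| = 1 by rewrite normrN.
have [|k [s [k1 s1 Te]]] := off_clarkson_single rT.
  move=> y ry yT yNT.
  have [[Zy _ _] [ru uN]] := (ry, rigid_map TT'' ry).
  have y1 := fs_norm blocks_system Zy; have u1 := si_norm' TT' y1.
  have Ny1 : `|- y| = 1 by rewrite normrN.
  have Nu1 : `|T' (- y)| = 1 by rewrite (si_norm' TT').
  have -> : `|T (e i) - y| = `|e i - T' y|.
    by rewrite -{1}(si_K' TT' y1) (si_dist TT').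
  have -> : `|T (e i) + y| = `|e i + T' y|.
    by rewrite -{1}[y]opprK -{1}(si_K' TT' Ny1) (si_dist TT') // uN opprK.
  apply: (off_clarkson_basis i1 ru) => h.
    by apply: yT; rewrite -(si_K' TT' y1) h.
  by apply: yNT; rewrite -TN -h (si_K' TT').
by exists k, s; split => //; rewrite TN Te.
Qed.

End NotTwo.

Definition equidistant x := forall z, unit_blocks z ->
  (forall y, face z y -> 2 <= `|x - y| `^ p) ->
  forall y y', face z y -> face z y' -> `|x - y| = `|x - y'|.

(** If z_i > 0, z itself is too close to e_i. If z_i < 0, the distances are given by [phi] at |z_i|.
    If z_i = 0, being far forces the support together with i into [F], so y_i = 0 on the face and
    the p-th power of the distance is 2. *)
Lemma equidistant_basis i : equidistant (e i).
Proof.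
move=> z [A hz] far.
have [FA sA hA] := hz; have z1 := block_norm hz.
have dE y : `|e i - y| = `|y + -1 *: e i| by rewrite scaleN1r distrC.
have n1 : `|-1 : R| = 1 by rewrite normrN1.
suff [r hr] : exists r, forall y, face z y -> `|y + -1 *: e i| `^ p = r.
  by move=> y y' fy fy'; rewrite !dE; apply: (powRp_inj p1) => //; rewrite !hr.
have far1 := far z (face_self z1); rewrite dE in far1.
have [B FB hB] := psum_attained ce (z + -1 *: e i); rewrite -hB (psum_add ce) in far1.
move: far1; case: ifP => iB far1; last by have := psum_le1 ce FB z1; lra.
have rest := psum_le_rest FB z1 iB.
have [zi|zi|zi] := ltrgt0P (c z i).
- exfalso; have zi1 := coord_le p1 F_schreier ce z i; rewrite z1 (gtr0_norm zi) in zi1.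
  have : `|c z i + -1| `^ p <= 1.
    by rewrite -[leRHS](pow1p p) (ler_powRp p1) // ler_norml; apply/andP; split; lra.
  have : 0 < `|c z i| `^ p by rewrite powR_gt0 // normr_gt0 gt_eqF.
  lra.
- exists (phi `|c z i|) => y /(face_block _ hz)[y1 yz].
  have iA : i \in A by rewrite hA lt_eqF.
  rewrite (dist_eq_phi y1 n1 FA) ?yz //; last by rewrite mulN1r oppr_ge0 ltW.
  by rewrite -sA; apply: eq_psum => k /yz->.
have iA : i \notin A by rewrite hA zi eqxx.
have FiA : F (i |` A)%fset.
  apply: (schreier_sub F_schreier FB); apply/fsubsetP => k; rewrite !inE => /orP[/eqP->//|].
  apply: fsubsetP; apply: (block_sub hz FB); move: far1.
  by rewrite zi add0r n1 powR1 (psumD1 _ _ iB) zi normr0 powR0 // add0r; lra.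
exists 2 => y /(face_block _ hz)[y1 yz].
have sAy : psum p A (c y) = 1 by rewrite -sA; apply: eq_psum => k /yz->.
have yi : c y i = 0.
  have := psum_le1 ce FiA y1; rewrite psumU1 // sAy => h.
  have : `|c y i| `^ p <= 0 by lra.
  by rewrite le_eqVlt ltNge powR_ge0 orbF powR_eq0 normr_eq0 => /andP[/eqP->].
apply/le_anti/andP; split.
  by have := dist_le_phi i y1 n1; rewrite yi normr0 /phi addr0 powR1 powR0 // subr0.
apply: le_trans (psum_le ce _ FiA); rewrite (psum_add ce) !inE eqxx /= yi add0r n1 powR1.
have -> : ((i |` A) `\ i)%fset = A.
  by apply/fsetP => l; rewrite !inE; case: eqP => // ->; rewrite (negbTE iA).
by rewrite sAy.
Qed.

(** * Basis vectors among the rigid vectors, p = 2 *)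

Section Two.
Context (p_eq2 : p = 2).

Let psum_sqr A (f : posN -> R) : psum p A f = \sum_(i <- A) f i ^+ 2.
Proof.
apply: eq_bigr => i _; rewrite p_eq2 powR_mulrn //.
by rewrite real_normK // num_real.
Qed.

(* On a maximal set M containing the support G of x, take v = - t x with the
   a-th coordinate reversed and with small entries eta on M \ G.  Since
   (1 - t) |x a| < eta, M \ a + b norms x - y more than M does for the point
   y = v - eta e_b of the face of v. *)
Lemma not_equidistant x G a a' : rigid x -> norming_support G x ->
  a \in G -> a' \in G -> a' != a -> `|c x a| <= `|c x a'| -> ~ equidistant x.
Proof.
move=> rx hx aG a'G a'a xaa' eqd.
have [FG sG hG] := hx.
have sqG : \sum_(i <- G) c x i ^+ 2 = 1 by rewrite -psum_sqr.
have sqGa : \sum_(i <- (G `\ a)%fset) c x i ^+ 2 = 1 - c x a ^+ 2.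
  by move: sqG; rewrite (big_fsetD1 a) //=; lra.
have xa2 : 2 * c x a ^+ 2 <= 1.
  have h1 : c x a ^+ 2 <= c x a' ^+ 2.
    by rewrite -[leLHS]real_normK ?num_real // -[leRHS]real_normK ?num_real // ler_sqr ?nnegrE.
  have : c x a' ^+ 2 <= \sum_(i <- (G `\ a)%fset) c x i ^+ 2.
    rewrite (big_fsetD1 a') ?inE ?a'a //= lerDl.
    by apply: sumr_ge0 => i _; exact: sqr_ge0.
  rewrite sqGa; lra.
have [M [FM GM maxM]] := maximal_superset (schreier_compact F_schreier) (schreier_sub F_schreier) FG.
pose N : R := \sum_(i <- M) (if i \in G then 0 else 1).
have N0 : 0 <= N by apply: sumr_ge0 => i _; case: ifP.
have sumM (u : posN -> R) (k : R) :
    \sum_(i <- M) (if i \in G then u i else k) = \sum_(i <- G) u i + k * N.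
  rewrite /N mulr_sumr [X in _ = X + _](eq_big_seq (fun i => if i \in G then u i else 0)); last by move=> i ->.
  rewrite [X in _ = X + _](big_fset_incl _ GM) => [|i _ /negbTE->//].
  rewrite -big_split /=; apply: eq_bigr => i _.
  by case: ifP => _; rewrite ?mulr0 ?addr0 ?mulr1 ?add0r.
have [m /andP[m0 m1] mx] := block_pos_min hx.
(* [N] counts [M \ G]. The factor N + 1 gives N eta <= 1/2, whence 1 - t <= eta / 2; the factor m
   keeps all entries of [v] at least eta in modulus, as [face_push] requires. *)
pose eta := m / (2 * (N + 1)).
have d0 : 0 < 2 * (N + 1) by lra.
have eta0 : 0 < eta by rewrite divr_gt0.
have etam : 2 * (N + 1) * eta = m by rewrite /eta mulrC divfK // gt_eqF.
have Neta : N * eta <= 2^-1 by nra.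
have Neta2 : 2 * (N * eta ^+ 2) <= eta by rewrite expr2; nra.
have eta2 : 2 * eta <= m by nra.
pose t := Num.sqrt (1 - N * eta ^+ 2).
have Nq : 0 <= 1 - N * eta ^+ 2 by lra.
have t2 : t ^+ 2 = 1 - N * eta ^+ 2 by rewrite sqr_sqrtr.
have t0 : 0 <= t by exact: sqrtr_ge0.
have Ne0 : 0 <= N * eta ^+ 2 by rewrite mulr_ge0 // sqr_ge0.
have tle : t <= 1 by rewrite expr2 in t2; nra.
have th : 1 - N * eta ^+ 2 <= t by rewrite -t2 expr2; nra.
have thalf : 2^-1 <= t by lra.
pose f i := if i == a then t * c x a else if i \in G then - (t * c x i) else - eta.
pose v := \sum_(i <- M) f i *: e i.
have vE i : c v i = if i \in M then f i else 0 by exact: (coord_vec ce).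
have aM : a \in M by exact: (fsubsetP GM).
have xout i : i \notin G -> c x i = 0 by exact: support_out hx i.
have fnz i : i \in M -> eta <= `|f i|.
  move=> iM; rewrite /f; have [ia|ia] := eqVneq i a.
    rewrite normrM (ger0_norm t0); have := mx a aG; nra.
  case: ifP => iG; last by rewrite normrN gtr0_norm.
  rewrite normrN normrM (ger0_norm t0); have := mx i iG; nra.
have hv : norming_support M v.
  split => //; last first.
    move=> i; rewrite vE; case: ifP => iM; last by rewrite eqxx.
    by rewrite -normr_gt0 (lt_le_trans eta0) // fnz.
  rewrite psum_sqr (eq_big_seq (fun i => if i \in G then t ^+ 2 * c x i ^+ 2 else eta ^+ 2)).
    by rewrite sumM -mulr_sumr sqG t2; ring.
  move=> i iM; rewrite vE iM /f; have [->|ia] := eqVneq i a; first by rewrite aG; ring.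
  by case: ifP => _; ring.
pose D := (1 - t) ^+ 2 * c x a ^+ 2 + (1 + t) ^+ 2 * (1 - c x a ^+ 2) + eta ^+ 2 * N.
have sD y : (forall i, i \in M -> c y i = c v i) -> psum p M (c (x - y)) = D.
  move=> yv; rewrite psum_sqr (eq_big_seq (fun i => if i \in G then
    (if i == a then (1 - t) ^+ 2 * c x a ^+ 2 else (1 + t) ^+ 2 * c x i ^+ 2) else eta ^+ 2)).
    rewrite sumM (big_fsetD1 a) //= eqxx; congr (_ + _ + _).
    rewrite -sqGa mulr_sumr; apply: eq_big_seq => i; rewrite !inE.
    by move=> /andP[/negbTE->].
  move=> i iM; rewrite (coordB ce) yv // vE iM /f; have [->|ia] := eqVneq i a.
    by rewrite aG; ring.
  by case: ifP => iG; [ring|rewrite xout ?iG //; ring].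
(* Here the choice of a as the smaller of two coordinates enters: x_a^2 <= 1/2, so the whole face is
   far from [x]. *)
have D2 : 2 <= D.
  have -> : D = 2 + 2 * t * (1 - 2 * c x a ^+ 2).
    have e1 : eta ^+ 2 * N = 1 - t ^+ 2 by rewrite t2; ring.
    by rewrite /D e1; ring.
  by rewrite lerDl mulr_ge0 ?mulr_ge0 // subr_ge0.
have [b bM] := fset_above M.
have bnM : b \notin M by apply/negP => /bM; rewrite ltnn.
have nFb : ~ F (b |` M)%fset by move=> /maxM; rewrite (negbTE bnM).
have fy : face v (v + - eta *: e b).
  by apply: face_push hv bnM nFb _ => i iM; rewrite normrN gtr0_norm // vE iM fnz.
have far y : face v y -> 2 <= `|x - y| `^ p.
  move=> /(face_block _ hv)[_ yv]; apply: le_trans D2 _.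
  by rewrite -(sD y yv) (psum_le ce).
have := eqd v (ex_intro _ M hv) far _ _ fy (face_self (block_norm hv)).
move=> /(congr1 (fun r => r `^ p)) /=.
have -> : `|x - v| `^ p = D.
  rewrite (norm_support p1 ce FM) ?sD // => i iM.
  rewrite (coordB ce) vE (negbTE iM) xout ?subr0 //.
  by apply: contra iM; exact: (fsubsetP GM).
have FH : F (b |` (M `\ a))%fset.
  exact: (spreading_shift (schreier_spread F_schreier) FM aM bnM (bM a aM)).
have := psum_le ce (x - (v + - eta *: e b)) FH.
have bnMa : b \notin (M `\ a)%fset by rewrite !inE (negbTE bnM) andbF.
rewrite psumU1 //.
have -> : c (x - (v + - eta *: e b)) b = eta.
  rewrite (coordB ce) (coordD ce) (coordZ ce) (coord_e_eq ce) vE (negbTE bnM).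
  rewrite xout; first by ring.
  by apply: contra bnM; exact: (fsubsetP GM).
have -> : psum p (M `\ a)%fset (c (x - (v + - eta *: e b))) = D - (1 - t) ^+ 2 * c x a ^+ 2.
  have := sD v (fun _ _ => erefl); rewrite (psumD1 _ _ aM).
  have -> : `|c (x - v) a| `^ p = (1 - t) ^+ 2 * c x a ^+ 2.
    rewrite -[LHS](psum1 p a (c (x - v))) psum_sqr big_seq_fset1 (coordB ce) vE aM /f eqxx; ring.
  move=> h; have -> : D - (1 - t) ^+ 2 * c x a ^+ 2 = psum p (M `\ a)%fset (c (x - v)) by lra.
  apply: eq_psum => i; rewrite !inE => /andP[_ iM].
  rewrite !(coordB ce) (coordD ce) (coordZ ce) (coord_e_neq ce) ?mulr0 ?addr0 //.
  by apply: contraNneq bnM => <-.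
have -> : `|eta| `^ p = eta ^+ 2.
  by rewrite p_eq2 powR_mulrn // real_normK // num_real.
move=> h1 h2; rewrite h2 in h1.
have : (1 - t) ^+ 2 * c x a ^+ 2 < eta ^+ 2.
  have h3 : 0 <= 1 - t by lra.
  have h4 : 1 - t <= eta / 2 by lra.
  have h5 : (1 - t) ^+ 2 <= (eta / 2) ^+ 2 by rewrite ler_sqr ?nnegrE // divr_ge0 // ltW.
  have h6 : 0 < eta ^+ 2 by rewrite exprn_gt0.
  have h7 : 0 <= c x a ^+ 2 by exact: sqr_ge0.
  have h8 : c x a ^+ 2 <= 1 by lra.
  have h9 : (1 - t) ^+ 2 * c x a ^+ 2 <= (1 - t) ^+ 2 by rewrite ler_piMr // sqr_ge0.
  have h10 : (eta / 2) ^+ 2 = eta ^+ 2 / 4 by field.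
  lra.
lra.
Qed.

Lemma equidistant_single x : rigid x -> equidistant x ->
  exists k (s : R), [/\ k != pone, s = 1 \/ s = - 1 & x = s *: e k].
Proof.
move=> rx eqd; apply: (rigid_single rx) => A a a' hx aA a'A a'a.
have [h|/ltW h] := leP `|c x a| `|c x a'|.
  exact: not_equidistant rx hx aA a'A a'a h eqd.
by apply: not_equidistant rx hx a'A aA _ h eqd; rewrite eq_sym.
Qed.

Lemma equidistant_map T T' x : sphere_isometry T T' -> `|x| = 1 -> equidistant x ->
  equidistant (T x).
Proof.
move=> TT' x1 eqd w Zw far; have TT'' := sphere_isometry_sym TT'.
have [z [Zz wz _]] := face_map blocks_system TT'' Zw.
have dT y : face w y -> face z (T' y) /\ `|T x - y| = `|x - T' y|.
  move=> fy; have y1 : `|y| = 1 by case: fy.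
  split; first exact/wz.
  by rewrite -{1}(si_K' TT' y1) (si_dist TT') // (si_norm' TT').
have far' u : face z u -> 2 <= `|x - u| `^ p.
  move=> fu; have u1 : `|u| = 1 by case: fu.
  rewrite -(si_dist TT') //; apply: far; apply/wz; first exact: si_norm TT' _ u1.
  by rewrite (si_K TT').
by move=> y y' /dT[fy ->] /dT[fy' ->]; exact: eqd far' _ _ fy fy'.
Qed.

Lemma basis_mapping_eq2 T T' : sphere_isometry T T' -> basis_mapping e T.
Proof.
move=> TT' i i1.
have [rT TN] := rigid_map TT' (rigid_basis i1).
have ei1 : `|e i| = 1 by exact: (norm_basis p1 F_schreier ce).
have [k [s [k1 s1 Te]]] := equidistant_single rT (equidistant_map TT' ei1 (@equidistant_basis i)).
by exists k, s; split => //; rewrite TN Te.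
Qed.

End Two.

Lemma basis_mapping_gt1 T T' : sphere_isometry T T' -> basis_mapping e T.
Proof.
have [p2|p2] := eqVneq p 2; first exact: basis_mapping_eq2.
exact: basis_mapping_neq2.
Qed.

(** * Coordinates on a norming set for p > 1 *)

Section Action.
Context (T T' : X -> X) (TT' : sphere_isometry T T').
Context (g : posN -> posN) (s : posN -> R) (Tgs : basis_action c e T g s).

Lemma dist_basis_eq y k : `|y| = 1 -> `|y - e k| = `|y + e k| -> c y k = 0.
Proof.
move=> y1 h; have [yk|yk|//] := ltrgt0P (c y k).
  by have := dist_basis_lt p1 F_schreier ce y1 yk; rewrite h ltxx.
have Ny1 : `|- y| = 1 by rewrite normrN.
have := dist_basis_lt p1 F_schreier ce (i := k) Ny1; rewrite (coordN ce) oppr_gt0 => /(_ yk).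
have -> : `|- y - e k| = `|y + e k| by rewrite -normrN opprB opprK addrC.
have -> : `|- y + e k| = `|y - e k| by rewrite -normrN opprD opprK.
by rewrite h ltxx.
Qed.

(** Indices of a norming set where x vanishes are not in the support of the block, so faces say
    nothing there; equal distances to e_i and - e_i do. *)
Lemma action_zero x i : `|x| = 1 -> i != pone -> c x i = 0 -> c (T x) (g i) = 0.
Proof.
move=> x1 i1 xi.
have h : `|x - e i| = `|x + e i|.
  have eq1 (a b : R) : `|a| = `|b| -> `|x + a *: e i| <= `|x + b *: e i|.
    move=> ab; apply: (norm_le_psum p1 ce) => // A FA; apply: le_trans (psum_le ce _ FA).
    by rewrite !(psum_add ce) xi !add0r ab.
  have h1 := eq1 (- 1) 1 (normrN 1); have h2 := eq1 1 (- 1) (esym (normrN 1)).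
  by rewrite scaleN1r scale1r in h1 h2; apply/le_anti; rewrite h1 h2.
have Tx1 := si_norm TT' x1; apply: dist_basis_eq => //.
rewrite -(basis_action_dist p1 F_schreier ce TT' Tgs x1 i1) in h.
rewrite -(basis_action_distN p1 F_schreier ce TT' Tgs x1 i1) in h.
case: (ba_sign Tgs i) h => ->; rewrite ?scale1r // ?scaleN1r opprK => h.
by rewrite h.
Qed.

(** Since B norms T z, the larger of its distances to +- e_(g i) is given exactly by [phi]; the same
    distance, measured at z, is at most [phi] of |z_i|. *)
Lemma block_image_le A B z w i : norming_support A z -> norming_support B w ->
  (forall y, `|y| = 1 -> face z y <-> face w (T y)) ->
  g i \in B -> `|c w (g i)| <= `|c z i|.
Proof.
move=> hz hw zw gB; have [FB sB hB] := hw.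
have z1 := block_norm hz; have Tz1 := si_norm TT' z1.
have /(face_block _ hw)[_ Tzw] : face w (T z) by apply/zw => //; exact: face_self.
rewrite -Tzw //.
have [->|i1] := eqVneq i pone.
  rewrite (ba_pone Tgs) (ba_coord Tgs) // normrM.
  by case: (ba_sign Tgs pone) => ->; rewrite ?normrN normr1 mul1r.
apply: phi_mono => //.
have [r [r1 ry]] : exists r : R, `|r| = 1 /\ 0 <= r * c (T z) (g i).
  have [h|/ltW h] := leP 0 (c (T z) (g i)).
    by exists 1; rewrite normr1 mul1r.
  by exists (- 1); rewrite normrN normr1 mulN1r oppr_ge0.
have sTz : psum p B (c (T z)) = 1 by rewrite -sB; apply: eq_psum => k /Tzw->.
rewrite -(dist_eq_phi Tz1 r1 FB sTz gB ry).
have [q q1 ->] : exists2 q : R, `|q| = 1 & `|T z + r *: e (g i)| = `|z + q *: e i|.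
  have hp := basis_action_distN p1 F_schreier ce TT' Tgs z1 i1.
  have hm := basis_action_dist p1 F_schreier ce TT' Tgs z1 i1.
  move/eqP: r1; rewrite eqr_norml ler01 andbT => /orP[]/eqP ->;
    case: (ba_sign Tgs i) hp hm => ->; rewrite ?scaleN1r ?scale1r ?opprK => hp hm.
  - by exists 1; rewrite ?normr1 // scale1r hp.
  - by exists (- 1); rewrite ?normrN1 // scaleN1r -hm.
  - by exists (- 1); rewrite ?normrN1 // scaleN1r -hm.
  - by exists 1; rewrite ?normr1 // scale1r -hp.
exact: dist_le_phi.
Qed.

(** On the preimage C of B the p-th powers of w sum to 1 and are dominated by those of z, whose
    total is 1. So all are equal, and C contains the support of z. *)
Lemma block_image_eq A B z w i : norming_support A z -> norming_support B w ->
  (forall y, `|y| = 1 -> face z y <-> face w (T y)) ->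
  i \in A -> g i \in B /\ `|c w (g i)| = `|c z i|.
Proof.
move=> hz hw zw iA; have [FB sB hB] := hw; have [FA sA hA] := hz.
have /choice[g' gg'] : forall k, exists i, g i = k by exact: ba_surj Tgs.
pose C := [fset g' k | k in B]%fset.
have BC : B = [fset g l | l in C]%fset.
  apply/fsetP => k; apply/idP/imfsetP => [kB|[l /imfsetP[k' /= k'B ->] ->]].
    by exists (g' k); [apply/imfsetP; exists k|rewrite gg'].
  by rewrite gg'.
have CB l : l \in C -> g l \in B by move=> lC; rewrite BC; apply/imfsetP; exists l.
have sC : \sum_(l <- C) `|c w (g l)| `^ p = 1.
  have <- : psum p [fset g l | l in C]%fset (c w) = \sum_(l <- C) `|c w (g l)| `^ p.
    by rewrite /psum big_imfset //= => k l _ _; exact: (ba_inj Tgs).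
  by rewrite -BC.
have le l : l \in C -> `|c w (g l)| `^ p <= `|c z l| `^ p.
  by move=> /CB gB; rewrite (ler_powRp p1) // (block_image_le hz hw zw gB).
have zC : psum p C (c z) <= 1 by rewrite -sA; apply: (psum_support p1); exact: support_out hz.
have eqC := ler_sum_eq le; rewrite sC in eqC; have {}eqC := eqC zC.
have iC : i \in C.
  apply: contraT => iC; have := psum_miss p1 (support_out hz) iA iC.
  have -> : psum p C (c z) = 1 by rewrite -sC; apply: eq_big_seq => l /eqC.
  rewrite sA; have : 0 < `|c z i| `^ p by rewrite powR_gt0 // normr_gt0 -hA.
  lra.
split; first exact: CB.
by apply: (powRp_inj p1) => //; exact: eqC.
Qed.

Lemma normed_coord_gt1 x A i : `|x| = 1 -> F A -> psum p A (c x) = 1 -> i \in A ->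
  c (T x) (g i) = s i * c x i.
Proof.
move=> x1 FA sA iA.
have [->|i1] := eqVneq i pone; first by rewrite (ba_pone Tgs) (ba_coord Tgs).
have [xi|xi] := eqVneq (c x i) 0; first by rewrite xi mulr0 action_zero.
apply: (signed_of_norm p1 F_schreier ce TT' Tgs) => //.
have [B [z [hz BA zx _]]] := restrict_block FA sA.
have [w [[C hw] zw _]] := face_map blocks_system TT' (ex_intro _ B hz : unit_blocks z).
have iB : i \in B by case: hz => _ _ ->; rewrite zx.
have [gC <-] : g i \in C /\ `|c w (g i)| = `|c x i|.
  by rewrite -zx //; exact: (block_image_eq hz hw zw iB).
have : face w (T x).
  apply/zw => //; apply/(face_block _ hz); split => // k kB.
  by rewrite zx // (fsubsetP BA).
by move=> /(face_block _ hw)[_ ->].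
Qed.

End Action.

Lemma extension_gt1 T T' : sphere_isometry T T' -> exists U : {linear X -> X},
  [/\ isometry_on [set: X] U, set_surj [set: X] [set: X] U
    & forall x, unit_sphere X x -> U x = T x].
Proof.
move=> TT'; have TT'' := sphere_isometry_sym TT'.
have [g [s Tgs]] := exists_basis_action p1 F_schreier ce TT'
  (basis_mapping_gt1 TT') (basis_mapping_gt1 TT'') (coord_pone_map2 TT').
apply: (linear_extension p1 F_schreier ce TT' (ba_sign Tgs) (ba_surj Tgs)).
exact: normed_coord_gt1 TT' _ _ Tgs.
Qed.

End ExponentGtOne.

(** * Application to the completion *)

Section Conclusion.
Context (R : realType) (p : R) (F : set {fset posN}).
Context (X : completeNormedModType R) (j : {linear c00 R -> X}).
Context (p_ge1 : 1 <= p) (F_schreier : schreier_family F).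
Context (F_pair : forall i k : posN, i != pone -> k != pone -> F [fset i; k]%fset).
Context (F_triple : forall i j k : posN, (2 < val i)%N -> (val i < val j)%N ->
  (val j < val k)%N -> F [fset i; j; k]%fset).
Context (X_completion : is_completion (schreier_norm F p) j).

Lemma sphere_isometry_of_surj (T : X -> X) :
  set_fun (unit_sphere X) (unit_sphere X) T -> set_surj (unit_sphere X) (unit_sphere X) T ->
  isometry_on (unit_sphere X) T -> exists T', sphere_isometry T T'.
Proof.
move=> Tf Ts Ti.
have /choice[T' hT'] : forall y, exists x, `|y| = 1 -> `|x| = 1 /\ T x = y.
  move=> y; have [y1|y1] := pselect (`|y| = 1); last by exists 0 => /y1.
  by have [x x1 <-] := Ts y y1; exists x.
exists T'; split.
- by move=> x x1; exact: Tf.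
- by move=> x /hT'[].
- move=> x x1; have [h1 h2] := hT' (T x) (Tf x x1).
  by apply/eqP; rewrite -subr_eq0 -normr_eq0 -Ti // h2 subrr normr0.
- by move=> x /hT'[].
- exact: Ti.
Qed.

Lemma schreier_sphere_isometries_extend : sphere_isometries_extend X.
Proof.
move=> T Tf Ts Ti; have [T' TT'] := sphere_isometry_of_surj Tf Ts Ti.
have [c [e ce]] : exists c e, coordinates p F (X := X) c e.
  by eexists; eexists; exact: completion_coordinates p_ge1 F_schreier X_completion.
move: (p_ge1); rewrite le_eqVlt => /orP[/eqP p1|p_gt1].
  rewrite -p1 in ce.
  exact: (extension1 F_schreier F_pair F_triple ce TT').
exact: (extension_gt1 p_gt1 F_schreier F_pair ce TT').
Qed.

End Conclusion.

Unset Implicit Arguments.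

Theorem theorem1p1 (d : Order.disp_t) (W : orderType d)
    (approx : W -> posN -> W) (S : W -> set {fset posN})
    (R : realType) (p : R) (alpha : W)
    (X : completeNormedModType R) (j : {linear c00 R -> X})
    (W_omega1 : is_omega1 W)
    (S_schreier : schreier_sequence approx S)
    (p_ge1 : 1 <= p)
    (alpha_ge1 : ~ is_zero alpha)
    (X_completion : is_completion (schreier_norm (S alpha) p) j) :
  (good approx S -> sphere_isometries_extend X) /\
  (p = 1 \/ p = 2 -> sphere_isometries_extend X).

Proof.
suff h : sphere_isometries_extend X by split.
have [W_wo _ _] := W_omega1.
apply: (@schreier_sphere_isometries_extend R p (S alpha) X j) => //.
- exact: schreier_family_seq W_wo S_schreier alpha.
- by move=> i k; exact: (schreier_pair W_wo S_schreier).
- by move=> i k l; exact: (schreier_triple W_wo S_schreier).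
Qed.
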